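(* Let $p>2$ and $2<q<\min\left\{4,\frac p2+1\right\}$. The following holds: (i) if $p\in(2,6)$, then $\mathcal{E}_{p,q}$ is negative on $(0,+\infty)$, strictly decreasing on $[0,\mu_{p,q})$, and $\mathcal{E}_{p,q}(\mu)=\mathcal{E}_{p,q}(\mu_{p,q})$ for every $\mu\geq\mu_{p,q}$, where $\mu_{p,q}>0$ is the threshold mass defined in the context. Furthermore, ground states exist at mass $\mu>0$ if and only if $\mu\in(0,\mu_{p,q}]$ and, for all such masses, they are unique up to a change of sign; (ii) if $p\geq6$, then $\mathcal{E}_{p,q}$ is negative on $(0,+\infty)$ and strictly decreasing on $[0,+\infty)$, and $\lim_{\mu\to+\infty}\mathcal{E}_{p,q}(\mu)>-\infty$. Furthermore, ground states exist and are unique (up to a change of sign) for every $\mu>0$. Moreover, in both cases, there exists $\overline{\mu}_{p,q}>0$ such that $\mathcal{E}_{p,q}$ is concave on $[0,\overline{\mu}_{p,q}]$ and convex on $[\overline{\mu}_{p,q},+\infty)$.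
   Context: Functions are real-valued. For $p,q>2$, $E_{p,q}(v):=\frac12\|v'\|_{L^2(\mathbb{R})}^2+\frac1p\|v\|_{L^p(\mathbb{R})}^p-\frac1q|v(0)|^q$ for $v\in H^1(\mathbb{R})$. For $\mu\geq0$, $H^1_\mu(\mathbb{R}):=\{v\in H^1(\mathbb{R}):\|v\|_{L^2(\mathbb{R})}^2=\mu\}$ and $\mathcal{E}_{p,q}(\mu):=\inf_{u\in H^1_\mu(\mathbb{R})}E_{p,q}(u)$ (so $\mathcal{E}_{p,q}(0)=0$). A ground state at mass $\mu$ is a function $u\in H^1_\mu(\mathbb{R})$ with $E_{p,q}(u)=\mathcal{E}_{p,q}(\mu)$. Threshold mass: for $2<p<6$ and $2<q<\frac p2+1$, $\mu_{p,q}$ is the positive number (which exists for such $p,q$) such that, for $\mu>0$, the problem $u''-|u|^{p-2}u=\lambda u$ on $\mathbb{R}\setminus\{0\}$, $u'(0^-)-u'(0^+)=|u(0)|^{q-2}u(0)$, $\|u\|_{L^2(\mathbb{R})}^2=\mu$ is satisfied (in the weak sense) by some $u\in H^1(\mathbb{R})$ and some $\lambda\geq0$ if and only if $\mu\leq\mu_{p,q}$. Here $u'(0^\pm)$ are the one-sided derivatives at $0$. *)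

(* Defs.v *)
From mathcomp Require Import all_boot all_order all_algebra.
From mathcomp Require Import all_classical all_reals all_analysis.

Set Implicit Arguments.
Unset Strict Implicit.
Unset Printing Implicit Defensive.

Import Order.TTheory GRing.Theory Num.Theory.
Import numFieldNormedType.Exports.

Local Open Scope classical_set_scope.
Local Open Scope ring_scope.

Section Sobolev.
Context {R : realType}.
Implicit Types (u g phi : R -> R).

Definition L2 u : Prop := u \in Lfun (@lebesgue_measure R) 2%:E.

Definition supp phi : set R := closure [set x | phi x != 0].

Definition C1c phi : Prop :=
  [/\ forall x, derivable phi x 1, continuous (derive1 phi) & compact (supp phi)].

Definition is_weak_derivative u g : Prop :=
  forall phi, C1c phi ->
    (\int[lebesgue_measure]_x (u x * derive1 phi x)) =
    - (\int[lebesgue_measure]_x (g x * phi x)).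

(* Elements of H^1(R) are represented by their unique continuous
   representative, so that u 0 is meaningful and equality in H^1(R) is
   pointwise equality. *)
Definition H1 u : Prop :=
  [/\ continuous u, L2 u & exists2 g, L2 g & is_weak_derivative u g].

(* Determined up to a.e. equality when H1 u; the zero function otherwise. *)
Definition wderiv u : R -> R :=
  xget (cst 0) [set g | L2 g /\ is_weak_derivative u g].

Definition Lpnorm (p : R) u : \bar R :=
  'N[@lebesgue_measure R]_p%:E[EFin \o u]%E.

Definition H1mass (mu : R) u : Prop :=
  H1 u /\ (Lpnorm 2 u `^ 2)%E = mu%:E.

End Sobolev.

Section GroundStates.
Context {R : realType}.
Implicit Types (p q mu m lam : R) (u v : R -> R).

Definition energy p q v : \bar R :=
  (2^-1%:E * Lpnorm 2 (wderiv v) `^ 2 + p^-1%:E * Lpnorm p v `^ p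
   - (q^-1 * `|v 0| `^ q)%:E)%E.

Definition ground_energy p q mu : \bar R :=
  ereal_inf [set energy p q u | u in [set u | H1mass mu u]].

Definition ground_state p q mu u : Prop :=
  H1mass mu u /\ energy p q u = ground_energy p q mu.

(* u'' - |u|^(p-2) u = lam u on R \ {0}, tested against C^1 functions compactly
   supported away from 0. *)
Definition weak_equation p lam u : Prop :=
  forall phi, C1c phi -> ~ supp phi 0 ->
    - (\int[lebesgue_measure]_x (wderiv u x * derive1 phi x))
    - (\int[lebesgue_measure]_x (`|u x| `^ (p - 2) * u x * phi x))
    = lam * (\int[lebesgue_measure]_x (u x * phi x)).

Definition jump_condition q u : Prop :=
  exists dl dr : R,
    [/\ (u h - u 0) / h @[h --> 0^'-] --> dl,
        (u h - u 0) / h @[h --> 0^'+] --> dr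
      & dl - dr = `|u 0| `^ (q - 2) * u 0].

Definition bound_state_exists p q mu : Prop :=
  exists u lam, [/\ 0 <= lam, H1mass mu u, weak_equation p lam u
                  & jump_condition q u].

Definition is_threshold_mass p q m : Prop :=
  0 < m /\ forall mu, 0 < mu -> (bound_state_exists p q mu <-> mu <= m).

Definition strictly_decreasing_on (I : interval R) (f : R -> \bar R) : Prop :=
  {in I &, {homo f : x y / (x < y)%R >-> (y < x)%E}}.

Definition convex_on (I : interval R) (f : R -> R) : Prop :=
  @convex_function R R^o [set` I] f.

Definition concave_on (I : interval R) (f : R -> R) : Prop :=
  convex_on I (fun x => - f x).

Definition ground_state_unique p q mu : Prop :=
  forall u v, ground_state p q mu u -> ground_state p q mu v ->
    u = v \/ u = - v.

End GroundStates.

(* Main.v *)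
(* Let S_l(s) = s sqrt(l + (2/p) |s|^(p-2)), so that u' = - sgn(x) S_l(u) is the
   decaying branch of u'' = l u + |u|^(p-2) u.  Completing the square gives, for
   every v of mass m and every l >= 0,
     E(v) = F_l(|v(0)|) - l m / 2 + (1/2) \int (v' + sgn(x) S_l(v))^2,
   where F_l(a) = 2 \int_0^a S_l - a^q / q.  The square vanishes exactly on the
   decaying profiles, which are explicit powers of a hyperbolic cosine plus sine,
   so minimising E is a problem in the amplitude a alone.  A critical amplitude of
   F_l has frequency l = lam(a) = a^(2q-4)/4 - (2/p) a^(p-2), which increases up
   to amp_peak and then decreases to 0 at amp_max, while the mass of the profile is
   increasing in a.  Since the energy curve has slope - lam(a)/2 at the mass of a,
   it is concave up to the mass of amp_peak and convex beyond it.  For p < 6 the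
   profile of amplitude amp_max (l = 0) has finite mass, the threshold; the excess
   of a larger mass is carried away at no cost by a low and wide bump.  For p >= 6
   that mass is infinite.  Conversely, the first integral u'^2 - S_l(u)^2 of a
   bound state vanishes at infinity, so every bound state is such a profile. *)
Require Import Defs.
From mathcomp Require Import all_boot all_order all_algebra.
From mathcomp Require Import all_classical all_reals all_analysis.
From mathcomp Require Import measurable_realfun ring lra.

Set Implicit Arguments.
Unset Strict Implicit.
Unset Printing Implicit Defensive.

Import Order.TTheory GRing.Theory Num.Theory.
Import numFieldNormedType.Exports.
Local Open Scope classical_set_scope.
Local Open Scope ring_scope.

(** * Pointwise calculus: derivatives, continuity, monotonicity from the sign of the derivative *)

Section PointwiseCalculus.
Context {R : realType}.
Implicit Types (f g : R -> R) (x a b k : R).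

(** The obstacle is that the calibration with l = lam(a) does not suffice below [amp_peak]. By
    [action_derive], F_l at s has a derivative with the sign of l - lam(s); so a is a local minimum
    of F_lam(a) where lam decreases, but a local maximum where lam increases. The multiplier l must
    therefore depend on the amplitude b of the competitor, and [optimal_min] supplies one for each b
    different from a. Its comparisons rest on the relation d crit = (M/2) d lam along critical
    amplitudes, with M the mass and crit(a) = F_lam(a)(a). The mass is never differentiated: the
    relation is replaced by a tangent inequality, which says that the square in the calibration is
    nonnegative for the profile of amplitude a and a foreign frequency l; this inequality is then
    summed over fine subdivisions. Beyond the threshold the bump is d exp(-c|x|), added to the
    profile of frequency 0, with c small and d fixed by the missing mass, overlap included. *)

Lemma is_derive_addf f g x a b : is_derive x 1 f a -> is_derive x 1 g b ->
  is_derive x 1 (fun t => f t + g t) (a + b).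
Proof. exact: is_deriveD. Qed.

Lemma is_derive_subf f g x a b : is_derive x 1 f a -> is_derive x 1 g b ->
  is_derive x 1 (fun t => f t - g t) (a - b).
Proof. exact: is_deriveB. Qed.

Lemma is_derive_oppf f x a : is_derive x 1 f a ->
  is_derive x 1 (fun t => - f t) (- a).
Proof. exact: is_deriveN. Qed.

Lemma is_derive_mulf f g x a b : is_derive x 1 f a -> is_derive x 1 g b ->
  is_derive x 1 (fun t => f t * g t) (f x * b + a * g x).
Proof. by move=> fa gb; rewrite [a * _]mulrC; have := is_deriveM fa gb. Qed.

Lemma is_derive_cstf k x : is_derive x 1 (fun _ : R => k) 0.
Proof. exact: is_derive_cst. Qed.

Lemma is_derive_idf x : is_derive x 1 (fun t : R => t) 1.
Proof. exact: is_derive_id. Qed.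

Lemma is_derive_scalef f x a k : is_derive x 1 f a ->
  is_derive x 1 (fun t => k * f t) (k * a).
Proof.
move=> fa; have := is_derive_mulf (is_derive_cstf k x) fa.
by rewrite mul0r addr0.
Qed.

Lemma is_derive_compf f g x a b : is_derive (g x) 1 f a -> is_derive x 1 g b ->
  is_derive x 1 (fun t => f (g t)) (a * b).
Proof. exact: is_derive1_comp. Qed.

Lemma is_derive_addcf f x a k : is_derive (x + k) 1 f a ->
  is_derive x 1 (fun t => f (t + k)) a.
Proof.
move=> fa; have := @is_derive_compf f (fun t => t + k) x _ _ fa
    (is_derive_addf (is_derive_idf x) (is_derive_cstf k x)).
by move/trigger_derive; apply; rewrite addr0 mulr1.
Qed.

Lemma is_derive_nearf f g x a : (\forall t \near x, f t = g t) ->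
  is_derive x 1 f a -> is_derive x 1 g a.
Proof. exact: (@near_eq_is_derive R R^o R^o f g x 1 a). Qed.

Lemma is_derive_sqrf f x a : is_derive x 1 f a ->
  is_derive x 1 (fun t => f t ^+ 2) (2 * f x * a).
Proof.
by move=> fa; apply: (trigger_derive (is_derive_mulf fa fa)); ring.
Qed.

Lemma is_derive_cont f x a : is_derive x 1 f a -> {for x, continuous f}.
Proof.
by move=> fa; apply: differentiable_continuous; apply/derivable1_diffP; have [] := fa.
Qed.

Lemma is_derive_continuous f (df : R -> R) : (forall x, is_derive x 1 f (df x)) ->
  continuous f.
Proof. by move=> h x; exact: (is_derive_cont (h x)). Qed.

Lemma is_derive_derive1 f x a : is_derive x 1 f a -> derive1 f x = a.
Proof. by move=> fa; rewrite derive1E (@derive_val _ _ _ _ _ _ _ fa). Qed.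

Lemma continuous_addf f g : continuous f -> continuous g ->
  continuous (fun t => f t + g t).
Proof. by move=> cf cg x; exact: continuousD (cf x) (cg x). Qed.

Lemma continuous_subf f g : continuous f -> continuous g ->
  continuous (fun t => f t - g t).
Proof. by move=> cf cg x; exact: continuousB (cf x) (cg x). Qed.

Lemma continuous_oppf f : continuous f -> continuous (fun t => - f t).
Proof. by move=> cf x; exact: continuousN (cf x). Qed.

Lemma continuous_mulf f g : continuous f -> continuous g ->
  continuous (fun t => f t * g t).
Proof. by move=> cf cg x; exact: continuousM (cf x) (cg x). Qed.

Lemma continuous_cstf k : continuous (fun _ : R => k).
Proof. by move=> x; exact: cst_continuous. Qed.

Lemma continuous_idf : continuous (fun t : R => t).
Proof. by move=> x; exact: cvg_id. Qed.

Lemma continuous_compf f g : continuous f -> continuous g ->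
  continuous (fun t => f (g t)).
Proof. by move=> cf cg x; exact: (@continuous_comp _ _ _ g f x (cg x) (cf (g x))). Qed.

Lemma continuous_normf f : continuous f -> continuous (fun t => `|f t|).
Proof. by move=> cf x; exact: (@continuous_comp _ _ _ f _ x (cf x) (@norm_continuous _ _ (f x))). Qed.

Lemma within_derive f (df : R -> R) s t :
  (forall x, s <= x -> x <= t -> is_derive x 1 f (df x)) -> {within `[s, t], continuous f}.
Proof.
move=> d; apply: continuous_in_subspaceT => x /set_mem/=; rewrite in_itv/= => /andP[sx xt].
exact: is_derive_cont (d x sx xt).
Qed.

Lemma derive_gt0_lt f (df : R -> R) s t : s < t -> {within `[s, t], continuous f} ->
  (forall x, s < x -> x < t -> is_derive x 1 f (df x)) ->
  (forall x, s < x -> x < t -> 0 < df x) -> f s < f t.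
Proof.
move=> st cf d df0.
have dx x : x \in `]s, t[ -> is_derive x 1 f (df x).
  by rewrite in_itv/= => /andP[]; exact: d.
have [c] := MVT st dx cf; rewrite in_itv/= => /andP[sc ct] E.
by rewrite -subr_gt0 E mulr_gt0 ?df0// subr_gt0.
Qed.

Lemma derive_ge0_le f (df : R -> R) s t : s <= t -> {within `[s, t], continuous f} ->
  (forall x, s < x -> x < t -> is_derive x 1 f (df x)) ->
  (forall x, s < x -> x < t -> 0 <= df x) -> f s <= f t.
Proof.
rewrite le_eqVlt => /orP[/eqP->//|st] cf d df0.
have dx x : x \in `]s, t[ -> is_derive x 1 f (df x).
  by rewrite in_itv/= => /andP[]; exact: d.
have [c] := MVT st dx cf; rewrite in_itv/= => /andP[sc ct] E.
by rewrite -subr_ge0 E mulr_ge0 ?df0// subr_ge0 ltW.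
Qed.

End PointwiseCalculus.

(** * Comparison of increments without derivatives *)

Section Telescoping.
Context {R : realType}.
Implicit Types (T V : R -> R) (a b c e x : R).

Lemma le0_of_le_eps x c : (forall e, 0 < e -> x <= e * c) -> x <= 0.
Proof.
move=> H; rewrite leNgt; apply/negP => x0.
have [c0|c0] := leP c 0.
  have := H 1 ltr01; lra.
have /H : 0 < x / (2 * c) by apply: divr_gt0 => //; lra.
rewrite invfM mulrA -mulrA mulVf ?gt_eqF//; lra.
Qed.

(** A substitute for the sign of a derivative: near each x, over intervals containing x, the
    increments of T need only be at most e times those of a fixed gauge V. The proof takes the
    supremum of the points up to which the summed inequality holds and pushes past it. *)
Lemma telescope_le T V a b : a <= b ->
  (forall e, 0 < e -> forall x, a <= x -> x <= b -> exists2 d, 0 < d &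
     forall s t, a <= s -> s <= x -> x <= t -> t <= b -> x - d < s -> t < x + d ->
       T t - T s <= e * (V t - V s)) ->
  T b <= T a.
Proof.
move=> ab H; rewrite -subr_le0; apply: (@le0_of_le_eps _ (V b - V a)) => e e0.
pose A := [set c | [/\ a <= c, c <= b & T c - T a <= e * (V c - V a)]].
have Aa : A a by split => //; rewrite !subrr mulr0.
have Ab : ubound A b by move=> c [].
have supA : has_sup A by split; [exists a|exists b].
have asup : a <= sup A by apply: ub_le_sup => //; exists b.
have supb : sup A <= b by apply: ge_sup => //; exists a.
have [d d0 Hd] := H e e0 _ asup supb.
have [s As ds] := sup_adherent d0 supA.
have ssup : s <= sup A by apply: ub_le_sup => //; exists b.
case: As => as_ sb hs.
have step t : sup A <= t -> t <= b -> t < sup A + d -> A t.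
  move=> st tb td; split => //; first lra.
  have := Hd s t as_ ssup st tb ds td; lra.
have [supb'|bsup] := ltP (sup A) b; last first.
  have e1 : sup A = b by apply/eqP; rewrite eq_le supb.
  by have [//|//||_ _] := step b; lra.
pose t := Num.min b (sup A + d / 2).
have st : sup A < t by rewrite lt_min supb'/=; lra.
have tb : t <= b by rewrite ge_min lexx.
have td : t < sup A + d by rewrite gt_min; apply/orP; right; lra.
have : t <= sup A by apply: ub_le_sup; [exists b|apply: step => //; exact: ltW].
lra.
Qed.

End Telescoping.

(** * Integrals over intervals, absolutely continuous functions, Lebesgue points *)

Section IntegralToolbox.
Context {R : realType}.
Notation mu := (@lebesgue_measure R).
Implicit Types (f g u v : R -> R) (a b c x y : R).

Lemma itgS f (A B : set (measurableTypeR R)) : measurable A -> measurable B -> B `<=` A ->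
  mu.-integrable A (EFin \o f) -> mu.-integrable B (EFin \o f).
Proof. by move=> mA mB BA; apply: integrableS. Qed.

Lemma itgD f g (A : set (measurableTypeR R)) : measurable A -> mu.-integrable A (EFin \o f) ->
  mu.-integrable A (EFin \o g) -> mu.-integrable A (EFin \o (fun x => f x + g x)).
Proof. by move=> mA fi gi; have := integrableD mA fi gi; apply. Qed.

Lemma itgZ k f (A : set (measurableTypeR R)) : measurable A -> mu.-integrable A (EFin \o f) ->
  mu.-integrable A (EFin \o (fun x => k * f x)).
Proof. by move=> mA fi; have := integrableZl mA k fi; apply. Qed.

Lemma itgB f g (A : set (measurableTypeR R)) : measurable A -> mu.-integrable A (EFin \o f) ->
  mu.-integrable A (EFin \o g) -> mu.-integrable A (EFin \o (fun x => f x - g x)).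
Proof. by move=> mA fi gi; have := integrableB mA fi gi; apply. Qed.

Lemma itg_itvS f a b c d : a <= c -> d <= b ->
  mu.-integrable `[a, b] (EFin \o f) -> mu.-integrable `[c, d] (EFin \o f).
Proof.
move=> ac db; apply: itgS => //.
by apply: subset_itv; rewrite bnd_simp.
Qed.

Lemma itg_itv_setT f (i : interval R) : mu.-integrable setT (EFin \o f) ->
  mu.-integrable [set` i] (EFin \o f).
Proof. by apply: itgS. Qed.

Lemma continuous_measurable f (A : set (measurableTypeR R)) : measurable A -> continuous f ->
  measurable_fun A f.
Proof.
move=> mA cf; apply: measurable_funTS; exact: measurable_realfun.continuous_measurable_fun.
Qed.

Lemma continuous_itg f a b : continuous f ->
  mu.-integrable `[a, b] (EFin \o f).
Proof.
move=> cf; apply: continuous_compact_integrable; first exact: segment_compact.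
exact: continuous_subspaceT.
Qed.

Lemma Rint_split f a c b : a <= c -> c <= b ->
  mu.-integrable `[a, b] (EFin \o f) ->
  \int[mu]_(x in `[a, b]) f x =
  \int[mu]_(x in `[a, c]) f x + \int[mu]_(x in `[c, b]) f x.
Proof.
move=> ac cb fi.
have := @Rintegral_itvB R f (BLeft a) (BRight b) c fi.
rewrite !bnd_simp => /(_ ac cb).
rewrite Rintegral_itv_obnd_cbnd; last first.
  apply: itgS fi => //; apply: subset_itv; rewrite bnd_simp//.
move=> <-; ring.
Qed.

Lemma Rint_point f a : \int[mu]_(x in `[a, a]) f x = 0.
Proof. by rewrite set_itv1 Rintegral_set1. Qed.

Lemma Rint_cst a b c : a <= b -> \int[mu]_(x in `[a, b]) c = c * (b - a).
Proof.
move=> ab; rewrite Rintegral_cst//= lebesgue_measure_itv/= lte_fin.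
have [ab'|ba] := ltP a b; first by rewrite -EFinB.
by rewrite (_ : b = a) ?subrr//; apply/eqP; rewrite eq_le ab ba.
Qed.

(* Absolute continuity of [u] with derivative [g], in integrated form. *)
Definition primitive_on a b u g : Prop :=
  mu.-integrable `[a, b] (EFin \o g) /\
  forall s t, a <= s -> s <= t -> t <= b ->
    u t - u s = \int[mu]_(x in `[s, t]) g x.

Lemma itg_mul_cont f g a b : continuous f ->
  mu.-integrable `[a, b] (EFin \o g) ->
  mu.-integrable `[a, b] (EFin \o (f \* g)).
Proof.
move=> cf gi.
have -> : EFin \o (f \* g) = ((EFin \o f) \* (EFin \o g))%E by apply/funext => x.
apply: integrableMr => //.
  exact: continuous_measurable.
have [ab|ba] := leP a b; last first.
  rewrite set_itv_ge ?bnd_simp -?ltNge//.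
  exists 0; split => // x _ y /=; by [].
have cn : {within `[a, b], continuous (fun x => `|f x|)}.
  apply: continuous_subspaceT => x; apply: continuous_comp; first exact: cf.
  exact: norm_continuous.
have [c _ hc] := EVT_max ab cn.
exists `|f c|; split; first exact: num_real.
move=> x xc y /= yab; apply: le_trans (ltW xc); exact: hc.
Qed.

(** Since [g] is merely integrable, there is no pointwise derivative to compose. On a short interval
    the increment of G o u is S(u c) times that of u, and replacing S(u c) by S(u y) under the
    integral costs at most e times the integral of |g|, which serves as the gauge of
    [telescope_le]. *)
Lemma chain_primitive (G S : R -> R) a b u g : a <= b -> continuous u ->
  continuous S -> (forall x, is_derive x 1 G (S x)) -> primitive_on a b u g ->
  primitive_on a b (G \o u) (fun x => S (u x) * g x).
Proof.
move=> ab cu cS dG pug; have [gi ug] := pug.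
have cSu : continuous (S \o u) by move=> x; apply: continuous_comp; [exact: cu|exact: cS].
have Sgi : mu.-integrable `[a, b] (EFin \o (fun x => S (u x) * g x)).
  exact: (@itg_mul_cont (S \o u) g).
split => // s t as_ st tb.
have cG : continuous G.
  by move=> x; apply: differentiable_continuous; apply/derivable1_diffP; have [] := dG x.
(* The two signs give the two inequalities whose conjunction is the equality. *)
have key (sg : bool) : (-1) ^+ sg * (G (u t) - \int[mu]_(x in `[s, t]) (S (u x) * g x))
   <= (-1) ^+ sg * (G (u s) - \int[mu]_(x in `[s, s]) (S (u x) * g x)).
  pose T c := (-1) ^+ sg * (G (u c) - \int[mu]_(x in `[s, c]) (S (u x) * g x)).
  pose V c := \int[mu]_(x in `[s, c]) `|g x|.
  apply: (@telescope_le _ T V s t st) => e e0 x sx xt.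
  have : \forall y \near x, `|S (u x) - S (u y)| < e / 2.
    by have /cvgrPdist_lt := cSu x; apply; lra.
  move=> [d /= d0 hd]; exists d => // s' t' ss' s'x xt' t't ds' dt'.
  have s't' : s' <= t' by lra.
  have as' := le_trans as_ ss'; have t'b := le_trans t't tb.
  have near_x y : s' <= y -> y <= t' -> `|S (u x) - S (u y)| < e / 2.
    by move=> h1 h2; apply: hd; rewrite /ball/= ltr_norml; lra.
  (* The mean value theorem for G gives a value between u s' and u t'; the intermediate value
     theorem for u pulls it back to a point c. *)
  have [c /andP[]] : exists2 c, s' <= c <= t' & G (u t') - G (u s') = S (u c) * (u t' - u s').
    have dGu (y : R) : is_derive y 1 G (S y) by exact: dG.
    pose m := Num.min (u s') (u t'); pose M := Num.max (u s') (u t').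
    have mM : m <= M by rewrite ge_min le_max lexx.
    have [xi xim eq] := @MVT_segment _ G S m M mM (fun y _ => dG y) (continuous_subspaceT cG).
    have xim' : m <= xi <= M by rewrite !(itvP xim).
    have [c cst uc] := @IVT _ u s' t' xi s't' (continuous_subspaceT cu) xim'.
    exists c; first by rewrite !(itvP cst).
    rewrite uc; move: eq; rewrite /m /M; have [h|h] := leP (u s') (u t'); first by [].
    move=> h1; lra.
  move=> s'c ct' eqG.
  have Sg' : mu.-integrable `[s', t'] (EFin \o (fun x => S (u x) * g x)).
    exact: itg_itvS Sgi.
  have g' : mu.-integrable `[s', t'] (EFin \o g) by exact: itg_itvS gi.
  have gn' : mu.-integrable `[s', t'] (EFin \o (fun x => `|g x|)) by exact: integrable_norm.
  have gn : mu.-integrable `[s, t'] (EFin \o (fun x => `|g x|)).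
    exact: integrable_norm (itg_itvS as_ t'b gi).
  rewrite /T /V (Rint_split ss' s't' (itg_itvS as_ t'b Sgi)).
  rewrite [in X in _ <= _ * X](Rint_split ss' s't')//.
  rewrite [_ + _ - _]addrAC subrr add0r.
  have -> : (-1) ^+ sg * (G (u t') - (\int[mu]_(x0 in `[s, s']) (S (u x0) * g x0) +
      \int[mu]_(x0 in `[s', t']) (S (u x0) * g x0))) -
    (-1) ^+ sg * (G (u s') - \int[mu]_(x0 in `[s, s']) (S (u x0) * g x0)) =
    (-1) ^+ sg * ((G (u t') - G (u s')) - \int[mu]_(x0 in `[s', t']) (S (u x0) * g x0)).
    ring.
  rewrite eqG (ug s' t' as' s't' t'b).
  rewrite -RintegralZl// -RintegralB//; last exact: itgZ.
  apply: (le_trans (ler_norm _)); rewrite normrM normrX normrN1 expr1n mul1r.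
  apply: (le_trans (le_normr_Rintegral _ _)) => //.
    by apply: itgB => //; exact: itgZ.
  rewrite -RintegralZl//; apply: le_Rintegral => //.
  - apply: integrable_norm => //.
    by apply: itgB => //; exact: itgZ.
  - exact: itgZ.
  - move=> y /=; rewrite in_itv/= => /andP[y1 y2].
    rewrite -mulrBl normrM ler_wpM2r//.
    have h1 := near_x c s'c ct'; have h2 := near_x y y1 y2.
    rewrite (_ : S (u c) - S (u y) = (S (u x) - S (u y)) - (S (u x) - S (u c))); last ring.
    apply: (le_trans (ler_normB _ _)); lra.
have := key false; have := key true.
rewrite Rint_point subr0 expr0 expr1 !mul1r !mulN1r /=; lra.
Qed.

Lemma primitive_onD a b u g v h : primitive_on a b u g -> primitive_on a b v h ->
  primitive_on a b (u \+ v) (g \+ h).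
Proof.
move=> [gi ug] [hi vh]; split.
  by exact: itgD.
move=> s t as_ st tb /=; rewrite RintegralD//; [|by apply: itg_itvS gi|by apply: itg_itvS hi].
by rewrite -ug// -vh//; ring.
Qed.

Lemma primitive_onZ a b u g k : primitive_on a b u g ->
  primitive_on a b (fun x => k * u x) (fun x => k * g x).
Proof.
move=> [gi ug]; split.
  exact: itgZ.
move=> s t as_ st tb /=; rewrite RintegralZl//; [|by apply: itg_itvS gi].
by rewrite -ug//; ring.
Qed.

(** Polarisation: 4 u v = (u + v)^2 - (u - v)^2 reduces the product rule to the chain rule for
    squares. *)
Lemma primitive_onM a b u g v h : a <= b -> continuous u -> continuous v ->
  primitive_on a b u g -> primitive_on a b v h ->
  primitive_on a b (u \* v) (fun x => u x * h x + v x * g x).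
Proof.
move=> ab cu cv ug vh.
have sq w k : continuous w -> primitive_on a b w k ->
    primitive_on a b (fun x => w x ^+ 2) (fun x => 2 * w x * k x).
  move=> cw wk.
  apply: (@chain_primitive (fun x => x ^+ 2) (fun x => 2 * x)) => //.
    by move=> x; apply: (@continuousM _ _ (cst 2) id); [exact: cst_continuous|exact: cvg_id].
  move=> x; have := is_deriveX 2 (is_derive_id x (1 : R)).
  by move/trigger_derive; apply; rewrite /GRing.scale/= mulr1 expr1.
have h1 := sq _ _ (fun x => continuousD (cu x) (cv x)) (primitive_onD ug vh).
have h2 := sq _ _ (fun x => continuousD (cu x) (continuousM (@cst_continuous R R (-1) x) (cv x)))
  (primitive_onD ug (primitive_onZ (-1) vh)).
have := primitive_onD (primitive_onZ (4^-1) h1) (primitive_onZ (- 4^-1) h2).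
congr primitive_on; by apply/funext => x; rewrite !fctE /=; field.
Qed.

Lemma Rint_supp f a b : (forall x, ~ `[a, b]%classic x -> f x = 0) ->
  \int[mu]_x f x = \int[mu]_(x in `[a, b]) f x.
Proof.
move=> f0; rewrite [RHS]Rintegral_mkcond; congr Rintegral.
apply/funext => x; rewrite patchE; case: ifPn => // /negP xab.
by apply: f0 => xab'; apply: xab; exact: mem_set.
Qed.

Lemma Rint_derive u k s t : s <= t -> continuous k -> {within `[s, t], continuous u} ->
  (forall x, s < x -> x < t -> is_derive x 1 u (k x)) ->
  \int[mu]_(x in `[s, t]) k x = u t - u s.
Proof.
rewrite le_eqVlt => /orP[/eqP->|st] ck cu du; first by rewrite Rint_point subrr.
have [_ cs ct] := (continuous_within_itvP u st).1 cu.
rewrite /Rintegral (@continuous_FTC2 R k u s t st (continuous_subspaceT ck))//.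
- split; [|exact: cs|exact: ct].
  by move=> x; rewrite in_itv/= => /andP[sx xt]; have [] := du x sx xt.
- by move=> x; rewrite in_itv/= => /andP[sx xt]; exact: is_derive_derive1 (du x sx xt).
Qed.

Lemma primitive_C1 u g a b : (forall x, is_derive x 1 u (g x)) -> continuous g ->
  primitive_on a b u g.
Proof.
move=> du cg; split; first exact: continuous_itg.
move=> s t _ st _; rewrite (@Rint_derive u)//.
by apply: continuous_subspaceT; exact: is_derive_continuous du.
Qed.

(** The indefinite integral of |f| is continuous at x, so its values at x - h and x + h are both
    within e / 2 of its value at x. *)
Lemma itg_shrink f a b x e : a < x -> x < b -> 0 < e ->
  mu.-integrable `[a, b] (EFin \o f) ->
  exists2 d, 0 < d & forall h, 0 < h -> h < d ->
    \int[mu]_(t in `[x - h, x + h]) `|f t| < e.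
Proof.
have tri (A B C I : R) : `|C - A| < e / 2 -> `|C - B| < e / 2 -> B = A + I -> I < e.
  by rewrite !ltr_norml => /andP[? ?] /andP[? ?]; lra.
move=> ax xb e0 fi; have fn := integrable_norm fi.
pose K t := \int[mu]_(s in `[a, t]) `|f s|.
have cK : {within `[a, b], continuous K}.
  apply: (@parameterized_integral_continuous R a b (fun s => `|f s|)) => //; lra.
have cx : {for x, continuous K}.
  move/(continuous_within_itvP) : cK; case; first lra.
  move=> + _ _; apply; rewrite in_itv/=; lra.
have e20 : 0 < e / 2 by lra.
have /cvgrPdist_lt /(_ _ e20) [d /= d0 hd] := cx.
exists (Num.min d (Num.min (x - a) (b - x))).
  by rewrite !lt_min d0/=; lra.
move=> h h0; rewrite !lt_min => /and3P[h1 h2 h3].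
have ah : a <= x - h by lra.
have hb : x + h <= b by lra.
have hh : x - h <= x + h by lra.
apply: (tri (K (x - h)) (K (x + h)) (K x)).
- by apply: hd; rewrite /ball/= opprB addrC subrK gtr0_norm.
- by apply: hd; rewrite /ball/= opprD addrA subrr add0r normrN gtr0_norm.
- exact: Rint_split ah hh (itg_itvS (lexx a) hb fn).
Qed.

Lemma lebesgue_pt_near f x e : 0 < e -> lebesgue_pt f x ->
  (forall a b, mu.-integrable `[a, b] (EFin \o f)) ->
  exists2 d, 0 < d & forall h, 0 < h -> h < d ->
    \int[mu]_(t in `[x - h, x + h]) `|f t - f x| < e * h.
Proof.
move=> e0 lf fi.
(* The ball has length 2h, so an average below e / 2 is an integral below e h. *)
have e20 : (0 < e / 2)%R by lra.
have /fine_cvgP[_] := lf.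
move=> /cvgrPdist_lt /(_ _ e20) [d /= d0 hd].
exists d => // h h0 hlt.
have := hd h; rewrite /ball/= sub0r normrN gtr0_norm// => /(_ hlt h0).
rewrite sub0r normrN /davg /iavg /= lebesgue_measure_ball; last exact: ltW.
have fxi : mu.-integrable `[x - h, x + h] (EFin \o (fun t => f t - f x)).
  by apply: itgB => //; apply: continuous_itg; exact: cst_continuous.
have fxn := integrable_norm fxi.
rewrite ball_itv.
have -> : (\int[mu]_(y in `](x - h)%R, (x + h)%R[) `|(f y - f x)%:E| =
   (\int[mu]_(t in `[x - h, x + h]) `|f t - f x|)%:E)%E.
  rewrite /Rintegral fineK; last exact: integrable_fin_num.
  rewrite -(@integral_itv_bndoo _ _ _ _ true false)//.
  have fxo : mu.-integrable `](x - h), (x + h)[ (EFin \o (fun t => `|f t - f x|)).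
    by apply: itgS fxn => //; apply: subset_itv; rewrite bnd_simp.
  exact: measurable_int fxo.
rewrite inver mulrn_eq0/= gt_eqF// -EFinM /=.
rewrite ger0_norm; last first.
  by apply: mulr_ge0; [rewrite invr_ge0 mulrn_wge0// ltW|apply: Rintegral_ge0].
rewrite mulrC ltr_pdivrMr; last by rewrite mulrn_wgt0.
by rewrite (_ : e / 2 * (h *+ 2) = e * h)//; field.
Qed.
End IntegralToolbox.

(** * C^1 approximations of indicators, and weak derivatives tested at two Lebesgue points *)

Section TestFunctions.
Context {R : realType}.
Notation mu := (@lebesgue_measure R).
Implicit Types (f g u v : R -> R) (a b c h x y s : R).

Definition ramp s : R := Num.max 0 s.
Definition ramp2 s : R := ramp s ^+ 2 / 2.

(* A C^1 step from 0 to 1 on [-h, h], and its derivative. *)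
Definition step h s := (ramp2 (s + h) - 2 * ramp2 s + ramp2 (s - h)) / h ^+ 2.
Definition tent h s := (ramp (s + h) - 2 * ramp s + ramp (s - h)) / h ^+ 2.

Lemma ramp_continuous : continuous ramp.
Proof.
move=> s; apply: (@continuous_max _ _ (cst 0) id); [exact: cst_continuous|exact: cvg_id].
Qed.

Lemma ramp2_derive s : is_derive s 1 ramp2 (ramp s).
Proof.
have [s0|s0|->] := ltgtP s 0.
- apply: (@is_derive_nearf _ (cst 0)).
    near=> t; rewrite /ramp2 /ramp max_l ?expr0n ?mul0r//.
    near: t; near do apply: ltW; exact: lt_nbhsl.
  rewrite /ramp max_l; [exact: is_derive_cst|exact: ltW].
- apply: (@is_derive_nearf _ (fun t => t ^+ 2 / 2)).
    near=> t; rewrite /ramp2 /ramp max_r//.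
    near: t; near do apply: ltW; exact: lt_nbhsr.
  rewrite /ramp max_r; last exact: ltW.
  apply: (trigger_derive (is_derive_mulf (is_derive_sqrf (is_derive_idf s)) (is_derive_cstf 2^-1 s))).
  by field.
(* At the junction point 0 the quotient of [ramp2] is [ramp z / 2], which is continuous and vanishes
   there. *)
- apply/is_derive1_caratheodory; exists (fun z => ramp z / 2); split.
  + move=> z; rewrite /ramp2 /ramp maxxx expr0n mul0r !subr0.
    have [z0|z0] := leP 0 z; [by field|by field].
  + by move=> z; apply: continuousM; [exact: ramp_continuous|exact: cst_continuous].
  + by rewrite /ramp maxxx mul0r.
Unshelve. all: by end_near. Qed.

Lemma tent_continuous h : continuous (tent h).
Proof.
have cr := ramp_continuous; have ci := @continuous_idf R.
have sh c : continuous (fun t => ramp (t + c)).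
  by apply: continuous_compf => //; apply: continuous_addf => //; exact: continuous_cstf.
apply: continuous_mulf; last exact: continuous_cstf.
apply: continuous_addf; last exact: sh.
apply: continuous_subf; first exact: sh.
by apply: continuous_mulf => //; exact: continuous_cstf.
Qed.

Lemma step_derive h s : is_derive s 1 (step h) (tent h s).
Proof.
have sh c : is_derive s 1 (fun t => ramp2 (t + c)) (ramp (s + c)).
  by apply: is_derive_addcf; exact: ramp2_derive.
apply: (trigger_derive (is_derive_mulf (is_derive_addf (is_derive_subf (sh h)
  (is_derive_scalef 2 (ramp2_derive s))) (sh (- h))) (is_derive_cstf ((h ^+ 2)^-1) s))).
by rewrite /tent; ring.
Qed.

Lemma ramp_pos s : 0 <= s -> ramp s = s. Proof. exact: max_r. Qed.
Lemma ramp_neg s : s <= 0 -> ramp s = 0. Proof. exact: max_l. Qed.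

Lemma step_left h s : 0 < h -> s <= - h -> step h s = 0.
Proof.
move=> h0 sh; rewrite /step /ramp2 !ramp_neg ?expr0n/= ?mul0r ?mulr0 ?subrr ?addr0 ?mul0r//; lra.
Qed.

Lemma step_right h s : 0 < h -> h <= s -> step h s = 1.
Proof. move=> h0 sh; rewrite /step /ramp2 !ramp_pos; [by field; lra|lra..]. Qed.

Lemma tent_out h s : 0 < h -> h <= `|s| -> tent h s = 0.
Proof.
move=> h0; rewrite ler_normr => /orP[hs|hs].
  by rewrite /tent !ramp_pos; [field; lra|lra..].
by rewrite /tent !ramp_neg; [field; lra|lra..].
Qed.

Lemma tent_ge0 h s : 0 < h -> 0 <= tent h s.
Proof.
move=> h0; apply: divr_ge0; last exact: sqr_ge0.
rewrite /ramp; case: (leP 0 (s + h)) => ?; case: (leP 0 s) => ?; case: (leP 0 (s - h)) => ?; lra.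
Qed.

Lemma tent_le h s : 0 < h -> tent h s <= h^-1.
Proof.
move=> h0; rewrite /tent ler_pdivrMr ?exprn_gt0// expr2 mulKf ?gt_eqF//.
rewrite /ramp; case: (leP 0 (s + h)) => ?; case: (leP 0 s) => ?; case: (leP 0 (s - h)) => ?; lra.
Qed.

Lemma step_itv h s : 0 < h -> 0 <= step h s <= 1.
Proof.
move=> h0.
have inc x y : x <= y -> step h x <= step h y.
  move=> xy; apply: (derive_ge0_le xy _ (fun z _ _ => step_derive h z)).
    by apply: continuous_subspaceT; exact: is_derive_continuous (step_derive h).
  by move=> z _ _; exact: tent_ge0.
apply/andP; split.
  have [sh|sh] := leP s (- h); first by rewrite step_left.
  by rewrite -(@step_left h (- h))// inc// ltW.
have [sh|sh] := leP h s; first by rewrite step_right.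
by rewrite -(@step_right h h)// inc// ltW.
Qed.

Definition step2 h x y s := step h (s - x) - step h (s - y).
Definition tent2 h x y s := tent h (s - x) - tent h (s - y).

Lemma step2_derive h x y s : is_derive s 1 (step2 h x y) (tent2 h x y s).
Proof.
by apply: is_derive_subf; apply: (@is_derive_addcf _ (step h)); exact: step_derive.
Qed.

Lemma tent2_continuous h x y : continuous (tent2 h x y).
Proof.
have ci := @continuous_idf R.
by apply: continuous_subf; apply: (continuous_compf (@tent_continuous h));
  apply: continuous_addf => //; exact: continuous_cstf.
Qed.

Lemma step2_out h x y s : 0 < h -> x <= y -> ~ `[x - h, y + h]%classic s ->
  step2 h x y s = 0.
Proof.
move=> h0 xy; rewrite /= in_itv/= => /negP; rewrite negb_and -!ltNge => /orP[sx|sy].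
  by rewrite /step2 !step_left ?subrr//; lra.
by rewrite /step2 !step_right ?subrr//; lra.
Qed.

Lemma step2_supp h x y : 0 < h -> x <= y ->
  supp (step2 h x y) `<=` `[x - h, y + h]%classic.
Proof.
move=> h0 xy; rewrite /supp [X in _ `<=` X](closure_id _).1; last exact: itv_closed.
apply: closure_subset => s /= s0; apply: contrapT => sN.
by move/eqP: s0; apply; exact: step2_out.
Qed.

Lemma step2_C1c h x y : 0 < h -> x <= y -> C1c (step2 h x y).
Proof.
move=> h0 xy; split.
- by move=> s; have [] := step2_derive h x y s.
- have -> : derive1 (step2 h x y) = tent2 h x y.
    by apply/funext => s; apply: is_derive_derive1; exact: step2_derive.
  exact: tent2_continuous.
- apply: (@subclosed_compact _ _ `[x - h, y + h]%classic).
  + exact: closed_closure.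
  + exact: segment_compact.
  + exact: step2_supp.
Qed.

Lemma tent_mass h x : 0 < h -> \int[mu]_(s in `[x - h, x + h]) tent h (s - x) = 1.
Proof.
move=> h0.
have [_ /(_ (x - h) (x + h))] : primitive_on (x - h) (x + h) (fun s => step h (s - x)) (fun s => tent h (s - x)).
  apply: primitive_C1.
    by move=> s; apply: (@is_derive_addcf _ (step h)); exact: step_derive.
  apply: (continuous_compf (@tent_continuous h)).
  by apply: continuous_addf; [exact: continuous_idf|exact: continuous_cstf].
move=> <-; [|lra|lra|lra].
by rewrite step_right ?step_left ?subr0//; lra.
Qed.

(** The tent has unit mass, so [f x] is the tent average of a constant; its height is at most 1 /
    h. *)
Lemma tent_avg f h x : 0 < h -> mu.-integrable `[x - h, x + h] (EFin \o f) ->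
  `|\int[mu]_(s in `[x - h, x + h]) (tent h (s - x) * f s) - f x| <=
  h^-1 * \int[mu]_(s in `[x - h, x + h]) `|f s - f x|.
Proof.
move=> h0 fi; have ct : continuous (fun s => tent h (s - x)).
  apply: (continuous_compf (@tent_continuous h)).
  by apply: continuous_addf; [exact: continuous_idf|exact: continuous_cstf].
have ti : mu.-integrable `[x - h, x + h] (EFin \o (fun s => tent h (s - x))) by exact: continuous_itg.
have tfi : mu.-integrable `[x - h, x + h] (EFin \o (fun s => tent h (s - x) * f s)).
  exact: (itg_mul_cont ct fi).
have tci : mu.-integrable `[x - h, x + h] (EFin \o (fun s => f x * tent h (s - x))) by exact: itgZ.
have di : mu.-integrable `[x - h, x + h] (EFin \o (fun s => tent h (s - x) * f s - f x * tent h (s - x))).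
  exact: itgB.
have fxi : mu.-integrable `[x - h, x + h] (EFin \o (fun s => f s - f x)).
  by apply: itgB => //; apply: continuous_itg; exact: continuous_cstf.
have fxn := integrable_norm fxi.
have fE : f x = \int[mu]_(s in `[x - h, x + h]) (f x * tent h (s - x)).
  by rewrite RintegralZl// tent_mass// mulr1.
rewrite [X in `|_ - X|]fE -RintegralB//.
apply: (le_trans (le_normr_Rintegral _ _)) => //.
rewrite -RintegralZl//; apply: le_Rintegral => //.
- exact: integrable_norm di.
- exact: itgZ.
- move=> s _; rewrite (_ : _ - _ = tent h (s - x) * (f s - f x)); last ring.
  by rewrite normrM ger0_norm ?tent_ge0// ler_wpM2r// tent_le.
Qed.

(** The bound on [h] keeps the supports of the two tents disjoint. *)
Lemma tent2_pieces f h x y : 0 < h -> h < (y - x) / 2 ->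
  (forall a b, mu.-integrable `[a, b] (EFin \o f)) ->
  \int[mu]_s (f s * tent2 h x y s) =
  \int[mu]_(s in `[x - h, x + h]) (tent h (s - x) * f s) -
  \int[mu]_(s in `[y - h, y + h]) (tent h (s - y) * f s).
Proof.
move=> h0 hxy fi.
rewrite (@Rint_supp _ _ (x - h) (y + h)); last first.
  move=> s /=; rewrite in_itv/= => /negP; rewrite negb_and -!ltNge => /orP[sx|sy].
    by rewrite /tent2 !tent_out ?subrr ?mulr0// ler_normr; apply/orP; right; lra.
  by rewrite /tent2 !tent_out ?subrr ?mulr0// ler_normr; apply/orP; left; lra.
have tfi a b : mu.-integrable `[a, b] (EFin \o (fun s => f s * tent2 h x y s)).
  have -> : (fun s => f s * tent2 h x y s) = tent2 h x y \* f by apply/funext => s /=; rewrite mulrC.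
  exact: (itg_mul_cont (@tent2_continuous h x y) (fi a b)).
have e1 : \int[mu]_(s in `[x - h, x + h]) (f s * tent2 h x y s) =
    \int[mu]_(s in `[x - h, x + h]) (tent h (s - x) * f s).
  apply: eq_Rintegral => s; rewrite inE/= in_itv/= => /andP[sx sy].
  rewrite /tent2 (@tent_out _ (s - y))//; first by rewrite subr0 mulrC.
  by rewrite ler_normr; apply/orP; right; lra.
have e2 : \int[mu]_(s in `[x + h, y - h]) (f s * tent2 h x y s) = 0.
  rewrite (@eq_Rintegral _ _ _ _ _ (fun _ => 0)) => [|s].
    by rewrite Rint_cst ?mul0r//; lra.
  rewrite inE/= in_itv/= => /andP[sx sy].
  rewrite /tent2 !tent_out ?subrr ?mulr0// ler_normr; apply/orP; [right|left]; lra.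
have e3 : \int[mu]_(s in `[y - h, y + h]) (f s * tent2 h x y s) =
    - \int[mu]_(s in `[y - h, y + h]) (tent h (s - y) * f s).
  rewrite -[RHS]mulN1r -RintegralZl//; last first.
    apply: (@itg_mul_cont _ (fun s => tent h (s - y))) => //.
    apply: (continuous_compf (@tent_continuous h)).
    by apply: continuous_addf; [exact: continuous_idf|exact: continuous_cstf].
  apply: eq_Rintegral => s; rewrite inE/= in_itv/= => /andP[sx sy].
  rewrite /tent2 (@tent_out _ (s - x))//; first by ring.
  by rewrite ler_normr; apply/orP; left; lra.
rewrite (@Rint_split _ _ _ (x + h)) ?e1//; [|lra|lra].
by rewrite (@Rint_split _ _ (x + h) (y - h)) ?e2 ?e3 ?add0r//; lra.
Qed.

Lemma Rint_small f g a b : a <= b -> mu.-integrable `[a, b] (EFin \o f) ->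
  mu.-integrable `[a, b] (EFin \o g) -> (forall s, `|g s| <= 1) ->
  mu.-integrable `[a, b] (EFin \o (fun s => f s * g s)) ->
  `|\int[mu]_(s in `[a, b]) (f s * g s)| <= \int[mu]_(s in `[a, b]) `|f s|.
Proof.
move=> ab fi gi g1 fgi; apply: (le_trans (le_normr_Rintegral _ _)) => //.
apply: le_Rintegral => //; [exact: integrable_norm fgi|exact: integrable_norm|].
by move=> s _; rewrite normrM ler_piMr.
Qed.

(** The bump differs from the indicator of [x, y] only within h of the endpoints; there both are at
    most 1 in size, whence the factor 2. *)
Lemma step2_pieces f h x y : 0 < h -> h < (y - x) / 2 ->
  (forall a b, mu.-integrable `[a, b] (EFin \o f)) ->
  `|\int[mu]_s (f s * step2 h x y s) - \int[mu]_(s in `[x, y]) f s| <=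
  2 * (\int[mu]_(s in `[x - h, x + h]) `|f s| + \int[mu]_(s in `[y - h, y + h]) `|f s|).
Proof.
have tri (A B C D E A' B' : R) : `|A| <= A' -> `|B| <= B' -> `|C| <= A' -> `|D| <= B' ->
    `|A + (E + B) - (C + (E + D))| <= 2 * (A' + B').
  by rewrite !ler_norml => /andP[? ?] /andP[? ?] /andP[? ?] /andP[? ?]; lra.
move=> h0 hxy fi.
have cs : continuous (step2 h x y) by exact: is_derive_continuous (step2_derive h x y).
have fn a b : mu.-integrable `[a, b] (EFin \o (fun s => `|f s|)) by exact: integrable_norm.
rewrite (@Rint_supp _ _ (x - h) (y + h)); last first.
  by move=> s sxy; rewrite step2_out ?mulr0//; lra.
have tfi a b : mu.-integrable `[a, b] (EFin \o (fun s => f s * step2 h x y s)).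
  have -> : (fun s => f s * step2 h x y s) = step2 h x y \* f by apply/funext => s /=; rewrite mulrC.
  exact: (itg_mul_cont cs (fi a b)).
have s1 s : `|step2 h x y s| <= 1.
  have := step_itv (s - x) h0; have := step_itv (s - y) h0.
  by rewrite /step2 ler_norml => /andP[? ?] /andP[? ?]; lra.
have e2 : \int[mu]_(s in `[x + h, y - h]) (f s * step2 h x y s) = \int[mu]_(s in `[x + h, y - h]) f s.
  apply: eq_Rintegral => s; rewrite inE/= in_itv/= => /andP[sx sy].
  by rewrite /step2 step_right ?step_left ?subr0 ?mulr1//; lra.
rewrite (@Rint_split _ _ _ (x + h))//; [|lra|lra].
rewrite (@Rint_split _ _ (x + h) (y - h)) ?e2//; [|lra|lra].
rewrite (@Rint_split _ f x (x + h) y)//; [|lra|lra].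
rewrite (@Rint_split _ f (x + h) (y - h) y)//; [|lra|lra].
have p1 : `|\int[mu]_(s in `[x - h, x + h]) (f s * step2 h x y s)| <= \int[mu]_(s in `[x - h, x + h]) `|f s|.
  by apply: Rint_small => //; [lra|exact: continuous_itg].
have p2 : `|\int[mu]_(s in `[y - h, y + h]) (f s * step2 h x y s)| <= \int[mu]_(s in `[y - h, y + h]) `|f s|.
  by apply: Rint_small => //; [lra|exact: continuous_itg].
have p3 : `|\int[mu]_(s in `[x, x + h]) f s| <= \int[mu]_(s in `[x - h, x + h]) `|f s|.
  apply: (le_trans (le_normr_Rintegral _ _)) => //.
  rewrite (@Rint_split _ _ (x - h) x (x + h))//; [|lra|lra].
  by rewrite lerDr; apply: Rintegral_ge0.
have p4 : `|\int[mu]_(s in `[y - h, y]) f s| <= \int[mu]_(s in `[y - h, y + h]) `|f s|.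
  apply: (le_trans (le_normr_Rintegral _ _)) => //.
  rewrite (@Rint_split _ _ (y - h) y (y + h))//; [|lra|lra].
  by rewrite lerDl; apply: Rintegral_ge0.
exact: tri.
Qed.

(* The test function approximates the indicator of [x, y] and its derivative
   the difference of the Dirac masses at [x] and [y]. *)
Lemma weak_primitive_at f g x y : x < y ->
  (forall a b, mu.-integrable `[a, b] (EFin \o f)) ->
  (forall a b, mu.-integrable `[a, b] (EFin \o g)) ->
  lebesgue_pt f x -> lebesgue_pt f y ->
  (exists2 d, 0 < d & forall h, 0 < h -> h < d ->
     \int[mu]_s (f s * tent2 h x y s) = - \int[mu]_s (g s * step2 h x y s)) ->
  f y - f x = \int[mu]_(s in `[x, y]) g s.
Proof.
have tri (A B u v J I G G' e : R) : - J = A - B -> `|J - I| <= 2 * (G + G') -> G < e -> G' < e ->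
    `|A - u| <= e -> `|B - v| <= e -> `|v - u - I| <= e * 6.
  by rewrite !ler_norml => ? /andP[? ?] ? ? /andP[? ?] /andP[? ?]; lra.
move=> xy fi gi fx fy [d d0 Hd].
apply/eqP; rewrite -subr_eq0 -normr_le0; apply: (@le0_of_le_eps _ _ 6) => e e0.
have [d1 d10 H1] := lebesgue_pt_near e0 fx fi.
have [d2 d20 H2] := lebesgue_pt_near e0 fy fi.
have [d3 d30 H3] := @itg_shrink _ g (x - 1) (x + 1) x e ltac:(lra) ltac:(lra) e0 (gi _ _).
have [d4 d40 H4] := @itg_shrink _ g (y - 1) (y + 1) y e ltac:(lra) ltac:(lra) e0 (gi _ _).
have yx0 : 0 < (y - x) / 2 by lra.
have : \forall h \near 0^'+, [/\ h < d, h < d1, h < d2, h < d3 & h < d4] /\ h < (y - x) / 2.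
  near=> h; split; first split; near: h; exact: nbhs_right_lt.
move=> /filterI/(_ (nbhs_right_gt 0)) /filter_ex[h [[[hd hd1 hd2 hd3 hd4] hxy] /= h0]].
have := tent2_pieces h0 hxy fi; rewrite Hd// => E.
have S := step2_pieces h0 hxy gi.
have Tx := tent_avg h0 (fi (x - h) (x + h)).
have Ty := tent_avg h0 (fi (y - h) (y + h)).
have {Tx} Tx : `|\int[mu]_(s in `[x - h, x + h]) (tent h (s - x) * f s) - f x| <= e.
  by apply: (le_trans Tx); rewrite ler_pdivrMl// mulrC ltW// H1.
have {Ty} Ty : `|\int[mu]_(s in `[y - h, y + h]) (tent h (s - y) * f s) - f y| <= e.
  by apply: (le_trans Ty); rewrite ler_pdivrMl// mulrC ltW// H2.
exact: (tri _ _ _ _ _ _ _ _ _ E S (H3 h h0 hd3) (H4 h h0 hd4) Tx Ty).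
Unshelve. all: by end_near. Qed.

End TestFunctions.

Lemma continuous_at_compf {R : realType} (f g : R -> R) x :
  {for g x, continuous f} -> {for x, continuous g} ->
  {for x, continuous (fun t => f (g t))}.
Proof. by move=> cf cg; exact: (@continuous_comp _ _ _ g f x cg cf). Qed.

Lemma sqr_le_sqr {R : realType} (x y : R) : 0 <= x -> x <= y -> x ^+ 2 <= y ^+ 2.
Proof. by move=> x0 xy; rewrite lerXn2r// nnegrE (le_trans x0). Qed.

(** * Monotonicity of integrals *)

Section IntegralComparison.
Context {R : realType}.
Notation mu := (@lebesgue_measure R).
Implicit Types (f g : R -> R) (a b : R).

Lemma Rint_le f g a b : mu.-integrable `[a, b] (EFin \o f) ->
  mu.-integrable `[a, b] (EFin \o g) ->
  (forall x, a <= x -> x <= b -> f x <= g x) ->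
  \int[mu]_(x in `[a, b]) f x <= \int[mu]_(x in `[a, b]) g x.
Proof.
move=> fi gi fg; apply: le_Rintegral => // x; rewrite /= in_itv/= => /andP[ax xb].
exact: fg.
Qed.

Lemma RintT_le f g : mu.-integrable setT (EFin \o f) ->
  mu.-integrable setT (EFin \o g) -> (forall x : R, f x <= g x) ->
  \int[mu]_x f x <= \int[mu]_x g x.
Proof. by move=> fi gi fg; apply: le_Rintegral => // x _; exact: fg. Qed.

Lemma Rint_itv_leT f a b : mu.-integrable setT (EFin \o f) -> (forall x : R, 0 <= f x) ->
  \int[mu]_(x in `[a, b]) f x <= \int[mu]_x f x.
Proof.
move=> fi f0; rewrite Rintegral_mkcond; apply: RintT_le => //.
  by rewrite -restrict_EFin; apply/(integrable_mkcond _ _).1 => //; exact: itg_itv_setT.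
by move=> x; rewrite patchE; case: ifP.
Qed.

End IntegralComparison.

(** * Square-integrable functions, and H^1 functions as absolutely continuous functions *)

Section SquareIntegrable.
Context {R : realType}.
Notation mu := (@lebesgue_measure R).
Implicit Types (f g u v : R -> R) (a b c x y s : R).

Lemma ae_imp (P Q : R -> Prop) : (forall x, P x -> Q x) ->
  {ae mu, forall x, P x} -> {ae mu, forall x, Q x}.
Proof. by move=> PQ; apply: (@filterS _ (almost_everywhere mu)) => x; exact: PQ. Qed.

Lemma eq_Rint_ae f g (A : set (measurableTypeR R)) : measurable A ->
  measurable_fun A f -> measurable_fun A g -> {ae mu, forall x, A x -> f x = g x} ->
  \int[mu]_(x in A) f x = \int[mu]_(x in A) g x.
Proof.
move=> mA mf mg; rewrite /Rintegral => fg; congr fine; apply: ae_eq_integral => //.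
- exact/measurable_EFinP.
- exact/measurable_EFinP.
- by apply: ae_imp fg => x H Ax; rewrite H.
Qed.

Lemma itg_EFin f (A : set (measurableTypeR R)) : measurable A -> mu.-integrable A (EFin \o f) ->
  (\int[mu]_(x in A) (f x)%:E = (\int[mu]_(x in A) f x)%:E)%E.
Proof. by move=> mA fi; rewrite /Rintegral fineK//; exact: integrable_fin_num. Qed.

Lemma Rint_norm_le f a b : mu.-integrable `[a, b] (EFin \o f) ->
  `|\int[mu]_(x in `[a, b]) f x| <= \int[mu]_(x in `[a, b]) `|f x|.
Proof. by move=> fi; exact: le_normr_Rintegral. Qed.

Lemma itg_dom f g (A : set (measurableTypeR R)) : measurable A ->
  measurable_fun A f -> (forall x, A x -> `|f x| <= g x) ->
  mu.-integrable A (EFin \o g) -> mu.-integrable A (EFin \o f).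
Proof.
move=> mA mf fg gi; apply: (le_integrable mA _ _ gi).
  exact/measurable_EFinP.
move=> x Ax /=; rewrite lee_fin; apply: (le_trans (fg x Ax)); exact: ler_norm.
Qed.

Definition sqint f := measurable_fun [set: R] f /\
  mu.-integrable setT (EFin \o (fun x => f x ^+ 2)).

Lemma Lpnorm_powE p u : p != 0 ->
  (Lpnorm p u `^ p = \int[mu]_x (`|u x| `^ p)%:E)%E.
Proof. by move=> p0; rewrite /Lpnorm powR_Lnorm. Qed.

Lemma L2P u : L2 u <-> sqint u.
Proof.
have norm2 : (Lpnorm 2 u `^ 2 = \int[mu]_x (u x ^+ 2)%:E)%E.
  rewrite Lpnorm_powE//; apply: eq_integral => x _; congr EFin.
  by rewrite powR_mulrn// real_normK// num_real.
split=> [u2|[mu' u2]].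
  split; first by have := sub_Lfun_mfun u2; rewrite inE.
  exact: Lfun2_integrable_sqr.
rewrite /L2 inE; apply/andP; split; first by rewrite inE.
rewrite inE /= /finite_norm.
suff : (Lpnorm 2 u < +oo)%E by [].
have : (Lpnorm 2 u `^ 2 < +oo)%E.
  by rewrite norm2; exact: integrable_lty.
have := @Lnorm_ge0 _ _ _ mu 2%:E (EFin \o u); rewrite -/(Lpnorm 2 u).
by move: (Lpnorm 2 u) => [r _ _||//]; rewrite ?ltry// poweRyr.
Qed.

Lemma mass_sq u mu0 : sqint u ->
  (Lpnorm 2 u `^ 2)%E = mu0%:E <-> \int[mu]_x (u x ^+ 2) = mu0.
Proof.
move=> [mu' u2].
have -> : (Lpnorm 2 u `^ 2 = \int[mu]_x (u x ^+ 2)%:E)%E.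
  rewrite Lpnorm_powE//; apply: eq_integral => x _; congr EFin.
  by rewrite powR_mulrn// real_normK// num_real.
by rewrite itg_EFin//; split=> [[]|->].
Qed.

Lemma sqint_mul f g : sqint f -> sqint g ->
  mu.-integrable setT (EFin \o (fun x => f x * g x)).
Proof.
move=> [mf fi] [mg gi]; apply: (@itg_dom _ (fun x => f x ^+ 2 + g x ^+ 2)) => //.
- exact: measurable_funM.
- move=> x _; rewrite normrM; have := sqr_ge0 (`|f x| - `|g x|).
  have := sqr_ge0 (`|f x| + `|g x|).
  rewrite !sqrrD sqrrN -!normrX !(ger0_norm (sqr_ge0 _)).
  rewrite mulrN mulNrn; lra.
- exact: itgD.
Qed.

Lemma sqint_itv f a b : sqint f -> mu.-integrable `[a, b] (EFin \o f).
Proof.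
move=> [mf fi]; apply: (@itg_dom _ (fun x => f x ^+ 2 + 1)) => //.
- exact: measurable_funTS.
- move=> x _; have := sqr_ge0 (`|f x| - 1).
  rewrite sqrrB -normrX (ger0_norm (sqr_ge0 _)) => h.
  have := normr_ge0 (f x); lra.
- apply: itgD => //; first exact: itg_itv_setT.
  by apply: continuous_itg; exact: continuous_cstf.
Qed.

Lemma sqintD f g : sqint f -> sqint g -> sqint (fun x => f x + g x).
Proof.
move=> sf sg; have [mf fi] := sf; have [mg gi] := sg; split.
  exact: measurable_funD.
have -> : (fun x => (f x + g x) ^+ 2) = (fun x => f x ^+ 2 + (2 * (f x * g x) + g x ^+ 2)).
  by apply/funext => x; ring.
apply: itgD => //; apply: itgD => //; apply: itgZ => //; exact: sqint_mul.
Qed.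

Lemma sqintZ k f : sqint f -> sqint (fun x => k * f x).
Proof.
move=> [mf fi]; split; first exact: measurable_funM.
have -> : (fun x => (k * f x) ^+ 2) = (fun x => k ^+ 2 * f x ^+ 2).
  by apply/funext => x; ring.
exact: itgZ.
Qed.

(** The value at 0 is 1 rather than 0, so that the square is 1 at every point and not just almost
    everywhere. *)
Definition sgn x : R := if x < 0 then -1 else 1.

Lemma sgn2 x : sgn x ^+ 2 = 1.
Proof. by rewrite /sgn; case: ifP => _; rewrite ?sqrrN expr1n. Qed.

Lemma sgn_pos x : 0 <= x -> sgn x = 1.
Proof. by rewrite /sgn ltNge => ->. Qed.

Lemma sgn_neg x : x < 0 -> sgn x = -1.
Proof. by rewrite /sgn => ->. Qed.

Lemma sgn_measurable : measurable_fun [set: R] sgn.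
Proof.
apply: nondecreasing_measurable => // x y xy; rewrite /sgn.
have [y0|y0] := ltP y 0; first by rewrite (le_lt_trans xy y0).
by case: ifP => _ //; lra.
Qed.

Lemma sqint_sgn f : sqint f -> sqint (fun x => sgn x * f x).
Proof.
move=> [mf fi]; split; first by apply: measurable_funM => //; exact: sgn_measurable.
have -> : (fun x => (sgn x * f x) ^+ 2) = (fun x => f x ^+ 2).
  by apply/funext => x; rewrite exprMn sgn2 mul1r.
exact: fi.
Qed.

(** The error is bounded by the integral of |f| outside [-n, n], which tends to 0 by dominated
    convergence. *)
Lemma Rint_exhaust f e : 0 < e -> mu.-integrable setT (EFin \o f) ->
  exists N : R, forall a b, a <= - N -> N <= b ->
    `|\int[mu]_x f x - \int[mu]_(x in `[a, b]) f x| <= e.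
Proof.
move=> e0 fi.
have fn : mu.-integrable setT (EFin \o (fun t => `|f t|)) by exact: integrable_norm fi.
have rE g a b : mu.-integrable setT (EFin \o g) ->
    mu.-integrable setT (EFin \o (g \_ `[a, b])).
  by move=> gi; rewrite -restrict_EFin; apply/(integrable_mkcond _ _).1 => //; exact: itg_itv_setT.
have [n hn] : exists n : nat, \int[mu]_x `|f x| - \int[mu]_(x in `[- n%:R, n%:R]) `|f x| <= e.
  pose F (n : nat) := EFin \o ((fun t => `|f t|) \_ `[- n%:R, n%:R]).
  have [||||| _ _] := @dominated_convergence _ _ _ mu setT measurableT F
    (EFin \o (fun t => `|f t|)) (EFin \o (fun t => `|f t|)).
  - by move=> n; exact: measurable_int (rE _ _ _ fn).
  - exact: measurable_int fn.
  - apply: aeW => x _; apply: cvg_near_cst; near=> n.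
    rewrite /F /= patchE ifT// inE/= in_itv/= -ler_norml.
    by near: n; exact: nbhs_infty_ger.
  - exact: fn.
  - apply: aeW => x n _; rewrite /F /= lee_fin patchE.
    by case: ifP => _; rewrite ?normr_id// normr0.
  rewrite itg_EFin//.
  move=> /fine_cvgP[_] /cvgrPdist_le /(_ _ e0) [n _ /(_ n (leqnn _))] /= h.
  exists n; rewrite [\int[mu]_(x in `[_, _]) _]Rintegral_mkcond.
  exact: le_trans (ler_norm _) h.
exists n%:R => a b aN Nb.
rewrite [\int[mu]_(x in `[a, b]) _]Rintegral_mkcond -RintegralB//; last exact: rE.
apply: (le_trans (le_normr_Rintegral _ _)) => //; first by apply: itgB => //; exact: rE.
apply: le_trans hn; rewrite [X in _ <= _ - X]Rintegral_mkcond -RintegralB//; last exact: rE.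
apply: le_Rintegral => //.
- by apply: integrable_norm; apply: itgB => //; exact: rE.
- by apply: itgB => //; exact: rE.
- move=> x _; rewrite !patchE; case: ifPn => [_|xab]; first by rewrite subrr normr0; case: ifP => _; rewrite ?subrr// subr0.
  rewrite ifF ?subr0//; apply/negP; rewrite inE/= in_itv/= => /andP[x1 x2].
  move/negP: xab; apply; rewrite inE/= in_itv/=; lra.
Unshelve. all: by end_near. Qed.

Lemma small_value_itv f a b e I : a <= b -> I < e * (b - a) ->
  mu.-integrable `[a, b] (EFin \o f) -> \int[mu]_(x in `[a, b]) f x <= I ->
  exists2 x, a <= x <= b & f x < e.
Proof.
move=> ab Ie fi fI; apply: contrapT => H.
have ci : mu.-integrable `[a, b] (EFin \o (fun=> e)) by apply: continuous_itg; exact: continuous_cstf.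
have := Rint_le ci fi; rewrite Rint_cst// => /(_ _)/le_trans/(_ fI)/le_lt_trans/(_ Ie).
rewrite ltxx => C; apply/notF/C => x ax xb; rewrite leNgt; apply/negP => fx.
by apply: H; exists x => //; rewrite ax.
Qed.

(** A function that stays above e on an interval of length (|I| + 1) / e has an integral larger than
    I. Such far points of smallness stand in for decay at infinity. *)
Lemma small_value_right f N e I : 0 < e -> (forall a b, mu.-integrable `[a, b] (EFin \o f)) ->
  (forall b, N <= b -> \int[mu]_(x in `[N, b]) f x <= I) -> exists2 x, N <= x & f x < e.
Proof.
move=> e0 fi fI; pose b := N + (`|I| + 1) / e.
have Nb : N <= b by rewrite lerDl divr_ge0 ?addr_ge0// ltW.
have Ie : I < e * (b - N).
  by rewrite /b [N + _]addrC addrK mulrC divfK ?gt_eqF//; have := ler_norm I; lra.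
by have [x /andP[Nx _] fx] := small_value_itv Nb Ie (fi N b) (fI b Nb); exists x.
Qed.

Lemma small_value_left f N e I : 0 < e -> (forall a b, mu.-integrable `[a, b] (EFin \o f)) ->
  (forall a, a <= N -> \int[mu]_(x in `[a, N]) f x <= I) -> exists2 x, x <= N & f x < e.
Proof.
move=> e0 fi fI; pose a := N - (`|I| + 1) / e.
have aN : a <= N by rewrite lerBlDr lerDl divr_ge0 ?addr_ge0// ltW.
have Ie : I < e * (N - a).
  by rewrite /a opprB addrC subrK mulrC divfK ?gt_eqF//; have := ler_norm I; lra.
by have [x /andP[_ xN] fx] := small_value_itv aN Ie (fi a N) (fI a aN); exists x.
Qed.

Lemma lebesgue_pt_cont f x : continuous f -> lebesgue_pt f x.
Proof.
move=> cf; apply: (@continuous_lebesgue_pt _ _ _ setT) => //.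
- by split; [exact: openT|].
- exact: continuous_measurable.
- exact: cf.
Qed.

Lemma lebesgue_pt_ae f : measurable_fun [set: R] f ->
  (forall a b, mu.-integrable `[a, b] (EFin \o f)) ->
  {ae mu, forall x, lebesgue_pt f x}.
Proof.
move=> mf fi; apply: lebesgue_differentiation; split => //; first exact: openT.
move=> K _ cK; have [M [_ /(_ (`|M| + 1))]] := compact_bounded cK.
have M1 : M < `|M| + 1 by rewrite (le_lt_trans (ler_norm M))// ltrDl.
move=> /(_ M1) KM.
have le : (\int[mu]_(x in K) `|f x|%R%:E <= \int[mu]_(x in [set` `[(- (`|M| + 1))%R, (`|M| + 1)%R]]) `|f x|%R%:E)%E.
  apply: ge0_subset_integral => //.
  - exact: compact_measurable.
  - by apply/measurable_EFinP; apply: measurableT_comp => //; exact: measurable_funTS.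
  - by move=> x Kx; have := KM x Kx; rewrite /= ler_norml in_itv.
by apply: (le_lt_trans le); apply: integrable_lty => //; exact: integrable_norm.
Qed.

(** At a Lebesgue point x the integral of f - f x over an interval of length d is - d f x, while it
    is less than e d / 2 in size. *)
Lemma zero_of_zero_integrals f : measurable_fun [set: R] f ->
  (forall a b, mu.-integrable `[a, b] (EFin \o f)) ->
  (forall a b, a <= b -> \int[mu]_(x in `[a, b]) f x = 0) ->
  {ae mu, forall x, f x = 0}.
Proof.
move=> mf fi f0; apply: ae_imp (lebesgue_pt_ae mf fi) => x fx.
apply/eqP; rewrite -normr_le0; apply: (@le0_of_le_eps _ _ 1) => e e0; rewrite mulr1.
have [d d0 Hd] := lebesgue_pt_near e0 fx fi.
have d20 : 0 < d / 2 by lra.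
have dd : d / 2 < d by lra.
have fci a b : mu.-integrable `[a, b] (EFin \o (fun t => f t - f x)).
  by apply: itgB => //; apply: continuous_itg; exact: continuous_cstf.
have ci a b : mu.-integrable `[a, b] (EFin \o (fun t => f x)).
  by apply: continuous_itg; exact: continuous_cstf.
have := Rint_norm_le (fci (x - d / 2) (x + d / 2)).
rewrite RintegralB// f0 ?Rint_cst; [|lra|lra].
move=> /le_lt_trans/(_ (Hd _ d20 dd)).
rewrite sub0r normrN normrM (_ : x + d / 2 - (x - d / 2) = d); last lra.
rewrite (gtr0_norm d0); have := normr_ge0 (f x); nra.
Qed.

(** Every point is a Lebesgue point of the continuous [u], so [weak_primitive_at] holds between any
    two points. *)
Lemma H1_primitive u g : continuous u -> L2 g -> is_weak_derivative u g ->
  forall a b, primitive_on a b u g.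
Proof.
move=> cu /L2P sg wg a b; split; first exact: sqint_itv.
move=> s t _ st _.
have [->|st'] := eqVneq s t; first by rewrite Rint_point subrr.
apply: weak_primitive_at.
- by rewrite lt_neqAle st' st.
- by move=> *; exact: continuous_itg.
- by move=> *; exact: sqint_itv.
- exact: lebesgue_pt_cont.
- exact: lebesgue_pt_cont.
- exists 1 => // h h0 _; have := wg _ (step2_C1c h0 st).
  congr (_ = _); congr Rintegral; apply/funext => x; congr (_ * _).
  by apply: is_derive_derive1; exact: step2_derive.
Qed.

Lemma H1_wderiv u : H1 u -> L2 (wderiv u) /\ is_weak_derivative u (wderiv u).
Proof.
move=> [_ _ [g Lg wg]].
by have : [set g | L2 g /\ is_weak_derivative u g] (wderiv u) by apply: xgetPex; exists g.
Qed.

Lemma primitive_on_ae_eq u g h : sqint g -> sqint h ->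
  (forall a b, primitive_on a b u g) -> (forall a b, primitive_on a b u h) ->
  {ae mu, forall x, g x = h x}.
Proof.
move=> sg sh ug uh.
have sd := sqintD sg (sqintZ (-1) sh).
suff : {ae mu, forall x, g x + -1 * h x = 0} by apply: ae_imp => x; lra.
apply: zero_of_zero_integrals.
- by have [] := sd.
- by move=> *; exact: sqint_itv.
- move=> a b ab; rewrite RintegralD//; [|exact: sqint_itv|exact: sqint_itv (sqintZ _ sh)].
  rewrite RintegralZl//; last exact: sqint_itv.
  have [_ /(_ a b)<-//] := ug a b; have [_ /(_ a b)<-//] := uh a b.
  ring.
Qed.

End SquareIntegrable.

(** * Completing the square, and the signed primitive of a continuous function *)

Section Calibration.
Context {R : realType}.
Notation mu := (@lebesgue_measure R).
Implicit Types (f g u v S G : R -> R) (a b c x y : R).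

(** Needed on intervals ending at 0, where the convention [sgn 0 = 1] breaks the agreement at the
    right endpoint. *)
Lemma eq_Rint_oo f g a b : mu.-integrable `[a, b] (EFin \o f) ->
  mu.-integrable `[a, b] (EFin \o g) -> {in `]a, b[, f =1 g} ->
  \int[mu]_(x in `[a, b]) f x = \int[mu]_(x in `[a, b]) g x.
Proof.
move=> fi gi fg; rewrite /Rintegral; congr fine.
have sub h : mu.-integrable `[a, b] (EFin \o h) -> measurable_fun `]a, b[ h.
  move=> hi; have hio : mu.-integrable `]a, b[ (EFin \o h).
    by apply: itgS hi => //; apply: subset_itv; rewrite bnd_simp.
  by apply/measurable_EFinP; exact: measurable_int hio.
by apply: eq_integral_itv_bounded; [exact: sub|exact: sub|].
Qed.

(* The cross term of the square telescopes on each half-line, leaving only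
   the value of [v] at the origin. *)
Lemma calibration S G v g : continuous v -> continuous S ->
  (forall x, is_derive x 1 G (S x)) -> G 0 = 0 ->
  sqint v -> sqint g -> sqint (fun x => S (v x)) ->
  (forall a b, primitive_on a b v g) ->
  \int[mu]_x ((g x + sgn x * S (v x)) ^+ 2) =
  \int[mu]_x (g x ^+ 2) + \int[mu]_x (S (v x) ^+ 2) - 4 * G (v 0).
Proof.
move=> cv cS dG G0 sv sg sS vg.
have sSs := sqint_sgn sS.
have hi := sqint_mul sSs sg.
have cSv : continuous (fun x => S (v x)) by exact: continuous_compf.
have cross : \int[mu]_x (sgn x * S (v x) * g x) = - (2 * G (v 0)).
  apply/eqP; rewrite -subr_eq0 -normr_le0; apply: (@le0_of_le_eps _ _ 3) => e e0.
  have cG : continuous G by exact: is_derive_continuous.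
  have /cvgrPdist_lt /(_ _ e0) [d /= d0 hd] := cG 0.
  have Gs z : `|z| < d -> `|G z| < e.
    move=> zd; have := hd z; rewrite /ball/= sub0r normrN G0 sub0r normrN.
    exact.
  have [N hN] := Rint_exhaust e0 hi.
  have v2 : forall x, 0 <= v x ^+ 2 by move=> x; exact: sqr_ge0.
  have d2 : 0 < d ^+ 2 by rewrite exprn_gt0.
  have small x : v x ^+ 2 < d ^+ 2 -> `|v x| < d.
    by rewrite -[v x ^+ 2]real_normK ?num_real// ltr_pXn2r// ?nnegrE// ltW.
  have vi c c' := itg_itv_setT `[c, c'] sv.2.
  (* Two far points at which v is small are enough: the integral over [a, b] is already within e of
     the total, and the boundary terms G(v a) and G(v b) are below e. This accounts for the factor
     3. *)
  have [b Nb /small /Gs vb] := small_value_right (N := `|N|) d2 vi (fun b _ => Rint_itv_leT _ b sv.2 v2).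
  have [a aN /small /Gs va] := small_value_left (N := - `|N|) d2 vi (fun a _ => Rint_itv_leT a _ sv.2 v2).
  have N0 := normr_ge0 N; have NN := ler_norm N.
  have := hN a b ltac:(lra) ltac:(lra).
  have hii c c' : mu.-integrable `[c, c'] (EFin \o (fun x => sgn x * S (v x) * g x)) by exact: itg_itv_setT.
  rewrite (@Rint_split _ _ a 0 b)//; [|lra|lra].
  have [Sgi Sg1] := @chain_primitive _ G S 0 b v g ltac:(lra) cv cS dG (vg _ _).
  have [Sgi' Sg2] := @chain_primitive _ G S a 0 v g ltac:(lra) cv cS dG (vg _ _).
  have -> : \int[mu]_(x in `[0, b]) (sgn x * S (v x) * g x) = G (v b) - G (v 0).
    rewrite (Sg1 0 b) ?lexx//; last lra.
    apply: eq_Rintegral => x; rewrite inE/= in_itv/= => /andP[x0 _].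
    by rewrite sgn_pos// mul1r.
  have -> : \int[mu]_(x in `[a, 0]) (sgn x * S (v x) * g x) = - (G (v 0) - G (v a)).
    rewrite (Sg2 a 0) ?lexx//; last lra.
    rewrite -[RHS]mulN1r -RintegralZl//.
    apply: eq_Rint_oo => //; first exact: itgZ.
    by move=> x; rewrite in_itv/= => /andP[_ x0]; rewrite sgn_neg// mulrA.
  move: va vb; rewrite !ltr_norml => /andP[? ?] /andP[? ?].
  by rewrite !ler_norml => /andP[? ?]; lra.
have -> : (fun x => (g x + sgn x * S (v x)) ^+ 2) =
   (fun x => g x ^+ 2 + S (v x) ^+ 2 + 2 * (sgn x * S (v x) * g x)).
  apply/funext => x; rewrite sqrrD exprMn sgn2 mul1r -mulr_natl; ring.
have [_ gi] := sg; have [_ Si] := sS.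
rewrite RintegralD//; [|exact: itgD|exact: itgZ].
rewrite RintegralD// RintegralZl// cross; ring.
Qed.

(** The oriented integral from 0 to x: one of the two intervals is always empty or a single
    point. *)
Definition primitive0 S x := \int[mu]_(t in `[0, x]) S t - \int[mu]_(t in `[x, 0]) S t.

Lemma primitive0_0 S : primitive0 S 0 = 0.
Proof. by rewrite /primitive0 subrr. Qed.

Lemma primitive0_derive S x : continuous S -> is_derive x 1 (primitive0 S) (S x).
Proof.
(* The base point is moved to the left of both 0 and x, so that x is interior and the fundamental
   theorem applies on either side of 0. *)
move=> cS; pose a := Num.min x 0 - 1.
have ax : a < x by have : Num.min x 0 <= x; [rewrite ge_min lexx|rewrite /a; lra].
have a0 : a < 0 by have : Num.min x 0 <= 0; [rewrite ge_min lexx orbT|rewrite /a; lra].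
apply: (@is_derive_nearf _ (fun y => \int[mu]_(t in `[a, y]) S t - \int[mu]_(t in `[a, 0]) S t)).
  near=> y; have ay : a <= y by apply: ltW; near: y; exact: lt_nbhsr.
  rewrite /primitive0; have [y0|y0] := leP 0 y.
    rewrite (@Rint_split _ _ a 0 y)//; [|lra|exact: continuous_itg].
    rewrite [X in _ = _ - X](_ : _ = 0); first by ring.
    have [y0'|y0'] := ltP 0 y; first by rewrite set_itv_ge ?Rintegral_set0// bnd_simp -ltNge.
    by rewrite (_ : y = 0) ?Rint_point//; lra.
  rewrite (@Rint_split _ _ a y 0)//; [|lra|exact: continuous_itg].
  rewrite [X in _ = X - _](_ : _ = 0); first by ring.
  by rewrite set_itv_ge ?Rintegral_set0// bnd_simp -ltNge.
apply: (trigger_derive (is_derive_subf _ (is_derive_cstf _ _))); last first.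
  by rewrite subr0.
have xx1 : x < x + 1 by lra.
have [dF eF] := continuous_FTC1_closed xx1 (@continuous_itg _ S a (x + 1) cS) ax (cS x).
by split; [exact: dF|rewrite -derive1E].
Unshelve. all: by end_near. Qed.

Lemma primitive0_even S : continuous S -> (forall x, S (- x) = - S x) ->
  forall x, primitive0 S (- x) = primitive0 S x.
Proof.
move=> cS oS x; apply/eqP; rewrite -subr_eq0; apply/eqP.
have d0 (y : R) : is_derive y 1 (fun y => primitive0 S (- y) - primitive0 S y) 0.
  have := is_derive_subf (@is_derive_compf _ (primitive0 S) (fun y => - y) y _ _
    (primitive0_derive (- y) cS) (is_derive_oppf (is_derive_idf y))) (primitive0_derive y cS).
  by move/trigger_derive; apply; rewrite oS; ring.
rewrite (@is_derive_0_is_cst _ (fun y => primitive0 S (- y) - primitive0 S y) x 0)//.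
by rewrite oppr0 subrr.
Qed.

End Calibration.

(** * Powers of the absolute value *)

Section PowerNorm.
Context {R : realType}.
Implicit Types (r x e : R).

Lemma continuous_norm_powR r : 0 < r -> continuous (fun x : R => `|x| `^ r).
Proof.
move=> r0 x.
have [->|x0] := eqVneq x 0.
  apply/cvgrPdist_lt => e e0; rewrite normr0 powR0 ?gt_eqF//.
  exists (e `^ r^-1) => /=; first exact: powR_gt0.
  move=> y /=; rewrite /ball/= !sub0r !normrN => ye.
  rewrite ger0_norm ?powR_ge0//.
  have : `|y| `^ r < (e `^ r^-1) `^ r.
    by apply: gt0_ltr_powR => //; rewrite nnegrE// ?powR_ge0.
  by rewrite -powRrM mulVf ?gt_eqF// powRr1// ltW.
apply: (@continuous_comp _ _ _ (fun x => `|x|) (fun z => z `^ r)).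
  exact: norm_continuous.
by apply: is_derive_cont; apply: is_derive1_powR; rewrite normr_gt0.
Qed.

Lemma norm_powR_sq r x : r != 0 -> `|x| `^ r = `|x| `^ (r - 2) * x ^+ 2.
Proof.
move=> r0; have [->|x0] := eqVneq x 0; first by rewrite normr0 powR0// expr0n mulr0.
rewrite -(@real_normK _ x) ?num_real// -powR_mulrn// -powRD; last first.
  by rewrite normr_eq0 (negbTE x0) implybT.
by congr (_ `^ _); ring.
Qed.

End PowerNorm.

(** * The reduced problem in the amplitude *)

Section ReducedProblem.
Context {R : realType} (p q : R).
Implicit Types (l a b s t x : R).

Definition radicand l x := l + 2 / p * `|x| `^ (p - 2).
Definition slope l x := x * Num.sqrt (radicand l x).
Definition slopeI l := primitive0 (slope l).
Definition action l x := 2 * slopeI l x - `|x| `^ q / q.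
Definition lam a := `|a| `^ (2 * q - 4) / 4 - 2 / p * `|a| `^ (p - 2).
(** [amp_max] and [amp_peak] are the positive zeros of [lam] and of its derivative: after division
    by a power of a, each equation fixes a^(p - 2q + 2), an exponent that is positive precisely when
    q < p/2 + 1. *)
Definition amp_max := (p / 8) `^ (p - 2 * q + 2)^-1.
Definition amp_peak := ((2 * q - 4) * p / (8 * (p - 2))) `^ (p - 2 * q + 2)^-1.

Hypotheses (hp : 2 < p) (hq2 : 2 < q) (hqp : q < p / 2 + 1).

Let p0 : 0 < p. Proof. by have := hp; lra. Qed.
Let pm2 : 0 < p - 2. Proof. by have := hp; lra. Qed.
Let q0 : 0 < q. Proof. by have := hq2; lra. Qed.
Let al0 : 0 < 2 * q - 4. Proof. by have := hq2; lra. Qed.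
Let d0 : 0 < p - 2 * q + 2. Proof. by have := hqp; lra. Qed.

Lemma radicand_continuous l : continuous (radicand l).
Proof.
apply: continuous_addf; first exact: continuous_cstf.
by apply: continuous_mulf; [exact: continuous_cstf|exact: continuous_norm_powR].
Qed.

Lemma slope_continuous l : continuous (slope l).
Proof.
apply: continuous_mulf; first exact: continuous_idf.
apply: (continuous_compf (f := Num.sqrt)); first exact: sqrt_continuous.
exact: radicand_continuous.
Qed.

Lemma slope_odd l x : slope l (- x) = - slope l x.
Proof. by rewrite /slope /radicand normrN mulNr. Qed.

Lemma slopeI_derive l x : is_derive x 1 (slopeI l) (slope l x).
Proof. by apply: primitive0_derive; exact: slope_continuous. Qed.

Lemma slopeI0 l : slopeI l 0 = 0. Proof. exact: primitive0_0. Qed.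

Lemma slopeI_even l x : slopeI l (- x) = slopeI l x.
Proof. by apply: primitive0_even; [exact: slope_continuous|exact: slope_odd]. Qed.

Lemma slopeI_norm l x : slopeI l `|x| = slopeI l x.
Proof.
by have [h|h] := leP 0 x; [rewrite (ger0_norm h)|rewrite (ltr0_norm h) slopeI_even].
Qed.

Lemma action_norm l x : action l `|x| = action l x.
Proof. by rewrite /action slopeI_norm normr_id. Qed.

Lemma action0 l : action l 0 = 0.
Proof. by rewrite /action slopeI0 normr0 powR0 ?gt_eqF// mul0r mulr0 subrr. Qed.

Lemma action_continuous l : continuous (action l).
Proof.
apply: continuous_subf.
  apply: continuous_mulf; first exact: continuous_cstf.
  by apply: is_derive_continuous; exact: slopeI_derive.
apply: continuous_mulf; last exact: continuous_cstf.
exact: continuous_norm_powR.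
Qed.

Lemma lam_continuous : continuous lam.
Proof.
apply: continuous_subf.
  by apply: continuous_mulf; [exact: continuous_norm_powR|exact: continuous_cstf].
by apply: continuous_mulf; [exact: continuous_cstf|exact: continuous_norm_powR].
Qed.

Lemma lam0 : lam 0 = 0.
Proof. by rewrite /lam normr0 !powR0 ?gt_eqF// mul0r mulr0 subrr. Qed.

(** [lam] is made for this: the radicand becomes a perfect square, and S_lam(a)(a) = a^(q-1) / 2 is
    half of the jump prescribed at the origin. *)
Lemma radicand_lam a : 0 <= a -> Num.sqrt (radicand (lam a) a) = a `^ (q - 2) / 2.
Proof.
move=> a0; rewrite /radicand /lam subrK ger0_norm//.
have -> : 2 * q - 4 = (q - 2) * 2 by ring.
rewrite powRrM powR_mulrn ?powR_ge0// (_ : _ / 4 = (a `^ (q - 2) / 2) ^+ 2).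
  by rewrite sqrtr_sqr ger0_norm// divr_ge0// powR_ge0.
by field.
Qed.

Lemma norm_powR_derive r x : 0 < x -> is_derive x 1 (fun t => `|t| `^ r) (r * x `^ (r - 1)).
Proof.
move=> x0; apply: (@is_derive_nearf _ (fun t => t `^ r)); last exact: is_derive1_powR.
near=> t; rewrite gtr0_norm//; near: t; exact: lt_nbhsr.
Unshelve. all: by end_near. Qed.

(** The derivative is 2 S_l(s) - s^(q-1); writing s^(q-2) / 2 as the root at frequency [lam s] turns
    its sign into a comparison of [l] with [lam s]. *)
Lemma action_derive l s : 0 < s -> is_derive s 1 (action l)
  (2 * s * (Num.sqrt (radicand l s) - Num.sqrt (radicand (lam s) s))).
Proof.
move=> s0; rewrite (radicand_lam (ltW s0)).
apply: (trigger_derive (is_derive_subf (is_derive_scalef 2 (slopeI_derive l s))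
  (is_derive_mulf (norm_powR_derive q s0) (is_derive_cstf q^-1 s)))).
rewrite /slope; have -> : s `^ (q - 1) = s * s `^ (q - 2).
  rewrite -(@mulr_powRB1 _ s (q - 1)) ?ltW//; last by have := hq2; lra.
  by congr (_ * _ `^ _); ring.
by have := gt_eqF q0; move=> /negbT ?; field.
Qed.

Lemma radicand_ge0 l s : 0 <= l -> 0 <= radicand l s.
Proof.
move=> l0; apply: addr_ge0 => //; apply: mulr_ge0; last exact: powR_ge0.
by rewrite divr_ge0// ltW.
Qed.

Lemma radicand_gt0 l s : 0 <= l -> s != 0 -> 0 < radicand l s.
Proof.
move=> l0 s0; apply: ltr_wpDl => //; apply: mulr_gt0; last by rewrite powR_gt0// normr_gt0.
by rewrite divr_gt0.
Qed.

Lemma lam_radicand_ge0 s : 0 <= radicand (lam s) s.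
Proof. by rewrite /radicand /lam subrK divr_ge0// powR_ge0. Qed.

Lemma sqrt_radicand_lam_lt l s : 0 < s -> 0 <= l -> lam s < l ->
  Num.sqrt (radicand (lam s) s) < Num.sqrt (radicand l s).
Proof. by move=> s0 l0 ll; rewrite ltr_sqrt ?ltrD2r// radicand_gt0// gt_eqF. Qed.

Lemma sqrt_radicand_lam_gt l s : 0 < s -> 0 <= l -> l < lam s ->
  Num.sqrt (radicand l s) < Num.sqrt (radicand (lam s) s).
Proof. by move=> s0 l0 ll; rewrite ltr_sqrt ?ltrD2r// radicand_gt0 ?gt_eqF//; lra. Qed.

Lemma action_incr l s t : 0 <= l -> 0 <= s -> s < t ->
  (forall x, s < x -> x < t -> lam x < l) -> action l s < action l t.
Proof.
move=> l0 s0 st H.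
apply: (derive_gt0_lt st _ (fun x sx _ => action_derive l (le_lt_trans s0 sx))).
- by apply: continuous_subspaceT; exact: action_continuous.
- move=> x sx xt; have x0 := le_lt_trans s0 sx.
  by rewrite !mulr_gt0// subr_gt0 sqrt_radicand_lam_lt// H.
Qed.

Lemma action_decr l s t : 0 <= l -> 0 <= s -> s < t ->
  (forall x, s < x -> x < t -> l < lam x) -> action l t < action l s.
Proof.
move=> l0 s0 st H; rewrite -ltrN2.
apply: (derive_gt0_lt st _
  (fun x sx _ => is_derive_oppf (action_derive l (le_lt_trans s0 sx)))).
- by apply: continuous_subspaceT; apply: continuous_oppf; exact: action_continuous.
- move=> x sx xt; have x0 := le_lt_trans s0 sx.
  by rewrite oppr_gt0 pmulr_rlt0 ?mulr_gt0// subr_lt0 sqrt_radicand_lam_gt// H.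
Qed.

Lemma lam_derive x : 0 < x -> is_derive x 1 lam
  (x `^ (2 * q - 4 - 1) * ((2 * q - 4) / 4 - 2 / p * (p - 2) * x `^ (p - 2 * q + 2))).
Proof.
move=> x0.
apply: (trigger_derive (is_derive_subf
  (is_derive_mulf (norm_powR_derive (2 * q - 4) x0) (is_derive_cstf 4^-1 x))
  (is_derive_scalef (2 / p) (norm_powR_derive (p - 2) x0)))).
have -> : x `^ (p - 2 - 1) = x `^ (2 * q - 4 - 1) * x `^ (p - 2 * q + 2).
  rewrite -powRD; last by rewrite (gt_eqF x0) implybT.
  by congr (_ `^ _); ring.
by rewrite mulr0 add0r; ring.
Qed.

Lemma powR_root (x r : R) : 0 <= x -> 0 < r -> (x `^ r^-1) `^ r = x.
Proof. by move=> x0 r0; rewrite -powRrM mulVf ?gt_eqF// powRr1. Qed.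

Lemma amp_peak_gt0 : 0 < amp_peak.
Proof. by apply: powR_gt0; apply: divr_gt0; apply: mulr_gt0. Qed.

Lemma amp_peakE : amp_peak `^ (p - 2 * q + 2) = (2 * q - 4) * p / (8 * (p - 2)).
Proof. by apply: powR_root => //; apply: ltW; apply: divr_gt0; apply: mulr_gt0. Qed.

Lemma amp_max_gt0 : 0 < amp_max.
Proof. by apply: powR_gt0; apply: divr_gt0. Qed.

Lemma amp_maxE : amp_max `^ (p - 2 * q + 2) = p / 8.
Proof. by apply: powR_root => //; apply: ltW; apply: divr_gt0. Qed.

Lemma amp_peak_lt : amp_peak < amp_max.
Proof.
apply: gt0_ltr_powR; rewrite ?nnegrE ?invr_gt0//.
- by apply: ltW; apply: divr_gt0; apply: mulr_gt0.
- by apply: ltW; apply: divr_gt0.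
have -> : (2 * q - 4) * p / (8 * (p - 2)) = (2 * q - 4) / (p - 2) * (p / 8).
  by have := gt_eqF pm2 => /negbT ?; field.
by rewrite gtr_pMl ?divr_gt0// ltr_pdivrMr// mul1r; have := hqp; lra.
Qed.

Let coefE1 (X : R) : 2 / p * (p - 2) * X = X * (8 * (p - 2)) / (4 * p).
Proof. by have := gt_eqF p0 => /negbT ?; field. Qed.

Let coefE2 : (2 * q - 4) / 4 = (2 * q - 4) * p / (4 * p).
Proof. by have := gt_eqF p0 => /negbT ?; field. Qed.

Lemma lam_incr s t : 0 <= s -> s < t -> t <= amp_peak -> lam s < lam t.
Proof.
move=> s0 st tp.
apply: (derive_gt0_lt st _ (fun x sx _ => lam_derive (le_lt_trans s0 sx))).
- by apply: continuous_subspaceT; exact: lam_continuous.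
- move=> x sx xt; have x0 := le_lt_trans s0 sx; rewrite mulr_gt0 ?powR_gt0// subr_gt0.
  have : x `^ (p - 2 * q + 2) < amp_peak `^ (p - 2 * q + 2).
    by apply: gt0_ltr_powR; rewrite ?nnegrE//; lra.
  rewrite amp_peakE ltr_pdivlMr ?mulr_gt0// => h.
  by rewrite coefE1 coefE2 ltr_pM2r ?invr_gt0 ?mulr_gt0.
Qed.

Lemma lam_decr s t : amp_peak <= s -> s < t -> lam t < lam s.
Proof.
move=> ps st; have s0 := lt_le_trans amp_peak_gt0 ps.
rewrite -ltrN2.
apply: (derive_gt0_lt st _
  (fun x sx _ => is_derive_oppf (lam_derive (lt_trans s0 sx)))).
- by apply: continuous_subspaceT; apply: continuous_oppf; exact: lam_continuous.
- move=> x sx xt; have x0 := lt_trans s0 sx.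
  rewrite oppr_gt0 pmulr_rlt0 ?powR_gt0// subr_lt0.
  have : amp_peak `^ (p - 2 * q + 2) < x `^ (p - 2 * q + 2).
    by have := amp_peak_gt0; move=> ?; apply: gt0_ltr_powR; rewrite ?nnegrE//; lra.
  rewrite amp_peakE ltr_pdivrMr ?mulr_gt0// => h.
  by rewrite coefE1 coefE2 ltr_pM2r ?invr_gt0 ?mulr_gt0.
Qed.

(* Phase-space ratio [k] of the bound state of amplitude [a]; the frequency is
   nonnegative exactly when [k <= 1]. *)
Definition kratio a := 8 / p * a `^ (p - 2 * q + 2).

Lemma lam_kratio a : 0 < a -> lam a = a `^ (2 * q - 4) / 4 * (1 - kratio a).
Proof.
move=> a0; rewrite /lam gtr0_norm// /kratio.
have -> : a `^ (p - 2) = a `^ (2 * q - 4) * a `^ (p - 2 * q + 2).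
  rewrite -powRD; last by rewrite (gt_eqF a0) implybT.
  by congr (_ `^ _); ring.
by have := gt_eqF p0; move=> /negbT ?; field.
Qed.

Lemma kratio_max : kratio amp_max = 1.
Proof. by rewrite /kratio amp_maxE; have := gt_eqF p0; move=> /negbT ?; field. Qed.

Lemma kratio_gt0 a : 0 < a -> 0 < kratio a.
Proof. by move=> a0; rewrite mulr_gt0 ?powR_gt0// divr_gt0. Qed.

Lemma kratio_lt a b : 0 <= a -> a < b -> kratio a < kratio b.
Proof.
move=> a0 ab; rewrite ltr_pM2l ?divr_gt0//.
by apply: gt0_ltr_powR; rewrite ?nnegrE//; lra.
Qed.

Lemma lam_max : lam amp_max = 0.
Proof. by rewrite lam_kratio ?amp_max_gt0// kratio_max subrr mulr0. Qed.

Lemma lam_ge0 a : 0 <= a -> a <= amp_max -> 0 <= lam a.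
Proof.
rewrite le_eqVlt => /orP[/eqP<-|a0]; first by rewrite lam0.
move=> am; rewrite lam_kratio// mulr_ge0// ?divr_ge0 ?powR_ge0// subr_ge0.
move: am; rewrite le_eqVlt => /orP[/eqP->|am]; first by rewrite kratio_max.
by rewrite -kratio_max; apply: ltW; apply: kratio_lt => //; exact: ltW.
Qed.

Lemma lam_gt0 a : 0 < a -> a < amp_max -> 0 < lam a.
Proof.
move=> a0 am; rewrite lam_kratio// mulr_gt0// ?divr_gt0 ?powR_gt0// subr_gt0.
by rewrite -kratio_max; apply: kratio_lt => //; exact: ltW.
Qed.

Lemma lam_ge0_le a : 0 < a -> 0 <= lam a -> a <= amp_max.
Proof.
move=> a0; rewrite lam_kratio// pmulr_rge0 ?divr_gt0 ?powR_gt0// subr_ge0 leNgt.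
move=> k1; rewrite leNgt; apply: contra k1 => am.
by rewrite -kratio_max; apply: kratio_lt => //; apply: ltW; exact: amp_max_gt0.
Qed.

Definition crit a := action (lam a) a.

(** Shows that the critical value tends to 0 with the amplitude. The slope is increasing on [0, a],
    so its integral is at most a S(a) = a^q / 2. *)
Lemma crit_le a : 0 < a -> crit a <= a `^ q.
Proof.
move=> a0; rewrite /crit /action gtr0_norm//.
have q1 : 0 < q - 1 by have := hq2; lra.
have sI : slopeI (lam a) a <= a `^ q / 2.
  have [xi xa] := MVT_segment (ltW a0) (fun x _ => slopeI_derive (lam a) x)
    (continuous_subspaceT (is_derive_continuous (slopeI_derive (lam a)))).
  rewrite slopeI0 !subr0 => ->.
  have x0 : 0 <= xi by rewrite (itvP xa).
  have xla : xi <= a by rewrite (itvP xa).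
  have mono : slope (lam a) xi <= slope (lam a) a.
    apply: ler_pM => //.
    rewrite ler_wsqrtr// lerD2l; apply: ler_wpM2l; first by rewrite divr_ge0// ltW.
    rewrite !ger0_norm ?(ltW a0)//.
    by apply: ge0_ler_powR; rewrite ?nnegrE ?(ltW pm2) ?(ltW a0).
  apply: (@le_trans _ _ (slope (lam a) a * a)); first by rewrite ler_wpM2r// ltW.
  rewrite /slope radicand_lam; last exact: ltW.
  have -> : a `^ q = a * a * a `^ (q - 2).
    rewrite -(@mulr_powRB1 _ a q) ?ltW// -(@mulr_powRB1 _ a (q - 1)) ?ltW// mulrA.
    by congr (_ * _ `^ _); ring.
  by rewrite le_eqVlt; apply/orP; left; apply/eqP; field.
have : 0 <= a `^ q / q by rewrite divr_ge0 ?powR_ge0// ltW.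
lra.
Qed.

(** For a on the rising branch, [lam x < lam a] on (0, a), so the action of frequency [lam a]
    increases from its value 0 at 0. *)
Lemma crit_ge0 a : 0 <= a -> a <= amp_peak -> 0 <= crit a.
Proof.
rewrite le_eqVlt => /orP[/eqP<-|a0 ap]; first by rewrite /crit action0.
rewrite -(action0 (lam a)); apply: ltW; apply: action_incr => //.
  by apply: lam_ge0; [exact: ltW|have := amp_peak_lt; lra].
by move=> x x0 xa; apply: lam_incr => //; exact: ltW.
Qed.

(* Near-criticality: [a] is a critical point of [action (lam a)], so moving the
   amplitude costs only second order. *)
Lemma action_crit_err a b s t l : 0 < a -> a <= s -> s <= t -> t <= b -> b <= amp_peak ->
  lam s <= l -> l <= lam t ->
  `|action l t - action l s| <= 4 * b / a `^ (q - 2) * (t - s) * (lam t - lam s).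
Proof.
move=> a0 as_ st tb bp sl lt.
have dx x : x \in `]s, t[ -> is_derive x 1 (action l)
    (2 * x * (Num.sqrt (radicand l x) - Num.sqrt (radicand (lam x) x))).
  by rewrite in_itv/= => /andP[sx _]; apply: action_derive; lra.
have [xi xst ->] := MVT_segment st dx (continuous_subspaceT (@action_continuous l)).
have sx : s <= xi by rewrite (itvP xst).
have xt : xi <= t by rewrite (itvP xst).
have x0 : 0 < xi by lra.
have mono x y : 0 <= x -> x <= y -> y <= b -> lam x <= lam y.
  rewrite [x <= y]le_eqVlt => x0' /orP[/eqP->//|xy] yb.
  by apply: ltW; apply: lam_incr => //; lra.
have l1 : lam s <= lam xi by apply: mono; lra.
have l2 : lam xi <= lam t by apply: mono; lra.
have l0 : 0 <= l.
  apply: (le_trans _ sl); rewrite -lam0; apply: mono; lra.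
have Yq : a `^ (q - 2) / 2 <= Num.sqrt (radicand (lam xi) xi).
  rewrite radicand_lam; last exact: ltW.
  rewrite ler_pM2r//; apply: ge0_ler_powR; rewrite ?nnegrE; have := hq2; lra.
(* For roots X and Y, |X - Y| Y is at most |X^2 - Y^2| = |l - lam xi|, and Y is bounded below by
   [Yq]. *)
have XY : `|Num.sqrt (radicand l xi) - Num.sqrt (radicand (lam xi) xi)| *
    Num.sqrt (radicand (lam xi) xi) <= lam t - lam s.
  set X := Num.sqrt _; set Y := Num.sqrt _.
  have X0 : 0 <= X by exact: sqrtr_ge0.
  have Y0 : 0 <= Y by exact: sqrtr_ge0.
  have E : X ^+ 2 - Y ^+ 2 = l - lam xi.
    rewrite !sqr_sqrtr ?lam_radicand_ge0 ?radicand_ge0//; rewrite /radicand; ring.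
  apply: (@le_trans _ _ (`|X - Y| * (X + Y))).
    by rewrite ler_wpM2l// lerDr.
  rewrite -[X in _ * X]ger0_norm ?addr_ge0// -normrM -subr_sqr E.
  by rewrite ler_norml; lra.
have a2 : 0 < a `^ (q - 2) by exact: powR_gt0.
have D0 : 0 <= lam t - lam s by rewrite subr_ge0; apply: mono; lra.
set D := `|Num.sqrt (radicand l xi) - _| in XY *.
have Dn : D <= (lam t - lam s) * 2 / a `^ (q - 2).
  rewrite ler_pdivlMr//.
  apply: (@le_trans _ _ (D * Num.sqrt (radicand (lam xi) xi) * 2)); last by rewrite ler_pM2r.
  rewrite -mulrA ler_wpM2l// /D//; lra.
rewrite !normrM (ger0_norm (ltW x0)) (@ger0_norm _ 2)// (@ger0_norm _ (t - s)) ?subr_ge0//.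
rewrite -/D (_ : 4 * b / a `^ (q - 2) * (t - s) * (lam t - lam s) =
  2 * b * ((lam t - lam s) * 2 / a `^ (q - 2)) * (t - s)); last by ring.
apply: ler_wpM2r; first by rewrite subr_ge0.
apply: ler_pM => //; first by apply: mulr_ge0 => //; exact: ltW.
  exact: normr_ge0.
by rewrite ler_pM2l//; lra.
Qed.

(** * Critical values and minimality, for an abstract mass function *)

Section Masses.
Variable M : R -> R.
Hypothesis M_incr : forall a b, 0 < a -> a < b -> b <= amp_peak -> M a < M b.
Hypothesis M_ge0 : forall a, 0 <= M a.
(** For the mass of the profiles, the gap in this inequality is half the integral of the square in
    the calibration of the profile of amplitude a at frequency l. *)
Hypothesis M_tangent : forall a l, 0 < a -> a <= amp_peak -> 0 <= l ->
  action l a <= crit a + (l - lam a) * M a / 2.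

Let lam_mono x y : 0 <= x -> x <= y -> y <= amp_peak -> lam x <= lam y.
Proof.
rewrite [x <= y]le_eqVlt => x0 /orP[/eqP->//|xy] yp.
by apply: ltW; exact: lam_incr.
Qed.

Let M_mono x y : 0 < x -> x <= y -> y <= amp_peak -> M x <= M y.
Proof.
rewrite [x <= y]le_eqVlt => x0 /orP[/eqP->//|xy] yp.
by apply: ltW; exact: M_incr.
Qed.

(** A product of the increments of s and of [lam] is of second order: with [lam] as gauge in
    [telescope_le], it adds up to nothing over fine subdivisions. *)
Let crit_telescope (T : R -> R) a b : 0 < a -> a <= b -> b <= amp_peak ->
  (forall s t, a <= s -> s <= t -> t <= b ->
     T t - T s <= 4 * b / a `^ (q - 2) * (t - s) * (lam t - lam s)) -> T b <= T a.
Proof.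
move=> a0 ab bp H; apply: (@telescope_le _ T lam) => // e e0 x ax xb.
have C0 : 0 < 4 * b / a `^ (q - 2).
  by rewrite divr_gt0 ?powR_gt0// mulr_gt0//; lra.
exists (e / (4 * b / a `^ (q - 2)) / 2); first by apply: divr_gt0 => //; apply: divr_gt0.
move=> s t as_ sx xt tb xs tx; apply: (le_trans (H _ _ as_ (le_trans sx xt) tb)).
apply: ler_wpM2r; first by rewrite subr_ge0; apply: lam_mono; lra.
rewrite mulrC -ler_pdivlMr//; lra.
Qed.

(** Integrated form of d crit = (M/2) d lam with M >= M a. On a small step the tangent inequality at
    t is used with the frequency of s, and [action_crit_err] allows [action (lam s) t] to be
    exchanged for [crit s]. *)
Lemma crit_ge_tangent a b : 0 < a -> a <= b -> b <= amp_peak ->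
  (lam b - lam a) * M a / 2 <= crit b - crit a.
Proof.
move=> a0 ab bp.
suff : lam b * M a / 2 - crit b <= lam a * M a / 2 - crit a by lra.
apply: (@crit_telescope (fun x => lam x * M a / 2 - crit x)) => // s t as_ st tb.
have s0 : 0 < s by lra.
have lst : lam s <= lam t by apply: lam_mono; lra.
have := action_crit_err a0 as_ st tb bp (lexx _) lst.
have ls0 : 0 <= lam s by apply: lam_ge0; have := amp_peak_lt; lra.
have := @M_tangent t (lam s) ltac:(lra) ltac:(lra) ls0.
rewrite ler_norml -/(crit s) => h1 /andP[h2 h3].
have MaMt : M a <= M t by apply: M_mono; lra.
have : (lam t - lam s) * M a <= (lam t - lam s) * M t by apply: ler_wpM2l => //; lra.
lra.
Qed.

(** The same summation with the roles exchanged: the tangent inequality at s with the frequency of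
    t, and M <= M b. *)
Lemma crit_le_tangent a b : 0 < a -> a <= b -> b <= amp_peak ->
  crit b - crit a <= (lam b - lam a) * M b / 2.
Proof.
move=> a0 ab bp.
suff : crit b - lam b * M b / 2 <= crit a - lam a * M b / 2 by lra.
apply: (@crit_telescope (fun x => crit x - lam x * M b / 2)) => // s t as_ st tb.
have s0 : 0 < s by lra.
have lst : lam s <= lam t by apply: lam_mono; lra.
have := action_crit_err a0 as_ st tb bp lst (lexx _).
have lt0 : 0 <= lam t by apply: lam_ge0; have := amp_peak_lt; lra.
have := @M_tangent s (lam t) ltac:(lra) ltac:(lra) lt0.
rewrite ler_norml -/(crit t) => h1 /andP[h2 h3].
have MsMb : M s <= M b by apply: M_mono; lra.
have : (lam t - lam s) * M s <= (lam t - lam s) * M b by apply: ler_wpM2l => //; lra.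
lra.
Qed.

Lemma crit_le_mass b : 0 < b -> b <= amp_peak -> crit b <= lam b * M b / 2.
Proof.
move=> b0 bp; rewrite -subr_le0; apply: (@le0_of_le_eps _ _ 1) => e e0; rewrite mulr1.
(* The lower amplitude in [crit_le_tangent] is sent to 0; this choice makes its critical value at
   most a^q <= e. *)
pose a := Num.min b (e `^ q^-1).
have a0 : 0 < a by rewrite lt_min b0 powR_gt0.
have ab : a <= b by rewrite ge_min lexx.
have h1 := crit_le_tangent a0 ab bp.
have h2 := crit_le a0.
have h3 : a `^ q <= e.
  rewrite -[X in _ <= X](@powR_root e q) ?(ltW e0)//.
  apply: ge0_ler_powR; rewrite ?nnegrE ?powR_ge0// ?(ltW a0) ?(ltW q0)//.
  by rewrite ge_min lexx orbT.
have h4 : 0 <= lam a * M b.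
  by rewrite mulr_ge0// lam_ge0 ?(ltW a0)//; have := amp_peak_lt; lra.
lra.
Qed.

(** Strictness comes from splitting at the midpoint, where the mass is already strictly larger than
    at a. *)
Lemma crit_gt_tangent a b : 0 < a -> a < b -> b <= amp_peak ->
  (lam b - lam a) * M a / 2 < crit b - crit a.
Proof.
move=> a0 ab bp; pose c := (a + b) / 2.
have h1 := @crit_ge_tangent a c a0 ltac:(rewrite /c; lra) ltac:(rewrite /c; lra).
have h2 := @crit_ge_tangent c b ltac:(rewrite /c; lra) ltac:(rewrite /c; lra) bp.
have Mc : M a < M c by apply: M_incr; rewrite /c; lra.
have lc : lam c < lam b by apply: lam_incr; rewrite /c; lra.
have : (lam b - lam c) * M a < (lam b - lam c) * M c by rewrite ltr_pM2l// subr_gt0.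
lra.
Qed.

Lemma crit_lt_tangent a b : 0 < a -> a < b -> b <= amp_peak ->
  crit b - crit a < (lam b - lam a) * M b / 2.
Proof.
move=> a0 ab bp; pose c := (a + b) / 2.
have h1 := @crit_le_tangent a c a0 ltac:(rewrite /c; lra) ltac:(rewrite /c; lra).
have h2 := @crit_le_tangent c b ltac:(rewrite /c; lra) ltac:(rewrite /c; lra) bp.
have Mc : M c < M b by apply: M_incr; rewrite /c; lra.
have lc : lam a < lam c by apply: lam_incr; rewrite /c; lra.
have : (lam c - lam a) * M c < (lam c - lam a) * M b by rewrite ltr_pM2l// subr_gt0.
lra.
Qed.

Lemma crit_lt_mass b : 0 < b -> b <= amp_peak -> crit b < lam b * M b / 2.
Proof.
move=> b0 bp; pose c := b / 2.
have cb : c < b by rewrite /c; lra.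
have c0 : 0 < c by rewrite /c; lra.
have h1 := @crit_lt_tangent c b c0 cb bp.
have h2 := @crit_le_mass c c0 ltac:(lra).
have lc : 0 < lam c by apply: lam_gt0 => //; have := amp_peak_lt; lra.
have : lam c * M c < lam c * M b by rewrite ltr_pM2l// M_incr.
lra.
Qed.

(* [a] is the amplitude at the origin of the optimal profile of mass [m]; beyond
   the threshold mass, [a = amp_max] and the excess mass escapes to infinity. *)
Definition optimal a m := [/\ 0 < a, a <= amp_max,
  forall l, 0 <= l -> action l a <= crit a + (l - lam a) * m / 2,
  (a <= amp_peak -> m = M a) & (amp_peak < a -> M amp_peak <= m)].

Definition level a m := crit a - lam a * m / 2.

(** On the falling branch [lam] is above [l] before a and below it after a, so there a is the strict
    minimum of the action of its own frequency. *)
Lemma action_peak l a b : 0 <= l -> a != b -> amp_peak <= a -> amp_peak <= b -> l = lam a ->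
  action l a < action l b.
Proof.
have pk := amp_peak_gt0.
move=> l0 ab pa pb la; have [h|h|h] := ltgtP a b; last by rewrite h eqxx in ab.
  apply: action_incr => //; first by lra.
  by move=> x ax xb; rewrite la; apply: lam_decr.
apply: action_decr => //; first by lra.
by move=> x bx xa; rewrite la; apply: lam_decr => //; lra.
Qed.

(** The lower bound for competitors of amplitude b at the origin. The frequency [l] has to vary with
    b, because on the rising branch [lam a] alone makes a a local maximum. *)
Lemma optimal_min a m b : optimal a m -> 0 <= b -> b != a ->
  exists2 l, 0 <= l & level a m < action l b - l * m / 2.
Proof.
have pk := amp_peak_gt0; have pm := amp_peak_lt.
move=> [a0 am tan eqM geM] b0 ba; rewrite /level.
have lp0 : 0 < lam amp_peak by apply: lam_gt0.
have [ap|pa] := leP a amp_peak.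
  have mE := eqM ap; subst m.
  have [b0'|b0'] := leP b 0.
    have -> : b = 0 by lra.
    by exists 0 => //; rewrite action0 !mul0r subr0; have := crit_lt_mass a0 ap; lra.
  have [bp|pb] := leP b amp_peak.
    (* Both amplitudes on the rising branch: the frequency of b itself, followed by the strict
       tangent inequalities. *)
    exists (lam b); first by apply: lam_ge0; lra.
    rewrite -/(crit b); have [h|h|h] := ltgtP b a; last by rewrite h eqxx in ba.
      have := crit_lt_tangent b0' h ap; lra.
    have := crit_gt_tangent a0 h bp; lra.
  (* For b beyond the peak, [amp_peak] minimises the action of its own frequency there, and the
     tangent inequality leads from a to the peak. *)
  exists (lam amp_peak); first exact: ltW.
  have h1 : action (lam amp_peak) amp_peak < action (lam amp_peak) b.
    by apply: action_peak => //; [exact: ltW|rewrite lt_eqF|exact: ltW].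
  have h2 := crit_ge_tangent a0 ap (lexx _).
  move: h1; rewrite -/(crit amp_peak); lra.
have la0 : 0 <= lam a by apply: lam_ge0; lra.
have Mm x : 0 < x -> x <= amp_peak -> M x <= m.
  by move=> x0 xp; apply: le_trans (geM pa); apply: M_mono.
have [pb|bp] := leP amp_peak b.
  exists (lam a) => //; rewrite ltrD2r; apply: action_peak => //; last exact: ltW.
  by rewrite eq_sym.
have apeak : crit a < action (lam a) amp_peak.
  by apply: action_peak => //; [rewrite gt_eqF|exact: ltW].
(* Here a is on the falling branch and b before the peak. If lam a <= lam b, the action of frequency
   [lam a] decreases from b to the peak, so this frequency still serves. *)
have [lb|lb] := leP (lam a) (lam b).
  exists (lam a) => //; rewrite ltrD2r; apply: (lt_trans apeak).
  apply: action_decr => // x bx xp; apply: (le_lt_trans lb).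
  by apply: lam_incr => //; exact: ltW.
have lap : lam a < lam amp_peak by exact: lam_decr.
(* Otherwise take the amplitude a1 on the rising branch with the same frequency as a: its critical
   value exceeds that of a, and the tangent inequality leads from b to a1. *)
have [a1 a1i la1] := @IVT _ lam b amp_peak (lam a) (ltW bp)
  (continuous_subspaceT lam_continuous)
  (ltac:(rewrite ge_min le_max (ltW lb) (ltW lap) orbT//)).
have ba1 : b < a1.
  rewrite lt_neqAle (itvP a1i) andbT; apply/eqP => E; move: lb; rewrite E la1 ltxx//.
have a1p : a1 < amp_peak.
  rewrite lt_neqAle (itvP a1i) andbT; apply/eqP => E; move: lap; rewrite -la1 E ltxx//.
have h1 : crit a < crit a1.
  rewrite /(crit a1) la1; apply: (lt_trans apeak); apply: action_decr => //; first by lra.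
  by move=> x ax xp; rewrite -la1; apply: lam_incr => //; lra.
have a10 : 0 < a1 by lra.
have [b0'|b0'] := leP b 0.
  have -> : b = 0 by lra.
  exists 0 => //; rewrite action0 !mul0r subr0.
  have := crit_le_mass a10 (ltW a1p); rewrite la1.
  have : lam a * M a1 <= lam a * m by rewrite ler_wpM2l// Mm// ltW.
  lra.
exists (lam b); first by apply: lam_ge0; lra.
have := crit_le_tangent b0' (ltW ba1) (ltW a1p); rewrite la1 -/(crit b).
have : (lam a - lam b) * M a1 <= (lam a - lam b) * m.
  by rewrite ler_wpM2l ?Mm ?subr_ge0// ltW.
lra.
Qed.

(** Amplitude 0 is a competitor whose bound, -l m / 2, is nonpositive for every l >= 0. *)
Lemma level_lt0 a m : 0 <= m -> optimal a m -> level a m < 0.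
Proof.
move=> m0 o; have [a0 _ _ _ _] := o.
have [|l l0] := optimal_min o (lexx 0); first by rewrite lt_eqF.
rewrite action0 sub0r => /lt_le_trans; apply.
by rewrite oppr_le0 divr_ge0// mulr_ge0.
Qed.

(** On the rising branch [- lam a / 2] is a supergradient of the energy at mass m; this restates the
    tangent inequalities for [crit]. *)
Lemma level_concave a m b n : a <= amp_peak -> b <= amp_peak -> optimal a m -> optimal b n ->
  level b n <= level a m - lam a * (n - m) / 2.
Proof.
move=> ap bp [a0 _ _ /(_ ap) -> _] [b0 _ _ /(_ bp) -> _]; rewrite /level.
have [ab|ba] := leP a b.
  by have := crit_le_tangent a0 ab bp; lra.
by have := crit_ge_tangent b0 (ltW ba) ap; lra.
Qed.

(** On the falling branch [- lam a / 2] is a subgradient: a minimises the action of frequency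
    [lam a], and the optimality of b is read at that frequency. *)
Lemma level_convex a m b n : amp_peak <= a -> amp_peak <= b -> optimal a m -> optimal b n ->
  level a m - lam a * (n - m) / 2 <= level b n.
Proof.
move=> pa pb [a0 am _ _ _] [b0 _ tan _ _]; rewrite /level.
have la0 : 0 <= lam a by apply: lam_ge0; lra.
have : crit a <= action (lam a) b.
  have [->//|ab] := eqVneq a b; exact/ltW/action_peak.
have := tan _ la0; lra.
Qed.

Lemma optimal_peak : optimal amp_peak (M amp_peak).
Proof.
have pk := amp_peak_gt0; have pm := amp_peak_lt.
split => //; [exact: ltW|by move=> l l0; exact: M_tangent].
Qed.

(** The slope is negative on each side of the peak, [b < amp_max] keeping it nonzero; states on
    opposite sides are compared through the state at the peak. *)
Lemma level_decr a m b n : optimal a m -> optimal b n -> m < n -> b < amp_max ->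
  level b n < level a m.
Proof.
have pm := amp_peak_lt.
move=> oa ob mn bm; have [a0 am _ eqMa geMa] := oa; have [b0 _ _ eqMb geMb] := ob.
have small a' m' b' n' : a' <= amp_peak -> b' <= amp_peak -> optimal a' m' ->
    optimal b' n' -> m' < n' -> level b' n' < level a' m'.
  move=> ap bp o1 o2 mn'; have := level_concave ap bp o1 o2.
  have [a0' _ _ _ _] := o1.
  have la' : 0 < lam a' by apply: lam_gt0 => //; lra.
  have : 0 < lam a' * (n' - m') by apply: mulr_gt0 => //; rewrite subr_gt0.
  lra.
have large a' m' b' n' : amp_peak <= a' -> amp_peak <= b' -> b' < amp_max ->
    optimal a' m' -> optimal b' n' -> m' < n' -> level b' n' < level a' m'.
  move=> ap bp bm' o1 o2 mn'; have := level_convex bp ap o2 o1.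
  have [b0' _ _ _ _] := o2.
  have lb' : 0 < lam b' by apply: lam_gt0.
  have : 0 < lam b' * (n' - m') by apply: mulr_gt0 => //; rewrite subr_gt0.
  lra.
have [ap|pa] := leP a amp_peak; have [bp|pb] := leP b amp_peak.
- exact: small oa ob mn.
- have Mn := geMb pb; have mE := eqMa ap.
  have mM : m <= M amp_peak by rewrite mE; exact: M_mono.
  (* If m equals the mass at the peak, strict monotonicity of M forces a to be the peak, so both
     states count as falling. *)
  have [h|h] := ltP m (M amp_peak); last first.
    have e1 : m = M amp_peak by lra.
    have [e2|e2] := eqVneq a amp_peak.
      by apply: (large _ _ _ _ _ _ bm oa ob mn); rewrite ?e2// ltW.
    have : M a < M amp_peak by apply: M_incr => //; rewrite lt_neqAle e2.
    lra.
  have h1 := small _ _ _ _ ap (lexx _) oa optimal_peak h.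
  have [h'|h'] := ltP (M amp_peak) n.
    exact: (lt_trans (large _ _ _ _ (lexx _) (ltW pb) bm optimal_peak ob h') h1).
  have e1 : n = M amp_peak by lra.
  have := level_convex (ltW pb) (lexx _) ob optimal_peak.
  by rewrite -e1 subrr mulr0 mul0r subr0 e1 => /le_lt_trans; apply.
- have := geMa pa; have := eqMb bp; have := M_mono b0 bp (lexx _); lra.
- by apply: large oa ob mn => //; exact: ltW.
Qed.

End Masses.

End ReducedProblem.

(** * The explicit decaying profiles and their mass *)

Section Profile.
Context {R : realType} (gam : R).
Notation mu := (@lebesgue_measure R).
Implicit Types (r s x y c L : R).
Hypothesis gam0 : 0 < gam.

(* [hyp r y = cosh (gam r y) + sinh (gam r y) / r], read as [1 + gam y] at
   [r = 0]; then [prof r = hyp r ^ (-1/gam)] solves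
   [w' = - w sqrt (r^2 + (1 - r^2) w^(2 gam))], [w 0 = 1] on [y >= 0]. *)
Definition hyp r y := if r == 0 then 1 + gam * y else
  (expR (gam * r * y) + expR (- (gam * r * y))) / 2 +
  (expR (gam * r * y) - expR (- (gam * r * y))) / (2 * r).
Definition hyp' r y := if r == 0 then 1 else
  (expR (gam * r * y) + expR (- (gam * r * y))) / 2 +
  r * (expR (gam * r * y) - expR (- (gam * r * y))) / 2.
Definition prof r y := hyp r y `^ (- gam^-1).
Definition eprof r y := prof r `|y|.

Let expR_lin_derive c y : is_derive y 1 (fun t => expR (c * t)) (c * expR (c * y)).
Proof.
have := @is_derive_compf _ expR (fun t => c * t) y _ _ (is_derive_expR _)
  (is_derive_scalef c (is_derive_idf y)).
by move/trigger_derive; apply; rewrite mulr1 mulrC.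
Qed.

Let expRN_lin_derive c y :
  is_derive y 1 (fun t => expR (- (c * t))) (- c * expR (- (c * y))).
Proof.
have := expR_lin_derive (- c) y.
by under [fun t => expR (- c * t)]funext do rewrite mulNr; rewrite [- c * y]mulNr.
Qed.

Lemma hyp_derive r y : is_derive y 1 (hyp r) (gam * hyp' r y).
Proof.
rewrite /hyp /hyp'; have [r0|r0] := eqVneq r 0.
  apply: (trigger_derive (is_derive_addf (is_derive_cstf 1 y)
    (is_derive_scalef gam (is_derive_idf y)))); by rewrite add0r.
have d1 := expR_lin_derive (gam * r) y; have d2 := expRN_lin_derive (gam * r) y.
apply: (trigger_derive (is_derive_addf
  (is_derive_mulf (is_derive_addf d1 d2) (is_derive_cstf 2^-1 y))
  (is_derive_mulf (is_derive_subf d1 d2) (is_derive_cstf (2 * r)^-1 y)))).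
by field.
Qed.

Lemma hyp'_derive r y : is_derive y 1 (hyp' r) (gam * r ^+ 2 * hyp r y).
Proof.
rewrite /hyp /hyp'; have [->|r0] := eqVneq r 0.
  by apply: (trigger_derive (is_derive_cstf 1 y)); rewrite expr0n/= mulr0 mul0r.
have d1 := expR_lin_derive (gam * r) y; have d2 := expRN_lin_derive (gam * r) y.
apply: (trigger_derive (is_derive_addf
  (is_derive_mulf (is_derive_addf d1 d2) (is_derive_cstf 2^-1 y))
  (is_derive_mulf (is_derive_scalef r (is_derive_subf d1 d2)) (is_derive_cstf 2^-1 y)))).
by field.
Qed.

Lemma hyp0 r : hyp r 0 = 1.
Proof.
rewrite /hyp; case: ifP => _; rewrite ?mulr0 ?addr0// oppr0 expR0 subrr mul0r addr0; lra.
Qed.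

Lemma hyp'0 r : hyp' r 0 = 1.
Proof.
by rewrite /hyp'; case: ifP => _; rewrite // mulr0 oppr0 expR0 subrr mulr0 mul0r addr0; lra.
Qed.

Let expR_facts x : 0 <= x -> [/\ 1 <= expR x, expR (- x) <= 1, 0 < expR (- x) &
  expR x * expR (- x) = 1].
Proof.
move=> x0; split; [|by rewrite expR_le1; lra|exact: expR_gt0|exact: expRxMexpNx_1].
by rewrite -[1]addr0; apply: le_trans (expR_ge1Dx x); lra.
Qed.

Let cosh_ge1 x : 2 <= expR x + expR (- x).
Proof. by have := expR_ge1Dx x; have := expR_ge1Dx (- x); lra. Qed.

Lemma hyp_ge1 r y : 0 <= r -> 0 <= y -> 1 <= hyp r y.
Proof.
move=> r0 y0; rewrite /hyp; have [_|r0'] := eqVneq r 0.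
  by rewrite lerDl mulr_ge0// ltW.
have x0 : 0 <= gam * r * y by rewrite !mulr_ge0// ltW.
have [h1 h2 _ _] := expR_facts x0; have := cosh_ge1 (gam * r * y).
have : 0 <= (expR (gam * r * y) - expR (- (gam * r * y))) / (2 * r).
  by rewrite divr_ge0 ?mulr_ge0// subr_ge0; lra.
lra.
Qed.

Lemma hyp'_ge1 r y : 0 <= r -> 0 <= y -> 1 <= hyp' r y.
Proof.
move=> r0 y0; rewrite /hyp'; have [_|r0'] := eqVneq r 0; first by [].
have x0 : 0 <= gam * r * y by rewrite !mulr_ge0// ltW.
have [h1 h2 _ _] := expR_facts x0; have := cosh_ge1 (gam * r * y).
have : 0 <= r * (expR (gam * r * y) - expR (- (gam * r * y))) / 2.
  by rewrite divr_ge0 ?mulr_ge0// subr_ge0; lra.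
lra.
Qed.

Lemma hyp_conserved r y : hyp' r y ^+ 2 = r ^+ 2 * hyp r y ^+ 2 + (1 - r ^+ 2).
Proof.
rewrite /hyp /hyp'; have [->|r0] := eqVneq r 0; first by ring.
have := expRxMexpNx_1 (gam * r * y).
set E := expR _; set E' := expR _ => EE.
have -> : 1 - r ^+ 2 = (1 - r ^+ 2) * (E * E') by rewrite EE mulr1.
by field.
Qed.

Lemma prof_derive r y : 0 <= r -> 0 <= y ->
  is_derive y 1 (prof r) (- (prof r y * hyp' r y / hyp r y)).
Proof.
move=> r0 y0; have h1 := hyp_ge1 r0 y0; have h0 : 0 < hyp r y by lra.
have := @is_derive_compf _ (fun t => t `^ (- gam^-1)) (hyp r) y _ _
  (is_derive1_powR (- gam^-1) h0) (hyp_derive r y).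
move/trigger_derive; apply.
rewrite powRB; last by rewrite (gt_eqF h0) implybT.
rewrite powRr1 ?(ltW h0)// /prof; have := gt_eqF gam0; move=> /negbT ?.
by have := gt_eqF h0; move=> /negbT ?; field; apply/andP.
Qed.

Lemma prof_gt0 r y : 0 <= r -> 0 <= y -> 0 < prof r y.
Proof. by move=> r0 y0; apply: powR_gt0; have := hyp_ge1 r0 y0; lra. Qed.

Lemma prof0 r : prof r 0 = 1. Proof. by rewrite /prof hyp0 powR1. Qed.

Lemma prof_le r s x y : 0 <= r -> 0 <= s -> 0 <= x -> 0 <= y -> hyp r x <= hyp s y ->
  prof s y <= prof r x.
Proof.
move=> r0 s0 x0 y0 h; have h1 := hyp_ge1 r0 x0; have h2 := hyp_ge1 s0 y0.
rewrite /prof !powRN lef_pV2 ?posrE ?powR_gt0//; [|lra|lra].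
by apply: ge0_ler_powR => //; rewrite ?nnegrE ?invr_ge0; [exact: ltW|lra|lra].
Qed.

Lemma prof_le1 r y : 0 <= r -> 0 <= y -> prof r y <= 1.
Proof. by move=> r0 y0; rewrite -(prof0 r); apply: prof_le; rewrite // hyp0 hyp_ge1. Qed.

(** With w = hyp^(-1/gam) one has w^(2 gam) = hyp^(-2), so by [hyp_conserved] the radicand is the
    square of hyp' / hyp. *)
Lemma prof_ode r y : 0 <= r -> r <= 1 -> 0 <= y ->
  is_derive y 1 (prof r)
    (- (prof r y * Num.sqrt (r ^+ 2 + (1 - r ^+ 2) * prof r y `^ (2 * gam)))).
Proof.
move=> r0 r1 y0; apply: (trigger_derive (prof_derive r0 y0)).
have h1 := hyp_ge1 r0 y0; have h1' := hyp'_ge1 r0 y0; have h0 : 0 < hyp r y by lra.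
rewrite -mulrA; congr (- (_ * _)).
have -> : prof r y `^ (2 * gam) = (hyp r y ^+ 2)^-1.
  rewrite /prof -powRrM (_ : - gam^-1 * (2 * gam) = - 2%:R); first by rewrite powR_invn// ltW.
  by have := gt_eqF gam0; move=> /negbT ?; field.
have -> : r ^+ 2 + (1 - r ^+ 2) * (hyp r y ^+ 2)^-1 = (hyp' r y / hyp r y) ^+ 2.
  rewrite expr_div_n hyp_conserved; have := gt_eqF h0; move=> /negbT ?; by field.
by rewrite sqrtr_sqr ger0_norm// divr_ge0//; lra.
Qed.

Lemma eprof_continuous r : 0 <= r -> continuous (eprof r).
Proof.
move=> r0 y.
have c : {for `|y|, continuous (prof r)} by apply: is_derive_cont; exact: prof_derive.
by apply: (@continuous_at_compf _ (prof r) (fun t => `|t|)) => //; exact: norm_continuous.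
Qed.

(* [D] is the Wronskian of [hyp s] and [hyp r]. *)
Lemma hyp_mono r s y : 0 <= r -> r <= s -> 0 <= y -> hyp r y <= hyp s y.
Proof.
move=> r0 rs y0; have s0 : 0 <= s by lra.
pose D x := hyp' s x * hyp r x - hyp s x * hyp' r x.
have dD x : is_derive x 1 D (gam * (s ^+ 2 - r ^+ 2) * hyp s x * hyp r x).
  apply: (trigger_derive (is_derive_subf (is_derive_mulf (hyp'_derive s x) (hyp_derive r x))
    (is_derive_mulf (hyp_derive s x) (hyp'_derive r x)))); by ring.
have D0 x : 0 <= x -> 0 <= D x.
  move=> x0; have -> : 0 = D 0 by rewrite /D !hyp0 !hyp'0 mulr1 subrr.
  apply: (derive_ge0_le x0 _ (fun z _ _ => dD z)).
    by apply: continuous_subspaceT; exact: is_derive_continuous dD.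
  move=> z z0 _; have := hyp_ge1 s0 (ltW z0); have := hyp_ge1 r0 (ltW z0) => h1 h2.
  rewrite !mulr_ge0//; [exact: ltW| |lra|lra].
  by rewrite subr_ge0 lerXn2r// nnegrE.
have dQ x : 0 <= x -> is_derive x 1 (fun t => hyp s t / hyp r t) (gam * D x / hyp r x ^+ 2).
  move=> x0; have h0 : hyp r x != 0 by have := hyp_ge1 r0 x0; move=> ?; rewrite gt_eqF//; lra.
  apply: (trigger_derive (is_derive_mulf (hyp_derive s x) (is_deriveV h0 (hyp_derive r x)))).
  by rewrite /GRing.scale/= /D; field.
have : hyp s 0 / hyp r 0 <= hyp s y / hyp r y.
  apply: (derive_ge0_le y0 _ (fun z z0 _ => dQ z (ltW z0))).
  - by apply: within_derive => z z0 _; exact: dQ.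
  - by move=> z z0 _; rewrite divr_ge0 ?sqr_ge0// mulr_ge0 ?(ltW gam0)// D0// ltW.
rewrite !hyp0 divr1 ler_pdivlMr ?mul1r//.
by have := hyp_ge1 r0 y0; lra.
Qed.

(** After the rescaling both sides have the same exponentials, and only the coefficients 1 / (2s) <=
    1 / (2r) of the sinh part differ. *)
Lemma hyp_scale r s y : 0 < r -> r <= s -> 0 <= y -> hyp s y <= hyp r (s / r * y).
Proof.
move=> r0 rs y0; have s0 : 0 < s by lra.
rewrite /hyp !gt_eqF// (_ : gam * r * (s / r * y) = gam * s * y); last by field; rewrite gt_eqF.
rewrite lerD2l ler_wpM2l//.
  have x0 : 0 <= gam * s * y by rewrite !mulr_ge0// ltW.
  by have [] := expR_facts x0; lra.
by rewrite lef_pV2 ?posrE ?mulr_gt0// ler_pM2l.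
Qed.

Lemma hyp_le_exp r y : 0 <= r -> 0 <= y -> hyp r y <= expR (gam * r * y) * hyp 0 y.
Proof.
move=> r0 y0; rewrite /hyp eqxx; have [->|r0'] := eqVneq r 0.
  by rewrite mulr0 mul0r expR0 mul1r.
have x0 : 0 <= gam * r * y by rewrite !mulr_ge0// ltW.
have rp : 0 < r by rewrite lt_neqAle eq_sym r0'.
have [h1 h2 h3 h4] := expR_facts x0.
set E := expR (gam * r * y) in h1 h4 *; set E' := expR _ in h2 h3 h4 *.
(* This is sinh x <= x exp x for x = gam r y, obtained from exp(-2x) >= 1 - 2x multiplied by exp
   x. *)
have h5 : E - E' <= 2 * (gam * r * y) * E.
  have := expR_ge1Dx (- (2 * (gam * r * y))).
  have -> : expR (- (2 * (gam * r * y))) = E' * E' by rewrite /E' -expRD; congr expR; ring.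
  move=> h6; have E0 : 0 < E by lra.
  have : (1 + - (2 * (gam * r * y))) * E <= E' * E' * E by rewrite ler_wpM2r// ltW.
  have -> : E' * E' * E = E' by rewrite -mulrA [E' * E]mulrC h4 mulr1.
  lra.
have h7 : (E - E') / (2 * r) <= gam * y * E.
  rewrite ler_pdivrMr ?mulr_gt0//; lra.
lra.
Qed.

Lemma eprof_even r y : eprof r (- y) = eprof r y.
Proof. by rewrite /eprof normrN. Qed.

Lemma eprof_gt0 r y : 0 <= r -> 0 < eprof r y.
Proof. by move=> r0; exact: prof_gt0. Qed.

Lemma eprof_ge0 r y : 0 <= r -> 0 <= eprof r y.
Proof. by move=> r0; exact: ltW (eprof_gt0 y r0). Qed.

Lemma eprof_sq_continuous r : 0 <= r -> continuous (fun y => eprof r y ^+ 2).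
Proof.
move=> r0; have c := eprof_continuous r0.
by rewrite (_ : (fun y => _) = (fun y => eprof r y * eprof r y))//; exact: continuous_mulf.
Qed.

Definition pmass r := \int[mu]_y (eprof r y ^+ 2).

(* The mass is finite iff [r > 0], or [r = 0] and [gam < 2]. *)
Definition admissible r := [/\ 0 <= r, r <= 1 & 0 < r \/ gam < 2].

Lemma admissible_ge0 r : admissible r -> 0 <= r.
Proof. by case. Qed.

(** On [0, n] the integral is at most F n - F 0 <= C; monotone convergence in n and evenness do the
    rest. *)
Lemma bounded_primitive_itg (f F F' : R -> R) C : continuous f -> (forall x, 0 <= f x) ->
  (forall x, f (- x) = f x) -> continuous F' ->
  (forall x, 0 <= x -> is_derive x 1 F (F' x)) -> (forall x, 0 <= x -> f x <= F' x) ->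
  (forall x, 0 <= x -> F x - F 0 <= C) ->
  mu.-integrable setT (EFin \o f).
Proof.
move=> cf f0 fe cF' dF fF FC.
have C0 : 0 <= C by have := FC 0 (lexx 0); rewrite subrr.
have mf : measurable_fun [set: R] f by exact: continuous_measurable.
have bound (n : nat) : (\int[mu]_(x in `[0%R, n%:R]) (f x)%:E <= C%:E)%E.
  rewrite itg_EFin//; last exact: continuous_itg.
  rewrite lee_fin; have n0 : 0 <= n%:R :> R by [].
  apply: (@le_trans _ _ (\int[mu]_(x in `[0, n%:R]) F' x)).
    apply: le_Rintegral => //; [exact: continuous_itg|exact: continuous_itg|].
    by move=> x /=; rewrite in_itv/= => /andP[x0 _]; exact: fF.
  apply: le_trans (FC n%:R n0).
  rewrite (Rint_derive n0 cF' _ (fun x xp _ => dF x (ltW xp)))//.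
  by apply: within_derive => x x0 _; exact: dF.
apply/integrableP; split; first exact/measurable_EFinP.
have -> : (\int[mu]_x `|(EFin \o f) x| = \int[mu]_x (f x)%:E)%E.
  by apply: eq_integral => x _ /=; rewrite ger0_norm.
rewrite ge0_symfun_integralT//; last by move=> x /=; rewrite fe.
rewrite lte_mul_pinfty//.
have -> : [set x | (0 <= x)%R] = \bigcup_n `[(0:R)%R, (n%:R)%R]%classic.
  apply/seteqP; split=> [x /= x0|x [n _] /=]; last by rewrite in_itv/= => /andP[].
  exists (Num.truncn x).+1 => //=; rewrite in_itv/= x0/=.
  by apply: ltW; exact: truncnS_gt.
have cv := @ge0_nondecreasing_set_cvg_integral _ (measurableTypeR R) R
  (fun n : nat => `[(0:R), n%:R]%classic) (EFin \o f) mu.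
have mon : {homo (fun n : nat => `[(0:R), n%:R]%classic) : n m / (n <= m)%N >-> (n <= m)%O}.
  move=> n m nm; apply/subsetPset; apply: subset_itv; rewrite ?bnd_simp//.
  by rewrite ler_nat.
have mfn (n : nat) : measurable_fun `[(0:R), n%:R] (EFin \o f).
  by apply/measurable_EFinP; exact: measurable_funTS.
have {cv} cv := cv mon (fun _ => measurable_itv _) mfn (fun _ x _ => f0 x).
apply: (@le_lt_trans _ _ C%:E); last exact: ltry.
rewrite -(cvg_lim _ cv)//; apply: lime_le; first by apply/cvg_ex; eexists; exact: cv.
by near=> n; exact: bound.
Unshelve. all: by end_near. Qed.

Lemma eprof_sq_itg r : admissible r ->
  mu.-integrable setT (EFin \o (fun y => eprof r y ^+ 2)).
Proof.
move=> ar; have r0 := admissible_ge0 ar.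
have fc := eprof_sq_continuous r0.
have f0 y : 0 <= eprof r y ^+ 2 by exact: sqr_ge0.
have fe y : eprof r (- y) ^+ 2 = eprof r y ^+ 2 by rewrite eprof_even.
case: ar => _ r1 ar.
have [rp|rn] := ltP 0 r.
  (* [w^2 <= (- w^2 / (2 r))'] since [- w' >= r w]. *)
  have ec := eprof_continuous r0.
  apply: (@bounded_primitive_itg _ (fun y => - (prof r y ^+ 2 / (2 * r)))
    (fun y => eprof r y ^+ 2 *
       Num.sqrt (r ^+ 2 + (1 - r ^+ 2) * `|eprof r y| `^ (2 * gam)) / r) (2 * r)^-1) => //.
  - apply: continuous_mulf; last exact: continuous_cstf.
    apply: continuous_mulf => //.
    apply: (continuous_compf (f := Num.sqrt)); first exact: sqrt_continuous.
    apply: continuous_addf; first exact: continuous_cstf.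
    apply: continuous_mulf; first exact: continuous_cstf.
    apply: (continuous_compf (f := fun x => `|x| `^ (2 * gam))) => //.
    by apply: continuous_norm_powR; rewrite mulr_gt0.
  - move=> x x0; have d := is_derive_sqrf (prof_ode r0 r1 x0).
    apply: (trigger_derive (is_derive_oppf (is_derive_mulf d (is_derive_cstf (2 * r)^-1 x)))).
    rewrite (gtr0_norm (eprof_gt0 _ r0)) /eprof (ger0_norm x0) mulr0 add0r.
    by field; rewrite gt_eqF.
  - move=> x x0; rewrite -mulrA ler_peMr// ler_pdivlMr// mul1r.
    rewrite -[X in X <= _]ger0_norm// -sqrtr_sqr ler_wsqrtr// lerDl.
    by rewrite mulr_ge0 ?powR_ge0// subr_ge0 exprn_ile1.
  - move=> x x0; rewrite prof0 expr1n mul1r opprK gerDr oppr_le0 divr_ge0 ?sqr_ge0//.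
    by rewrite mulr_ge0.
have g2 : gam < 2 by case: ar => //; rewrite ltNge rn.
have rE : r = 0 by lra.
subst r.
have hc : continuous (fun y => 1 + gam * `|y|).
  by apply: continuous_addf; [exact: continuous_cstf|
    apply: continuous_mulf; [exact: continuous_cstf|exact: continuous_normf (@continuous_idf R)]].
(* At r = 0 the squared profile is (1 + gam y)^(-2/gam), whose explicit primitive is bounded because
   2 / gam > 1. *)
apply: (@bounded_primitive_itg _ (fun y => - ((1 + gam * y) `^ (1 - 2 / gam) / (2 - gam)))
    (fun y => eprof 0 y ^+ 2) (2 - gam)^-1) => //.
- move=> x x0; have h0 : 0 < 1 + gam * x by rewrite ltr_pwDl// mulr_ge0// ltW.
  have d := @is_derive_compf _ (fun t => t `^ (1 - 2 / gam)) (fun t => 1 + gam * t) x _ _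
    (is_derive1_powR _ h0) (is_derive_addf (is_derive_cstf 1 x) (is_derive_scalef gam (is_derive_idf x))).
  apply: (trigger_derive (is_derive_oppf (is_derive_mulf d (is_derive_cstf (2 - gam)^-1 x)))).
  rewrite /eprof (ger0_norm x0) /prof /hyp eqxx -[RHS]powR_mulrn ?powR_ge0// -powRrM.
  have -> : 1 - 2 / gam - 1 = - gam^-1 * 2%:R by field; rewrite gt_eqF.
  set X := _ `^ (_ * _); rewrite mulr0 add0r mulr1 add0r.
  by field; rewrite (gt_eqF gam0) gt_eqF//; lra.
- move=> x x0; rewrite mulr0 addr0 powR1 mul1r opprK gerDr oppr_le0 divr_ge0 ?powR_ge0//.
  by lra.
Qed.

Lemma admissible_ge r s : admissible r -> r <= s -> s <= 1 -> admissible s.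
Proof.
move=> [r0 r1 ar] rs s1; split => //; first lra.
by case: ar => [h|h]; [left; lra|right].
Qed.

Lemma pmass_mono r s : admissible r -> r <= s -> s <= 1 -> pmass s <= pmass r.
Proof.
move=> ar rs s1; have r0 := admissible_ge0 ar.
have as_ := admissible_ge ar rs s1.
apply: le_Rintegral => //; [exact: eprof_sq_itg|exact: eprof_sq_itg|].
move=> y _; have s0 := admissible_ge0 as_.
apply: sqr_le_sqr; first exact: eprof_ge0.
by apply: prof_le => //; exact: hyp_mono.
Qed.

Lemma Rint_scale (G : R -> R) c : 0 < c -> continuous G -> (forall x, 0 <= G x) ->
  mu.-integrable setT (EFin \o G) ->
  mu.-integrable setT (EFin \o (fun x => G (c * x))) /\
  \int[mu]_x G (c * x) = \int[mu]_x G x / c.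
Proof.
move=> c0 cG G0 iG.
have dF x : is_derive x 1 (fun t : R => c * t) c.
  by apply: (trigger_derive (is_derive_scalef c (is_derive_idf x))); rewrite mulr1.
have F'E : derive1 (fun t : R => c * t) = cst c by apply/funext => x; exact: is_derive_derive1.
have := @increasing_ge0_integration_by_substitutionT R (fun t => c * t) G.
rewrite F'E => H.
have {H} E : (\int[mu]_x (G x)%:E = \int[mu]_x (c * G (c * x))%:E)%E.
  rewrite H//.
  - by apply: eq_integral => x _; congr EFin; rewrite fctE /= mulrC.
  - by move=> x y xy; rewrite ltr_pM2l.
  - by move=> x; exact: cst_continuous.
  - by apply/cvg_ex; exists c; exact: cvg_cst.
  - by apply/cvg_ex; exists c; exact: cvg_cst.
  - by apply: gt0_cvgMrNy => //; exact: cvg_id.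
  - by apply: gt0_cvgMry => //; exact: cvg_id.
have iGc : mu.-integrable setT (EFin \o (fun x => c * G (c * x))).
  apply/integrableP; split.
    apply/measurable_EFinP; apply: continuous_measurable => //.
    apply: continuous_mulf; first exact: continuous_cstf.
    apply: (continuous_compf cG).
    by apply: continuous_mulf; [exact: continuous_cstf|exact: continuous_idf].
  have -> : (\int[mu]_x `|(EFin \o (fun x => (c * G (c * x))%R)) x| = \int[mu]_x (c * G (c * x))%R%:E)%E.
    by apply: eq_integral => x _ /=; rewrite ger0_norm// mulr_ge0// ltW.
  by rewrite -E; exact: integrable_lty.
have iGc' : mu.-integrable setT (EFin \o (fun x => G (c * x))).
  have := itgZ c^-1 measurableT iGc; congr (mu.-integrable _ (EFin \o _)).
  by apply/funext => x; rewrite mulKf// gt_eqF.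
split => //.
have : \int[mu]_x G x = \int[mu]_x (c * G (c * x)) by rewrite /Rintegral E.
by rewrite RintegralZl// => ->; rewrite [c * _]mulrC mulfK// gt_eqF.
Qed.

Let eprof_scale_le r s y : 0 < r -> r <= s -> eprof r (s / r * y) ^+ 2 <= eprof s y ^+ 2.
Proof.
move=> r0 rs; have s0 : 0 < s by lra.
apply: sqr_le_sqr; first by apply: eprof_ge0; exact: ltW.
have c0 : 0 < s / r by rewrite divr_gt0.
rewrite /eprof normrM (gtr0_norm c0); apply: prof_le; rewrite ?(ltW r0) ?(ltW s0)//.
  by rewrite mulr_ge0// ltW.
exact: hyp_scale.
Qed.

(** A monotonicity opposite to [pmass_mono], from [hyp_scale] by a change of variable. *)
Lemma pmass_scale_mono r s : 0 < r -> r <= s -> s <= 1 -> r * pmass r <= s * pmass s.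
Proof.
move=> r0 rs s1; have s0 : 0 < s by lra.
have ar : admissible r by split; [lra|lra|left].
have as_ : admissible s by split; [lra|lra|left].
have c0 : 0 < s / r by rewrite divr_gt0.
have [i1 e1] := Rint_scale c0 (eprof_sq_continuous (ltW r0)) (fun x => sqr_ge0 _) (eprof_sq_itg ar).
have : \int[mu]_x (eprof r (s / r * x) ^+ 2) <= pmass s.
  by apply: RintT_le => //; [exact: eprof_sq_itg|move=> y; exact: eprof_scale_le].
rewrite e1 -/(pmass r); move: (pmass r) (pmass s) => P Q.
by rewrite invf_div mulrA ler_pdivrMr// mulrC [Q * s]mulrC.
Qed.

(** The two monotonicities trap [pmass s] between [pmass r] and (r / s) [pmass r], which gives
    continuity in r > 0 with no limit under the integral. *)
Lemma pmass_dist r s : 0 < r -> r <= 1 -> 0 < s -> s <= 1 ->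
  `|pmass s - pmass r| <= `|1 - r / s| * pmass r.
Proof.
move=> r0 r1 s0 s1.
have p0 t : 0 <= pmass t by apply: Rintegral_ge0 => x _; exact: sqr_ge0.
have [rs|sr] := leP r s.
  have ar : admissible r by split; [lra|lra|left].
  have h1 := pmass_mono ar rs s1.
  have h2 := pmass_scale_mono r0 rs s1.
  have h3 : r / s <= 1 by rewrite ler_pdivrMr// mul1r.
  have h4 : r / s * pmass r <= pmass s by rewrite mulrAC ler_pdivrMr// [pmass s * s]mulrC.
  move: (pmass r) (pmass s) h1 h4 => P Q h1 h4.
  rewrite ler0_norm ?subr_le0// (@ger0_norm _ (1 - r / s)) ?subr_ge0//.
  by rewrite mulrBl mul1r opprB lerD2l lerN2.
have as_ : admissible s by split; [lra|lra|left].
have h1 := pmass_mono as_ (ltW sr) r1.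
have h2 := pmass_scale_mono s0 (ltW sr) r1.
have h3 : 1 <= r / s by rewrite ler_pdivlMr// mul1r ltW.
have h4 : pmass s <= r / s * pmass r by rewrite mulrAC ler_pdivlMr// [pmass s * s]mulrC.
move: (pmass r) (pmass s) h1 h4 => P Q h1 h4.
rewrite ger0_norm ?subr_ge0// (@ler0_norm _ (1 - r / s)) ?subr_le0//.
by rewrite opprB mulrBl mul1r lerD2r.
Qed.

Lemma prof_ge_exp r y : 0 <= r -> 0 <= y -> expR (- (r * y)) * prof 0 y <= prof r y.
Proof.
move=> r0 y0; have h1 := hyp_ge1 r0 y0; have h2 := hyp_ge1 (lexx 0) y0.
have -> : expR (- (r * y)) = expR (gam * r * y) `^ (- gam^-1).
  by rewrite -expRM; congr expR; field; rewrite gt_eqF.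
rewrite /prof -powRM ?expR_ge0//; last lra.
have E0 := expR_gt0 (gam * r * y).
have hE : 0 < expR (gam * r * y) * hyp 0 y by rewrite mulr_gt0//; lra.
rewrite !powRN lef_pV2 ?posrE ?powR_gt0//; last lra.
by apply: ge0_ler_powR; rewrite ?nnegrE ?invr_ge0 ?(ltW gam0) ?(ltW hE)//; [lra|exact: hyp_le_exp].
Qed.

Definition pmass_trunc L := \int[mu]_(y in `[- L, L]) (eprof 0 y ^+ 2).

(** Controls the mass from below as r tends to 0, where [pmass] may blow up: on [-L, L] the profile
    is at least exp(-r L) times that of r = 0, and exp(-2 r L) >= 1 - 2 r L. *)
Lemma pmass_ge_trunc r L : 0 < r -> r <= 1 -> 0 <= L ->
  (1 - 2 * (r * L)) * pmass_trunc L <= pmass r.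
Proof.
move=> r0 r1 L0; have ar : admissible r by split; [lra|lra|left].
apply: (@le_trans _ _ (\int[mu]_(y in `[- L, L]) (eprof r y ^+ 2))); last first.
  by apply: Rint_itv_leT; [exact: eprof_sq_itg|move=> x; exact: sqr_ge0].
have ci := continuous_itg (- L) L (eprof_sq_continuous (lexx 0)).
rewrite -RintegralZl//; apply: le_Rintegral => //.
- exact: itgZ.
- exact: continuous_itg (eprof_sq_continuous (ltW r0)).
move=> y /=; rewrite in_itv/= -ler_norml => yL.
have h1 := prof_ge_exp (ltW r0) (normr_ge0 y).
have e0 := expR_gt0 (- (r * `|y|)); have p0 := prof_gt0 (lexx 0) (normr_ge0 y).
have : (expR (- (r * `|y|)) * prof 0 `|y|) ^+ 2 <= prof r `|y| ^+ 2.
  by rewrite lerXn2r ?nnegrE ?mulr_ge0 ?(ltW e0) ?(ltW p0)// (le_trans _ h1)// mulr_ge0// ltW.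
rewrite exprMn => h2; apply: le_trans h2; apply: ler_wpM2r; first exact: sqr_ge0.
rewrite expr2 -expRD; apply: le_trans (expR_ge1Dx _).
have : r * `|y| <= r * L by rewrite ler_pM2l.
lra.
Qed.

(** The profile w is at most 1, so w^2 >= w^gam = 1 / (1 + gam y), with integral ln(1 + gam L) / gam
    over [0, L]; L is chosen with ln(gam L) = gam |C|. *)
Lemma pmass_trunc_unbounded : 2 <= gam -> forall C, exists2 L, 0 <= L & C <= pmass_trunc L.
Proof.
move=> g2 C; pose L := expR (gam * `|C|) / gam.
have L0 : 0 <= L by rewrite divr_ge0 ?expR_ge0// ltW.
exists L => //.
have e0 : continuous (eprof 0) by exact: eprof_continuous.
have ce : continuous (fun y => `|eprof 0 y| `^ gam).
  by apply: (continuous_compf (f := fun x => `|x| `^ gam)) => //; exact: continuous_norm_powR.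
have ci := continuous_itg (- L) L (eprof_sq_continuous (lexx 0)).
rewrite /pmass_trunc (@Rint_split _ _ (- L) 0 L)//; last by lra.
apply: ler_wpDl; first by apply: Rintegral_ge0 => x _; exact: sqr_ge0.
apply: (@le_trans _ _ (\int[mu]_(y in `[0, L]) (`|eprof 0 y| `^ gam))); last first.
  apply: le_Rintegral => //; [exact: continuous_itg|exact: continuous_itg (eprof_sq_continuous (lexx 0))|].
  move=> y /=; rewrite in_itv/= => /andP[y0 _].
  have p0 := prof_gt0 (lexx 0) y0; have p1 := prof_le1 (lexx 0) y0.
  rewrite /eprof (ger0_norm y0) (gtr0_norm p0) -powR_mulrn ?(ltW p0)//.
  by apply: ger_powR => //; rewrite p0 p1.
have dln x : 0 <= x -> is_derive x 1 (fun y => ln (1 + gam * y) / gam) (`|eprof 0 x| `^ gam).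
  move=> x0; have h0 : 0 < 1 + gam * x by rewrite ltr_pwDl// mulr_ge0// ltW.
  have d := @is_derive_compf _ (@ln R) (fun t => 1 + gam * t) x _ _ (is_derive1_ln h0)
    (is_derive_addf (is_derive_cstf 1 x) (is_derive_scalef gam (is_derive_idf x))).
  apply: (trigger_derive (is_derive_mulf d (is_derive_cstf gam^-1 x))).
  rewrite (gtr0_norm (eprof_gt0 _ (lexx 0))) /eprof (ger0_norm x0) /prof /hyp eqxx.
  rewrite -powRrM mulNr mulVf ?gt_eqF// powR_inv1 ?(ltW h0)//.
  by field; rewrite (gt_eqF gam0) gt_eqF.
rewrite (Rint_derive L0 ce _ (fun x xp _ => dln x (ltW xp))).
- rewrite /= mulr0 addr0 ln1 mul0r subr0 ler_pdivlMr//.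
  apply: (@le_trans _ _ (ln (expR (gam * `|C|)))).
    by rewrite expRK mulrC ler_pM2l// ler_norm.
  rewrite ler_ln ?posrE ?expR_gt0//; last by rewrite ltr_pwDl// mulr_ge0// ltW.
  by rewrite /L mulrCA mulfV ?gt_eqF// mulr1 lerDr.
- by apply: within_derive => x x0 _; exact: dln.
Qed.

Lemma pmass_trunc_cvg : gam < 2 -> forall e, 0 < e ->
  exists2 L, 0 <= L & pmass 0 - e <= pmass_trunc L.
Proof.
move=> g2 e e0; have a0 : admissible 0 by split => //; right.
have [N hN] := Rint_exhaust e0 (eprof_sq_itg a0).
exists `|N| => //; have := hN (- `|N|) `|N|; rewrite lerN2 ler_norm => /(_ isT isT).
by rewrite ler_norml -/(pmass 0) -/(pmass_trunc _) => /andP[_]; lra.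
Qed.

Lemma pmass_gt0 r : admissible r -> 0 < pmass r.
Proof.
move=> ar; have r0 := admissible_ge0 ar.
have w1 := prof_gt0 r0 (@ler01 R).
apply: (@lt_le_trans _ _ (prof r 1 ^+ 2)); first by rewrite exprn_gt0.
have -> : prof r 1 ^+ 2 = \int[mu]_(y in `[0, 1]) (prof r 1 ^+ 2).
  by rewrite Rint_cst// subr0 mulr1.
apply: (@le_trans _ _ (\int[mu]_(y in `[0, 1]) (eprof r y ^+ 2))).
  have i1 : mu.-integrable `[0, 1] (EFin \o (fun y : R => prof r 1 ^+ 2)).
    by apply: continuous_itg; exact: continuous_cstf.
  apply: (Rint_le i1 (continuous_itg 0 1 (eprof_sq_continuous r0))) => y y0 y1.
  apply: sqr_le_sqr; first exact: ltW.
  rewrite /eprof (ger0_norm y0).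
  apply: prof_le => //.
  apply: (derive_ge0_le y1 _ (fun z _ _ => hyp_derive r z)).
    by apply: continuous_subspaceT; exact: is_derive_continuous (hyp_derive r).
  move=> z yz _; have := hyp'_ge1 r0 (le_trans y0 (ltW yz)) => ?.
  by rewrite mulr_ge0 ?(ltW gam0)//; lra.
by apply: Rint_itv_leT; [exact: eprof_sq_itg|move=> x; exact: sqr_ge0].
Qed.

End Profile.

(** * From integrated to weak derivatives, corners at the origin, test functions vanishing near 0 *)

Section WeakDerivativeOfPrimitive.
Context {R : realType}.
Notation mu := (@lebesgue_measure R).
Implicit Types (u g k phi : R -> R) (a b x L : R).

Lemma C1c_is_derive phi x : C1c phi -> is_derive x 1 phi (derive1 phi x).
Proof. by move=> [dp _ _]; split; [exact: dp|rewrite derive1E]. Qed.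

Lemma C1c_continuous phi : C1c phi -> continuous phi.
Proof. by move=> cp; apply: is_derive_continuous => x; exact: C1c_is_derive. Qed.

Lemma C1c_vanish_near phi (A : set R) x : open A -> A x ->
  (forall y, A y -> phi y = 0) -> derive1 phi x = 0.
Proof.
move=> oA Ax A0; apply: is_derive_derive1.
have E : \forall t \near x, (fun _ : R => 0 : R) t = phi t.
  by near=> t; rewrite A0//; near: t; exact: open_nbhs_nbhs.
exact: (is_derive_nearf E (is_derive_cstf (0:R) x)).
Unshelve. all: by end_near. Qed.

Lemma C1c_bounded phi : C1c phi -> exists2 L, 0 < L &
  forall x, L <= `|x| -> phi x = 0 /\ derive1 phi x = 0.
Proof.
move=> [_ _ /compact_bounded[M [_ /(_ (`|M| + 1))]]].
have M1 : M < `|M| + 1 by rewrite (le_lt_trans (ler_norm M))// ltrDl.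
(* The function vanishes beyond |M| + 1; the extra unit places x inside an open set of zeros, where
   the derivative vanishes too. *)
move=> /(_ M1) SM; exists (`|M| + 2); first by have := normr_ge0 M; lra.
have phi0 y : `|M| + 1 < `|y| -> phi y = 0.
  move=> My; apply/eqP; apply/negP => /negP py.
  have : supp phi y by apply: subset_closure.
  by move/SM; rewrite /= leNgt My.
move=> x xM; split; first by apply: phi0; lra.
apply: (@C1c_vanish_near _ [set y | `|M| + 1 < `|y|]) => //=; last by lra.
apply: (@open_comp _ _ (fun y : R => `|y|) [set z | `|M| + 1 < z]).
  by move=> y _; exact: norm_continuous.
exact: open_gt.
Qed.

(** The converse of [H1_primitive]: the product rule for u phi on an interval at whose ends phi
    vanishes. *)
Lemma weak_derivative_of_primitive u g : continuous u ->
  (forall a b, primitive_on a b u g) -> is_weak_derivative u g.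
Proof.
move=> cu ug phi cp; have [L L0 HL] := C1c_bounded cp.
have cphi := C1c_continuous cp.
have out x : ~ `[- L, L]%classic x -> phi x = 0 /\ derive1 phi x = 0.
  move=> /= xL; apply: HL; rewrite leNgt; apply/negP => h; apply: xL.
  by rewrite in_itv/= -ler_norml ltW.
have [_ c' _] := cp.
have vp : primitive_on (- L) L phi (derive1 phi).
  by apply: primitive_C1 => // x; exact: C1c_is_derive.
have LL : - L <= L by lra.
have [_ /(_ (- L) L (lexx _) LL (lexx _))] := primitive_onM LL cu cphi (ug _ _) vp.
move=> /=.
have [-> _] := HL L ltac:(rewrite gtr0_norm//); have [-> _] := HL (- L) ltac:(rewrite normrN gtr0_norm//).
rewrite !mulr0 subrr => E.
rewrite (@Rint_supp _ (fun x => u x * derive1 phi x) (- L) L); last first.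
  by move=> x /out[_ ->]; rewrite mulr0.
rewrite (@Rint_supp _ (fun x => g x * phi x) (- L) L); last first.
  by move=> x /out[-> _]; rewrite mulr0.
have [gi _] := ug (- L) L.
have i1 : mu.-integrable `[- L, L] (EFin \o (fun x => u x * derive1 phi x)).
  by apply: continuous_itg; exact: continuous_mulf.
have i2 : mu.-integrable `[- L, L] (EFin \o (fun x => phi x * g x)) by exact: (itg_mul_cont cphi gi).
move: E; rewrite RintegralD// => E.
have -> : \int[mu]_(x in `[- L, L]) (g x * phi x) = \int[mu]_(x in `[- L, L]) (phi x * g x).
  by apply: eq_Rintegral => x _; rewrite mulrC.
lra.
Qed.

Lemma H1_of_primitive u g : continuous u -> sqint u -> sqint g ->
  (forall a b, primitive_on a b u g) -> H1 u.
Proof.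
move=> cu su sg ug; split => //; first exact/L2P.
by exists g; [exact/L2P|exact: weak_derivative_of_primitive].
Qed.

(** A corner at 0 does not show in the integrated form: split the interval at 0 and use continuity
    of [u] there. *)
Lemma primitive_even u k : continuous u -> continuous k ->
  (forall x, 0 < x -> is_derive x 1 u (k x)) ->
  (forall x, x < 0 -> is_derive x 1 u (- k x)) ->
  forall a b, primitive_on a b u (fun x => sgn x * k x).
Proof.
move=> cu ck dp dn a b.
have gi a' b' : mu.-integrable `[a', b'] (EFin \o (fun x => sgn x * k x)).
  apply: (@itg_dom _ _ (fun x => `|k x|)) => //.
  - apply: measurable_funTS; apply: measurable_funM; first exact: sgn_measurable.
    exact: continuous_measurable.
  - by move=> x _; rewrite normrM /sgn; case: ifP; rewrite ?normrN normr1 mul1r.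
  - by apply: integrable_norm; exact: continuous_itg.
split => // s t _ st _.
have right s' t' : 0 <= s' -> s' <= t' -> u t' - u s' = \int[mu]_(x in `[s', t']) (sgn x * k x).
  move=> s0 st'.
  rewrite -(Rint_derive st' ck (continuous_subspaceT cu) (fun x sx _ => dp x (le_lt_trans s0 sx))).
  by apply: eq_Rintegral => x; rewrite inE/= in_itv/= => /andP[sx _]; rewrite sgn_pos ?mul1r//; lra.
have left s' t' : t' <= 0 -> s' <= t' -> u t' - u s' = \int[mu]_(x in `[s', t']) (sgn x * k x).
  move=> t0 st'; have ckN := continuous_oppf ck.
  rewrite -(Rint_derive st' ckN (continuous_subspaceT cu) (fun x _ xt => dn x (lt_le_trans xt t0))).
  apply: eq_Rint_oo => //; first exact: continuous_itg.
  by move=> x; rewrite in_itv/= => /andP[_ xt]; rewrite sgn_neg ?mulN1r//; lra.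
have [s0|s0] := leP 0 s; first exact: right.
have [t0|t0] := leP t 0; first exact: left.
rewrite (@Rint_split _ _ s 0 t)//; [|exact: ltW|exact: ltW].
rewrite -left ?(ltW s0)// -right ?(ltW t0)//; ring.
Qed.

Lemma right_slope u k : continuous u -> continuous k ->
  (forall x, 0 < x -> is_derive x 1 u (k x)) ->
  (u h - u 0) / h @[h --> 0^'+] --> k 0.
Proof.
move=> cu ck du; apply/cvgrPdist_lt => e e0.
have /cvgrPdist_lt /(_ _ e0) [d /= d0 hd] := ck 0.
exists d => // h /=; rewrite /ball/= sub0r normrN => hd' h0.
have dx x : x \in `]0, h[ -> is_derive x 1 u (k x).
  by rewrite in_itv/= => /andP[x0 _]; exact: du.
have [c ch ->] := MVT_segment (ltW h0) dx (continuous_subspaceT cu).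
rewrite subr0 mulfK ?gt_eqF//; apply: hd; rewrite /ball/= sub0r normrN.
have c0 : 0 <= c by rewrite (itvP ch).
have cle : c <= h by rewrite (itvP ch).
by move: hd'; rewrite (gtr0_norm h0) (ger0_norm c0); lra.
Qed.

Lemma left_slope u k : continuous u -> continuous k ->
  (forall x, x < 0 -> is_derive x 1 u (k x)) ->
  (u h - u 0) / h @[h --> 0^'-] --> k 0.
Proof.
move=> cu ck du; apply/cvgrPdist_lt => e e0.
have /cvgrPdist_lt /(_ _ e0) [d /= d0 hd] := ck 0.
exists d => // h /=; rewrite /ball/= sub0r normrN => hd' h0.
have dx x : x \in `]h, 0[ -> is_derive x 1 u (k x).
  by rewrite in_itv/= => /andP[_ x0]; exact: du.
have [c ch E] := MVT_segment (ltW h0) dx (continuous_subspaceT cu).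
have -> : (u h - u 0) / h = k c.
  rewrite (_ : u h - u 0 = k c * h) ?mulfK ?lt_eqF//; lra.
apply: hd; rewrite /ball/= sub0r normrN.
have c0 : c <= 0 by rewrite (itvP ch).
have cle : h <= c by rewrite (itvP ch).
by move: hd'; rewrite (ltr0_norm h0) (ler0_norm c0); lra.
Qed.

Lemma supp_vanish_near phi x : ~ supp phi x -> \forall t \near x, phi t = 0.
Proof.
move=> sx; have : nbhs x (~` supp phi).
  by apply: open_nbhs_nbhs; split => //; apply: closed_openC; exact: closed_closure.
apply: filterS => t st; apply/eqP; apply/negP => /negP pt; apply: st.
exact: subset_closure.
Qed.

Lemma sgn_near x : x != 0 -> \forall t \near x, sgn t = sgn x :> R.
Proof.
rewrite neq_lt => /orP[x0|x0]; near=> t.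
  by rewrite !sgn_neg//; near: t; exact: lt_nbhsl.
by rewrite !sgn_pos ?ltW//; near: t; exact: lt_nbhsr.
Unshelve. all: by end_near. Qed.

Lemma sgn_mul_continuous phi : continuous phi -> (\forall t \near 0, phi t = 0) ->
  continuous (fun x => sgn x * phi x).
Proof.
move=> cp p0 x; have [->|x0] := eqVneq x 0.
  have E : \forall t \near 0, (fun _ : R => 0 : R) t = sgn t * phi t.
    by apply: filterS p0 => t ->; rewrite mulr0.
  exact: (is_derive_cont (is_derive_nearf E (is_derive_cstf (0:R) 0))).
have c : {for x, continuous (fun t => sgn x * phi t)}.
  by apply: continuousM; [exact: cst_continuous|exact: cp].
have E : {near x, (fun t => sgn x * phi t) =1 (fun t => sgn t * phi t)}.
  by apply: filterS (sgn_near x0) => t ->.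
have := cvg_trans (near_eq_cvg E) c.
apply; exact: nbhs_filter.
Qed.

(** Multiplying by [sgn] is harmless for a test function that vanishes near 0. This moves the sign
    in the derivative of an even function onto the test function. *)
Lemma sgn_C1c phi : C1c phi -> ~ supp phi 0 ->
  C1c (fun x => sgn x * phi x) /\
  derive1 (fun x => sgn x * phi x) = (fun x => sgn x * derive1 phi x).
Proof.
move=> cp phi0; have p0 := supp_vanish_near phi0.
have d x : is_derive x 1 (fun x => sgn x * phi x) (sgn x * derive1 phi x).
  have [->|x0] := eqVneq x 0.
    have E : \forall t \near 0, (fun _ : R => 0 : R) t = sgn t * phi t.
      by apply: filterS p0 => t ->; rewrite mulr0.
    have E' : \forall t \near 0, (fun _ : R => 0 : R) t = phi t.
      by apply: filterS p0 => t ->.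
    have := is_derive_nearf E (is_derive_cstf (0:R) 0).
    by rewrite (is_derive_derive1 (is_derive_nearf E' (is_derive_cstf (0:R) 0))) mulr0.
  apply: (@is_derive_nearf _ (fun t => sgn x * phi t)).
    by apply: filterS (sgn_near x0) => t ->.
  by apply: is_derive_scalef; exact: C1c_is_derive.
have dE : derive1 (fun x => sgn x * phi x) = (fun x => sgn x * derive1 phi x).
  by apply/funext => x; exact: is_derive_derive1.
have [_ c' cs] := cp.
split; last exact: dE.
split; first by move=> x; have [] := d x.
  rewrite dE; apply: sgn_mul_continuous => //.
  have : nbhs (0:R) (~` supp phi).
    by apply: open_nbhs_nbhs; split => //; apply: closed_openC; exact: closed_closure.
  apply: filterS => t st; apply: (@C1c_vanish_near _ (~` supp phi)) => //.
    by apply: closed_openC; exact: closed_closure.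
  move=> y sy; apply/eqP; apply/negP => /negP py; apply: sy; exact: subset_closure.
rewrite (_ : supp _ = supp phi)//; congr closure; apply/funext => x /=.
by rewrite mulf_eq0 -sqrf_eq0 sgn2 oner_eq0.
Qed.

End WeakDerivativeOfPrimitive.

(** * Integrability of the p-th power and of the squared slope *)

Section PowerIntegrability.
Context {R : realType} (p : R).
Notation mu := (@lebesgue_measure R).
Implicit Types (l x C : R) (v : R -> R).
Hypothesis hp : 2 < p.

Let p0 : 0 < p. Proof. by have := hp; lra. Qed.

Definition powp_itg v := mu.-integrable setT (EFin \o (fun x => `|v x| `^ p)).

Lemma powp_measurable v : continuous v -> measurable_fun setT (fun x => `|v x| `^ p).
Proof.
move=> cv; apply: continuous_measurable => //.
by apply: (continuous_compf (f := fun z => `|z| `^ p)) => //; exact: continuous_norm_powR.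
Qed.

Lemma powp_itg_bounded v C : continuous v -> sqint v -> (forall x, `|v x| <= C) -> powp_itg v.
Proof.
move=> cv [mv iv] vC; have C0 : 0 <= C by exact: le_trans (vC 0).
apply: (@itg_dom _ _ (fun x => C `^ (p - 2) * v x ^+ 2)) => //.
- exact: powp_measurable.
- move=> x _; rewrite ger0_norm ?powR_ge0// norm_powR_sq ?gt_eqF// ler_wpM2r ?sqr_ge0//.
  by apply: ge0_ler_powR; rewrite ?nnegrE//; have := hp; lra.
- exact: itgZ.
Qed.

Lemma slope_sq l x : 0 <= l -> slope p l x ^+ 2 = l * x ^+ 2 + 2 / p * `|x| `^ p.
Proof.
move=> l0; rewrite /slope exprMn sqr_sqrtr ?radicand_ge0// /radicand.
by rewrite (norm_powR_sq x (lt0r_neq0 p0)); ring.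
Qed.

Lemma slope_sqint l v : 0 <= l -> continuous v -> sqint v -> powp_itg v ->
  sqint (fun x => slope p l (v x)).
Proof.
move=> l0 cv [mv iv] ip; split.
  apply: continuous_measurable => //.
  by apply: continuous_compf => //; exact: slope_continuous.
have -> : (fun x => slope p l (v x) ^+ 2) = (fun x => l * v x ^+ 2 + 2 / p * `|v x| `^ p).
  by apply/funext => x; exact: slope_sq.
by apply: itgD => //; apply: itgZ.
Qed.

End PowerIntegrability.

(** * Solitons: decaying solutions with the prescribed jump, and their mass *)

Section Solitons.
Context {R : realType} (p q : R).
Notation mu := (@lebesgue_measure R).
Implicit Types (a b x y : R).
Hypotheses (hp : 2 < p) (hq2 : 2 < q) (hqp : q < p / 2 + 1).
Notation gam := ((p - 2) / 2).
Notation lam := (lam p q).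
Notation amp_max := (amp_max p q).

Let gam0 : 0 < gam. Proof. by have := hp; lra. Qed.
Let p0 : 0 < p. Proof. by have := hp; lra. Qed.

(** Substituting u(x) = a w(f x) in u' = - S_lam(a)(u), with f = [freq a] the logarithmic slope at
    the origin, gives the profile equation with r^2 = lam(a) / f^2 = 1 - [kratio a]. *)
Definition rate a := Num.sqrt (1 - kratio p q a).
Definition freq a := a `^ (q - 2) / 2.
Definition soliton a x := a * eprof gam (rate a) (freq a * x).
(** The factor is a^2 / [freq a], from the scalings of amplitude and length. *)
Definition Mass a := 2 * a `^ (4 - q) * pmass gam (rate a).

(** At [amp_max] the rate is 0, and the mass is finite there only if gam < 2, that is p < 6. *)
Definition in_range a := [/\ 0 < a, a <= amp_max & a < amp_max \/ p < 6].

Lemma kratio_le1 a : 0 < a -> a <= amp_max -> kratio p q a <= 1.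
Proof.
move=> a0; rewrite le_eqVlt => /orP[/eqP->|am]; first by rewrite kratio_max.
by rewrite -(kratio_max hp hqp); apply: ltW; apply: kratio_lt => //; exact: ltW.
Qed.

Lemma kratio_lt1 a : 0 < a -> a < amp_max -> kratio p q a < 1.
Proof. by move=> a0 am; rewrite -(kratio_max hp hqp); apply: kratio_lt => //; exact: ltW. Qed.

Lemma rate_ge0 a : 0 <= rate a. Proof. exact: sqrtr_ge0. Qed.

Lemma rate_sq a : 0 < a -> a <= amp_max -> rate a ^+ 2 = 1 - kratio p q a.
Proof. by move=> a0 am; rewrite sqr_sqrtr// subr_ge0 kratio_le1. Qed.

Lemma rate_le1 a : 0 < a -> rate a <= 1.
Proof.
move=> a0; rewrite -[X in _ <= X]sqrtr1 ler_wsqrtr// gerBl.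
by apply: ltW; exact: kratio_gt0.
Qed.

Lemma rate_gt0 a : 0 < a -> a < amp_max -> 0 < rate a.
Proof. by move=> a0 am; rewrite sqrtr_gt0 subr_gt0 kratio_lt1. Qed.

Lemma rate_max : rate amp_max = 0.
Proof. by rewrite /rate kratio_max// subrr sqrtr0. Qed.

Lemma rate_decr a b : 0 < a -> a <= b -> rate b <= rate a.
Proof.
move=> a0; rewrite le_eqVlt => /orP[/eqP->//|ab].
by rewrite ler_wsqrtr// lerD2l lerN2; apply: ltW; apply: kratio_lt => //; exact: ltW.
Qed.

Lemma in_range_admissible a : in_range a -> admissible gam (rate a).
Proof.
move=> [a0 am ar]; split; [exact: rate_ge0|exact: rate_le1|].
by case: ar => [h|h]; [left; exact: rate_gt0|right; lra].
Qed.

Lemma freq_gt0 a : 0 < a -> 0 < freq a.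
Proof. by move=> a0; rewrite divr_gt0// powR_gt0. Qed.

Lemma freq_sq a : freq a ^+ 2 = a `^ (2 * q - 4) / 4.
Proof.
rewrite /freq expr_div_n -powR_mulrn ?powR_ge0// -powRrM.
by congr (_ `^ _ / _); ring.
Qed.

Lemma soliton_gt0 a x : 0 < a -> 0 < soliton a x.
Proof. by move=> a0; rewrite mulr_gt0// eprof_gt0// rate_ge0. Qed.

Lemma soliton0 a : soliton a 0 = a.
Proof. by rewrite /soliton mulr0 /eprof normr0 prof0 mulr1. Qed.

Lemma soliton_even a x : soliton a (- x) = soliton a x.
Proof. by rewrite /soliton mulrN eprof_even. Qed.

Lemma soliton_le a x : 0 < a -> soliton a x <= a.
Proof. by move=> a0; rewrite ger_pMr// /eprof prof_le1// rate_ge0. Qed.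

Lemma soliton_continuous a : continuous (soliton a).
Proof.
apply: continuous_mulf; first exact: continuous_cstf.
apply: (continuous_compf (f := eprof gam (rate a))).
  by apply: eprof_continuous => //; exact: rate_ge0.
by apply: continuous_mulf; [exact: continuous_cstf|exact: continuous_idf].
Qed.

Lemma slope_soliton a w : 0 < a -> a <= amp_max -> 0 <= w ->
  slope p (lam a) (a * w) =
  a * freq a * (w * Num.sqrt (rate a ^+ 2 + (1 - rate a ^+ 2) * w `^ (2 * gam))).
Proof.
move=> a0 am w0; rewrite /slope /radicand normrM (gtr0_norm a0) (ger0_norm w0).
rewrite (lam_kratio _ hp a0) powRM ?(ltW a0)// -freq_sq rate_sq//.
have -> : 2 / p * (a `^ (p - 2) * w `^ (p - 2)) = freq a ^+ 2 * (kratio p q a * w `^ (p - 2)).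
  rewrite freq_sq /kratio (_ : a `^ (p - 2) = a `^ (2 * q - 4) * a `^ (p - 2 * q + 2)).
    by have := gt_eqF p0 => /negbT ?; field.
  rewrite -powRD; last by rewrite (gt_eqF a0) implybT.
  by congr (_ `^ _); ring.
rewrite -mulrDr opprB addrCA subrr addr0 (_ : 2 * gam = p - 2); last by field.
rewrite sqrtrM ?sqr_ge0// sqrtr_sqr gtr0_norm ?freq_gt0//; ring.
Qed.

Lemma soliton_derive a x : 0 < a -> a <= amp_max -> 0 < x ->
  is_derive x 1 (soliton a) (- slope p (lam a) (soliton a x)).
Proof.
move=> a0 am x0; have f0 := freq_gt0 a0; have fx : 0 < freq a * x by rewrite mulr_gt0.
apply: (@is_derive_nearf _ (fun t => a * prof gam (rate a) (freq a * t))).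
  near=> t; rewrite /soliton /eprof gtr0_norm// mulr_gt0//.
  by near: t; exact: lt_nbhsr.
have d := prof_ode gam0 (rate_ge0 a) (rate_le1 a0) (ltW fx).
have := is_derive_scalef a (@is_derive_compf _ (prof gam (rate a)) (fun t => freq a * t) x _ _ d
  (is_derive_scalef (freq a) (is_derive_idf x))).
move/trigger_derive; apply.
rewrite {1}/soliton slope_soliton//; last by apply: ltW; apply: eprof_gt0 => //; exact: rate_ge0.
rewrite /eprof (gtr0_norm fx); ring.
Unshelve. all: by end_near. Qed.

Lemma soliton_derive_neg a x : 0 < a -> a <= amp_max -> x < 0 ->
  is_derive x 1 (soliton a) (slope p (lam a) (soliton a x)).
Proof.
move=> a0 am x0; have x0' : 0 < - x by lra.
have := @is_derive_compf _ (soliton a) (fun t => - t) x _ _ (soliton_derive a0 am x0')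
  (is_derive_oppf (is_derive_idf x)).
have -> : (fun t => soliton a (- t)) = soliton a by apply/funext => t; exact: soliton_even.
by move/trigger_derive; apply; rewrite soliton_even mulrNN mulr1.
Qed.

Lemma soliton_sq_itg a : in_range a ->
  mu.-integrable setT (EFin \o (fun x => soliton a x ^+ 2)) /\
  \int[mu]_x (soliton a x ^+ 2) = Mass a.
Proof.
move=> ar; have [a0 am _] := ar; have aadm := in_range_admissible ar.
have [i1 e1] := Rint_scale (freq_gt0 a0) (eprof_sq_continuous gam0 (rate_ge0 a))
  (fun x => sqr_ge0 _) (eprof_sq_itg gam0 aadm).
have sE : (fun x => soliton a x ^+ 2) = (fun x => a ^+ 2 * eprof gam (rate a) (freq a * x) ^+ 2).
  by apply/funext => x; rewrite /soliton exprMn.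
rewrite sE; split; first exact: itgZ.
rewrite RintegralZl; [|exact: measurableT|exact: i1].
rewrite e1 -/(pmass gam (rate a)) /Mass; move: (pmass gam (rate a)) => P.
have -> : a `^ (4 - q) = a ^+ 2 / a `^ (q - 2).
  rewrite -powR_mulrn ?(ltW a0)// -powRB; last by rewrite (gt_eqF a0) implybT.
  by congr (_ `^ _); ring.
have := powR_gt0 (q - 2) a0; rewrite /freq => /gt_eqF/negbT ?.
by field.
Qed.

Lemma soliton_sqint a : in_range a -> sqint (soliton a).
Proof.
move=> ar; split; last by have [] := soliton_sq_itg ar.
by apply: continuous_measurable => //; exact: soliton_continuous.
Qed.

Lemma soliton_ge0 a x : 0 < a -> 0 <= soliton a x.
Proof. by move=> a0; apply: ltW; exact: soliton_gt0. Qed.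

Lemma soliton_powp_itg a : in_range a -> powp_itg p (soliton a).
Proof.
move=> ar; have [a0 _ _] := ar.
apply: (powp_itg_bounded hp (@soliton_continuous a) (soliton_sqint ar) (C := a)) => x.
by rewrite ger0_norm ?soliton_ge0// soliton_le.
Qed.

Lemma soliton_slope_sqint a : in_range a -> sqint (fun x => slope p (lam a) (soliton a x)).
Proof.
move=> ar; have [a0 am _] := ar; apply: slope_sqint => //.
- by apply: lam_ge0 => //; exact: ltW.
- exact: soliton_continuous.
- exact: soliton_sqint.
- exact: soliton_powp_itg.
Qed.

Lemma soliton_primitive a : in_range a -> forall c d,
  primitive_on c d (soliton a) (fun x => sgn x * (- slope p (lam a) (soliton a x))).
Proof.
move=> [a0 am _]; apply: primitive_even.
- exact: soliton_continuous.
- apply: continuous_oppf; apply: continuous_compf; [exact: slope_continuous|exact: soliton_continuous].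
- by move=> x x0; exact: soliton_derive.
- by move=> x x0; rewrite opprK; exact: soliton_derive_neg.
Qed.

Lemma soliton_grad_sqint a : in_range a ->
  sqint (fun x => sgn x * (- slope p (lam a) (soliton a x))).
Proof.
move=> ar; apply: sqint_sgn.
have := sqintZ (-1) (soliton_slope_sqint ar).
by congr sqint; apply/funext => x; rewrite mulN1r.
Qed.

Lemma soliton_H1 a : in_range a -> H1 (soliton a).
Proof.
move=> ar; apply: (H1_of_primitive _ _ (soliton_grad_sqint ar) (soliton_primitive ar)).
- exact: soliton_continuous.
- exact: soliton_sqint.
Qed.

Lemma soliton_jump a : 0 < a -> a <= amp_max -> jump_condition q (soliton a).
Proof.
move=> a0 am; have cS : continuous (fun x => slope p (lam a) (soliton a x)).
  by apply: continuous_compf; [exact: slope_continuous|exact: soliton_continuous].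
exists (slope p (lam a) a), (- slope p (lam a) a); split.
- have := @left_slope _ (soliton a) _ (@soliton_continuous a) cS (fun x => soliton_derive_neg a0 am).
  by rewrite !soliton0.
- have := @right_slope _ (soliton a) _ (@soliton_continuous a) (continuous_oppf cS) (fun x => soliton_derive a0 am).
  by rewrite !soliton0.
- by rewrite soliton0 (gtr0_norm a0) /slope radicand_lam ?(ltW a0)//; field.
Qed.

(** The product S S' is half the derivative of S^2, which is the right-hand side of the second-order
    equation. *)
Lemma slope_pos_derive l x : 0 <= l -> 0 < x ->
  exists2 d : R, is_derive x 1 (slope p l) d & slope p l x * d = l * x + `|x| `^ (p - 2) * x.
Proof.
move=> l0 x0; have r0 := radicand_gt0 hp l0 (negbT (gt_eqF x0)).
have d1 : is_derive x 1 (radicand p l) (2 / p * ((p - 2) * x `^ (p - 2 - 1))).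
  have := is_derive_addf (is_derive_cstf l x) (is_derive_scalef (2 / p) (norm_powR_derive (p - 2) x0)).
  by rewrite add0r.
have d2 := is_derive_mulf (is_derive_idf x) (@is_derive_compf _ Num.sqrt (radicand p l) x _ _ (is_derive1_sqrt r0) d1).
eexists; first exact: d2.
have s0 : Num.sqrt (radicand p l x) != 0 by rewrite gt_eqF// sqrtr_gt0.
have ss : Num.sqrt (radicand p l x) * Num.sqrt (radicand p l x) = radicand p l x.
  by rewrite -expr2 sqr_sqrtr// ltW.
have xE : x `^ (p - 2) = x * x `^ (p - 2 - 1) by rewrite mulr_powRB1//; have := hp; lra.
rewrite /slope mul1r.
have -> : x * Num.sqrt (radicand p l x) * (x * ((2 * Num.sqrt (radicand p l x))^-1 *
    (2 / p * ((p - 2) * x `^ (p - 2 - 1)))) + Num.sqrt (radicand p l x)) =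
  x * (x * ((p - 2) / p * x `^ (p - 2 - 1)) +
    Num.sqrt (radicand p l x) * Num.sqrt (radicand p l x)).
  by field; rewrite s0 gt_eqF.
rewrite ss /radicand (gtr0_norm x0) xE.
by field; rewrite gt_eqF.
Qed.

(** W = - S(soliton) is continuous across 0, with soliton' = sgn W and W' = sgn rho. Testing W
    against sgn phi therefore gives the equation on both half-lines at once. *)
Lemma soliton_weak_equation a : in_range a -> weak_equation p (lam a) (soliton a).
Proof.
move=> ar phi cp phi0; have [a0 am _] := ar; have l0 := lam_ge0 hp hq2 hqp (ltW a0) am.
pose W x := - slope p (lam a) (soliton a x).
pose rho x := lam a * soliton a x + `|soliton a x| `^ (p - 2) * soliton a x.
have cs := @soliton_continuous a.
have cW : continuous W.
  by apply: continuous_oppf; apply: continuous_compf; [exact: slope_continuous|exact: cs].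
have c1 : continuous (fun x => lam a * soliton a x).
  by apply: continuous_mulf; [exact: continuous_cstf|exact: cs].
have c2 : continuous (fun x => `|soliton a x| `^ (p - 2) * soliton a x).
  apply: continuous_mulf; last exact: cs.
  apply: (continuous_compf (f := fun z => `|z| `^ (p - 2))); last exact: cs.
  by apply: continuous_norm_powR; have := hp; lra.
have crho : continuous rho by exact: continuous_addf.
have dW x : 0 < x -> is_derive x 1 W (rho x).
  move=> x0; have [d dd dE] := slope_pos_derive l0 (soliton_gt0 x a0).
  have := is_derive_oppf (@is_derive_compf _ _ (soliton a) x _ _ dd (soliton_derive a0 am x0)).
  by move/trigger_derive; apply; rewrite mulrN opprK mulrC dE.
have dWn x : x < 0 -> is_derive x 1 W (- rho x).
  move=> x0; have [d dd dE] := slope_pos_derive l0 (soliton_gt0 x a0).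
  have := is_derive_oppf (@is_derive_compf _ _ (soliton a) x _ _ dd (soliton_derive_neg a0 am x0)).
  by move/trigger_derive; apply; rewrite mulrC dE.
have wW := weak_derivative_of_primitive cW (primitive_even cW crho dW dWn).
have [cs1 dE] := sgn_C1c cp phi0.
have := wW _ cs1; rewrite dE => {}wW.
have [g2 wg] := H1_wderiv (soliton_H1 ar).
have ae := primitive_on_ae_eq (proj1 (L2P _) g2) (soliton_grad_sqint ar)
  (H1_primitive cs g2 wg) (soliton_primitive ar).
have -> : \int[mu]_x (wderiv (soliton a) x * derive1 phi x) =
    \int[mu]_x (W x * (sgn x * derive1 phi x)).
  have mphi : measurable_fun setT (derive1 phi) by apply: continuous_measurable => //; have [] := cp.
  apply: eq_Rint_ae => //.
  - by apply: measurable_funM => //; have [] := proj1 (L2P _) g2.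
  - apply: measurable_funM; first exact: continuous_measurable.
    by apply: measurable_funM => //; exact: sgn_measurable.
  - by apply: ae_imp ae => x -> _; rewrite /W; ring.
have [L L0 HL] := C1c_bounded cp; have cphi := C1c_continuous cp.
have supp0 f : \int[mu]_x (f x * phi x) = \int[mu]_(x in `[- L, L]) (f x * phi x).
  apply: Rint_supp => x /= xL; have [|-> _] := HL x; rewrite ?mulr0//.
  by rewrite leNgt; apply/negP => h; apply: xL; rewrite in_itv/= -ler_norml ltW.
have : \int[mu]_x (sgn x * rho x * (sgn x * phi x)) = \int[mu]_x (rho x * phi x).
  apply: eq_Rintegral => x _; have := sgn2 x; rewrite expr2.
  by rewrite mulrACA => ->; rewrite mul1r.
move: wW => -> -> /=; rewrite !supp0.
rewrite -RintegralZl//; last by apply: continuous_itg; exact: continuous_mulf.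
rewrite opprK -[RHS]opprK -RintegralB//; [|by apply: continuous_itg; exact: continuous_mulf..].
rewrite opprK; apply: eq_Rintegral => x _; rewrite /rho; ring.
Qed.

Lemma Mass_ge0 a : 0 <= Mass a.
Proof.
rewrite /Mass mulr_ge0 ?mulr_ge0 ?powR_ge0//.
by apply: Rintegral_ge0 => x _; exact: sqr_ge0.
Qed.

Hypothesis hq4 : q < 4.

(** The rate decreases in a, so [pmass] of the rate does not decrease; the factor a^(4 - q) is
    strictly increasing because q < 4. *)
Lemma Mass_incr a b : 0 < a -> a < b -> in_range b -> Mass a < Mass b.
Proof.
move=> a0 ab br; have [b0 bm _] := br.
have h1 : pmass gam (rate a) <= pmass gam (rate b).
  by apply: pmass_mono => //; [exact: in_range_admissible|apply: rate_decr => //; exact: ltW|exact: rate_le1].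
have ara : in_range a by split; [exact: a0|exact: le_trans (ltW ab) bm|left; exact: lt_le_trans ab bm].
have h2 : 0 < pmass gam (rate a) by apply: pmass_gt0 => //; exact: in_range_admissible.
have h3 : a `^ (4 - q) < b `^ (4 - q).
  by apply: gt0_ltr_powR => //; rewrite ?subr_gt0// nnegrE ltW.
have h4 : 0 < a `^ (4 - q) by exact: powR_gt0.
rewrite /Mass; move: (pmass _ _) (pmass _ _) h1 h2 => P Q h1 h2.
rewrite -!mulrA ltr_pM2l//; apply: (@lt_le_trans _ _ (b `^ (4 - q) * Q)).
  by rewrite ltr_pM2r.
by rewrite ler_pM2l// powR_gt0.
Qed.

Let powR_cont (r a : R) : 0 < a -> {for a, continuous (fun t => t `^ r)}.
Proof. by move=> a0; apply: is_derive_cont; exact: is_derive1_powR. Qed.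

Lemma rate_continuous a : 0 < a -> {for a, continuous rate}.
Proof.
move=> a0; apply: (@continuous_at_compf _ Num.sqrt (fun t => 1 - kratio p q t)).
  exact: sqrt_continuous.
apply: continuousB; first exact: cst_continuous.
apply: continuousM; first exact: cst_continuous.
exact: powR_cont.
Qed.

(** [pmass_dist] compares with the fixed value at a, leaving only the continuity of the positive
    rate. *)
Lemma Mass_continuous a : 0 < a -> a < amp_max -> {for a, continuous Mass}.
Proof.
move=> a0 am; apply: continuousM.
  by apply: continuousM; [exact: cst_continuous|exact: powR_cont].
have ra0 := rate_gt0 a0 am; have ra1 := rate_le1 a0.
pose P := pmass gam (rate a).
have ce : {for a, continuous (fun t => `|1 - rate a / rate t| * P)}.
  apply: continuousM; last exact: cst_continuous.
  apply: (@continuous_at_compf _ (fun z : R => `|z|) (fun t => 1 - rate a / rate t)).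
    exact: norm_continuous.
  apply: continuousB; first exact: cst_continuous.
  apply: continuousM; first exact: cst_continuous.
  by apply: continuousV; [rewrite gt_eqF|exact: rate_continuous].
apply/cvgrPdist_lt => e e0; have /cvgrPdist_lt /(_ _ e0) := ce.
rewrite divff ?gt_eqF// subrr normr0 mul0r => ne; near=> t.
have t0 : 0 < t by near: t; exact: lt_nbhsr.
have tm : t < amp_max by near: t; exact: lt_nbhsl.
rewrite /= distrC; apply: le_lt_trans.
  by apply: pmass_dist => //; [exact: rate_gt0|exact: rate_le1].
have : `|0 - `|1 - rate a / rate t| * P| < e by near: t; exact: ne.
by rewrite sub0r normrN; apply: le_lt_trans; exact: ler_norm.
Unshelve. all: by end_near. Qed.

(** Near [amp_max] the rate tends to 0, outside the reach of [pmass_dist]. The mass is bounded below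
    by G, built from a truncated mass and continuous up to [amp_max]; L is chosen so that G exceeds
    m there, for finite and infinite limit mass alike. *)
Lemma Mass_large m : 0 < m -> (p < 6 -> m < Mass amp_max) ->
  exists b, [/\ 0 < b, b < amp_max & m < Mass b].
Proof.
move=> m0 hm; have A0 := amp_max_gt0 q hp.
have c0 : 0 < 2 * amp_max `^ (4 - q) by rewrite mulr_gt0// powR_gt0.
have [L L0 hL] : exists2 L, 0 <= L & m < 2 * amp_max `^ (4 - q) * pmass_trunc gam L.
  have [p6|p6] := ltP p 6.
    have g2 : gam < 2 by lra.
    have := hm p6; rewrite /Mass rate_max -ltr_pdivrMl// => h.
    have e0 : 0 < (pmass gam 0 - (2 * amp_max `^ (4 - q))^-1 * m) / 2 by lra.
    have [L L0 hL] := pmass_trunc_cvg gam0 g2 e0.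
    by exists L => //; rewrite -ltr_pdivrMl//; lra.
  have g2 : 2 <= gam by lra.
  have [L L0 hL] := pmass_trunc_unbounded gam0 g2 ((2 * amp_max `^ (4 - q))^-1 * m + 1).
  by exists L => //; rewrite -ltr_pdivrMl//; lra.
pose G t := 2 * t `^ (4 - q) * ((1 - 2 * (rate t * L)) * pmass_trunc gam L).
have cG : {for amp_max, continuous G}.
  apply: continuousM.
    by apply: continuousM; [exact: cst_continuous|exact: powR_cont].
  apply: continuousM; last exact: cst_continuous.
  apply: continuousB; first exact: cst_continuous.
  apply: continuousM; first exact: cst_continuous.
  by apply: continuousM; [exact: rate_continuous|exact: cst_continuous].
have GA : G amp_max = 2 * amp_max `^ (4 - q) * pmass_trunc gam L.
  by rewrite /G rate_max mul0r mulr0 subr0 mul1r.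
have e0 : 0 < G amp_max - m by rewrite GA subr_gt0.
have /cvgrPdist_lt /(_ _ e0) nG := cG.
have [d /= d0 hd] := nG.
pose b := Num.max (amp_max / 2) (amp_max - d / 2).
have bA : b < amp_max by rewrite gt_max; apply/andP; split; lra.
have b1 : amp_max / 2 <= b by rewrite le_max lexx.
have b2 : amp_max - d / 2 <= b by rewrite le_max lexx orbT.
have b0 : 0 < b by lra.
exists b; split; [exact: b0|exact: bA|].
have : `|G amp_max - G b| < G amp_max - m.
  by apply: hd; rewrite /ball/= gtr0_norm ?subr_gt0//; lra.
move=> /(le_lt_trans (ler_norm _)) h; have {h} : m < G b by lra.
move=> /lt_le_trans; apply; rewrite /G /Mass; apply: ler_wpM2l.
  by rewrite mulr_ge0// powR_ge0.
by apply: pmass_ge_trunc => //; [exact: rate_gt0|exact: rate_le1].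
Qed.

Lemma Mass_small m b : 0 < m -> in_range b ->
  exists a, [/\ 0 < a, a <= b & Mass a < m].
Proof.
have half (z : R) : 0 < z -> z / 2 < z by lra.
move=> m0 br; have [b0 bA _] := br.
have P0 : 0 < pmass gam (rate b) by apply: pmass_gt0 => //; exact: in_range_admissible.
have h4 : 0 < 4 - q by have := hq4; lra.
(* With a^(4 - q) <= x the bound 2 a^(4 - q) [pmass (rate b)] on the mass is at most m / 2. *)
pose x := m / (4 * pmass gam (rate b)).
have x0 : 0 < x by rewrite divr_gt0// mulr_gt0.
pose a := Num.min b (x `^ (4 - q)^-1).
have a0 : 0 < a by rewrite lt_min b0 powR_gt0.
have ab : a <= b by rewrite ge_min lexx.
exists a; split; [exact: a0|exact: ab|].
have ax : a `^ (4 - q) <= x.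
  rewrite -[leRHS](powR_root (ltW x0) h4).
  apply: ge0_ler_powR; rewrite ?nnegrE ?powR_ge0 ?(ltW a0) ?(ltW h4)//.
  by rewrite ge_min lexx orbT.
have Pa : pmass gam (rate a) <= pmass gam (rate b).
  by apply: pmass_mono => //; [exact: in_range_admissible|exact: rate_decr|exact: rate_le1].
have : Mass a <= 2 * x * pmass gam (rate b).
  have a4 : 0 <= a `^ (4 - q) by exact: powR_ge0.
  rewrite /Mass; apply: (@le_trans _ _ (2 * a `^ (4 - q) * pmass gam (rate b))).
    by apply: ler_wpM2l; [exact: mulr_ge0|exact: Pa].
  by apply: ler_wpM2r; [exact: (ltW P0)|apply: ler_wpM2l; [exact: ler0n|exact: ax]].
move=> /le_lt_trans; apply; rewrite /x.
move: (pmass _ _) P0 => Q Q0.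
have -> : 2 * (m / (4 * Q)) * Q = m / 2 by field; rewrite gt_eqF.
exact: half.
Qed.

#[local] Opaque Mass pmass.

Lemma Mass_surj m : 0 < m -> (p < 6 -> m < Mass amp_max) ->
  exists a, [/\ 0 < a, a < amp_max & Mass a = m].
Proof.
have mid (x y z : R) : x < z -> z < y -> Num.min x y <= z <= Num.max x y.
  by move=> xz zy; rewrite ge_min le_max (ltW xz) (ltW zy) orbT.
move=> m0 hm; have [b [b0 bA mb]] := Mass_large m0 hm.
have br : in_range b by split; [exact: b0|exact: ltW|left].
have [a [a0 ab ma]] := Mass_small m0 br.
have [||c] := @IVT R Mass a b m ab.
- apply: continuous_in_subspaceT => x /set_mem /=; rewrite in_itv/= => /andP[ax xb].
  apply: Mass_continuous; [exact: lt_le_trans ax|exact: le_lt_trans xb bA].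
- exact: mid.
rewrite in_itv/= => /andP[ac cb] <-; exists c; split; [exact: lt_le_trans ac|exact: le_lt_trans cb bA|by []].
Qed.

End Solitons.

(** * Lower bound for the energy, existence and uniqueness of ground states up to the threshold *)

Section Energy.
Context {R : realType} (p q : R).
Notation mu := (@lebesgue_measure R).
Implicit Types (a b x y l m : R) (u v g : R -> R).
Hypotheses (hp : 2 < p) (hq2 : 2 < q) (hqp : q < p / 2 + 1).
Notation lam := (lam p q).
Notation amp_max := (amp_max p q).
Notation amp_peak := (amp_peak p q).
Notation soliton := (soliton p q).
Notation Mass := (Mass p q).
Notation powp_itg := (powp_itg p).

Let p0 : 0 < p. Proof. by have := hp; lra. Qed.

Lemma H1_sqint v : H1 v -> sqint v. Proof. by move=> [_ /L2P]. Qed.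

Lemma H1_continuous v : H1 v -> continuous v. Proof. by case. Qed.

Lemma wderiv_sqint v : H1 v -> sqint (wderiv v).
Proof. by move=> /H1_wderiv[/L2P]. Qed.

Lemma wderiv_primitive v : H1 v -> forall a b, primitive_on a b v (wderiv v).
Proof. by move=> hv; have [h1 h2] := H1_wderiv hv; apply: H1_primitive => //; exact: H1_continuous. Qed.

Lemma wderiv_ae v g : H1 v -> sqint g -> (forall a b, primitive_on a b v g) ->
  {ae mu, forall x, wderiv v x = g x}.
Proof.
by move=> hv sg vg; apply: (primitive_on_ae_eq (wderiv_sqint hv) sg (wderiv_primitive hv) vg).
Qed.

Lemma norm2E g : sqint g -> (Lpnorm 2 g `^ 2 = (\int[mu]_x (g x ^+ 2))%:E)%E.
Proof. by move=> sg; apply/(mass_sq _ sg). Qed.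

Definition renergy v :=
  2^-1 * \int[mu]_x (wderiv v x ^+ 2) + p^-1 * \int[mu]_x (`|v x| `^ p) - q^-1 * `|v 0| `^ q.

Lemma energyE v : H1 v -> powp_itg v -> energy p q v = (renergy v)%:E.
Proof.
move=> hv ip; rewrite /energy norm2E; last exact: wderiv_sqint.
by rewrite Lpnorm_powE ?gt_eqF// itg_EFin.
Qed.

(** Disposes of competitors outside L^p: the power term is infinite while the other two are
    finite. *)
Lemma energy_oo v : H1 v -> ~ powp_itg v -> energy p q v = +oo%E.
Proof.
move=> hv ip; rewrite /energy norm2E; last exact: wderiv_sqint.
rewrite Lpnorm_powE ?gt_eqF//.
have -> : (\int[mu]_x (`|v x| `^ p)%:E = +oo)%E.
  apply/eqP; rewrite -leye_eq leNgt; apply/negP => h; apply: ip.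
  apply/integrableP; split; first by apply/measurable_EFinP; apply: (powp_measurable hp); exact: H1_continuous.
  move: h; congr (_ < _)%E; apply: eq_integral => x _ /=.
  by rewrite (ger0_norm (powR_ge0 _ _)).
by rewrite gt0_muley ?lte_fin ?invr_gt0// addey.
Qed.

Definition excess l v := \int[mu]_x ((wderiv v x + sgn x * slope p l (v x)) ^+ 2).

Lemma excess_ge0 l v : 0 <= excess l v.
Proof. by apply: Rintegral_ge0 => x _; exact: sqr_ge0. Qed.

(** In [calibration] the integral of S_l(v)^2 is l times the mass plus 2/p times the power integral,
    which is how the potential energy and the multiplier term appear together. *)
Lemma renergy_excess l v : 0 <= l -> H1 v -> powp_itg v ->
  renergy v = action p q l (v 0) - l * \int[mu]_x (v x ^+ 2) / 2 + excess l v / 2.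
Proof.
move=> l0 hv ip; have cv := H1_continuous hv; have sv := H1_sqint hv.
have ss := slope_sqint hp l0 cv sv ip.
have := calibration cv (@slope_continuous _ p hp l) (slopeI_derive hp l) (primitive0_0 _)
  sv (wderiv_sqint hv) ss (wderiv_primitive hv).
rewrite -/(excess l v).
have -> : \int[mu]_x (slope p l (v x) ^+ 2) =
    l * \int[mu]_x (v x ^+ 2) + 2 / p * \int[mu]_x (`|v x| `^ p).
  have [_ iv] := sv; rewrite -!RintegralZl// -RintegralD//; [|exact: itgZ..].
  by apply: eq_Rintegral => x _; exact: slope_sq.
move=> ->; rewrite /renergy /action /slopeI.
move: (\int[mu]_x _) (\int[mu]_x _) (\int[mu]_x _) (primitive0 _ _) (_ `^ _) => I1 I2 I3 P Q.
field; rewrite !gt_eqF//; have := hq2; lra.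
Qed.

Lemma soliton_excess a : in_range p q a -> excess (lam a) (soliton a) = 0.
Proof.
move=> ar; have hs := soliton_H1 hp hq2 hqp ar.
have ae := wderiv_ae hs (soliton_grad_sqint hp hq2 hqp ar) (soliton_primitive hp hqp ar).
have sl := sqint_sgn (soliton_slope_sqint hp hq2 hqp ar).
have [md _] := sqintD (wderiv_sqint hs) sl.
have -> : (0 : R) = \int[mu]_(x in setT) (0 : R) by rewrite Rintegral_cst// mul0r.
apply: eq_Rint_ae => //; first exact: measurable_funX.
by apply: ae_imp ae => x -> _; rewrite mulrN addNr expr0n.
Qed.

Lemma soliton_mass a : in_range p q a -> H1mass (Mass a) (soliton a).
Proof.
move=> ar; have hs := soliton_H1 hp hq2 hqp ar; split => //.
by apply/(mass_sq _ (H1_sqint hs)); have [] := soliton_sq_itg hp hqp ar.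
Qed.

Lemma soliton_renergy a l : in_range p q a -> 0 <= l ->
  renergy (soliton a) = action p q l a - l * Mass a / 2 + excess l (soliton a) / 2.
Proof.
move=> ar l0; rewrite (renergy_excess l0 (soliton_H1 hp hq2 hqp ar) (soliton_powp_itg hp hqp ar)).
by rewrite soliton0//; have [_ ->] := soliton_sq_itg hp hqp ar.
Qed.

Lemma soliton_energy a : in_range p q a ->
  energy p q (soliton a) = (level p q a (Mass a))%:E.
Proof.
move=> ar; have [a0 am _] := ar; have l0 := lam_ge0 hp hq2 hqp (ltW a0) am.
rewrite (energyE (soliton_H1 hp hq2 hqp ar) (soliton_powp_itg hp hqp ar)).
by rewrite (soliton_renergy ar l0) soliton_excess// mul0r addr0.
Qed.

(** The energy of the soliton is written at the two frequencies [l] and [lam a]; the excess vanishes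
    for the second and is nonnegative for the first. *)
Lemma soliton_tangent a l : in_range p q a -> 0 <= l ->
  action p q l a <= crit p q a + (l - lam a) * Mass a / 2.
Proof.
move=> ar l0; have [a0 am _] := ar; have l0' := lam_ge0 hp hq2 hqp (ltW a0) am.
have := excess_ge0 l (soliton a).
have := soliton_renergy ar l0; rewrite (soliton_renergy ar l0') soliton_excess// mul0r addr0.
rewrite -/(crit p q a).
move: (Mass a) (excess _ _) (action _ _ _ _) (crit _ _ _) (lam a) => M e A c la; lra.
Qed.

Lemma H1mass_int m v : H1mass m v -> \int[mu]_x (v x ^+ 2) = m.
Proof. by move=> [hv /(mass_sq _ (H1_sqint hv))]. Qed.

Lemma slope_mono l x y : 0 <= l -> x <= y -> slope p l x <= slope p l y.
Proof.
move=> l0; have mono s t : 0 <= s -> s <= t -> slope p l s <= slope p l t.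
  move=> s0 st; have t0 := le_trans s0 st.
  apply: ler_pM; rewrite ?sqrtr_ge0//; apply: ler_wsqrtr.
  rewrite /radicand lerD2l; apply: ler_wpM2l; first by rewrite divr_ge0// ltW.
  by apply: ge0_ler_powR; rewrite ?nnegrE// ?ger0_norm//; have := hp; lra.
move=> xy; have [x0|x0] := leP 0 x; first exact: mono.
have [y0|y0] := leP 0 y.
  apply: (@le_trans _ _ 0); first by rewrite /slope mulr_le0_ge0 ?sqrtr_ge0// ltW.
  by rewrite /slope mulr_ge0 ?sqrtr_ge0.
rewrite -[x]opprK -[y]opprK !(slope_odd _ _ (- _)) lerN2; apply: mono; lra.
Qed.

Definition decay l u :=
  (forall x, 0 < x -> is_derive x 1 u (- slope p l (u x))) /\
  (forall x, x < 0 -> is_derive x 1 u (slope p l (u x))).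

(* Monotonicity of the slope makes the flow a contraction away from the origin. *)
Lemma decay_unique l u v : 0 <= l -> continuous u -> continuous v ->
  decay l u -> decay l v -> u 0 = v 0 -> u = v.
Proof.
move=> l0 cu cv [du1 du2] [dv1 dv2] uv; apply/funext => x.
have mono s t : 0 <= (s - t) * (slope p l s - slope p l t).
  have [st|ts] := leP s t.
    by rewrite mulr_le0// subr_le0//; exact: slope_mono.
  by rewrite mulr_ge0// subr_ge0; [|apply: slope_mono]; rewrite // ltW.
have cd : continuous (fun x => u x - v x) by exact: continuous_subf.
have cf : continuous (fun x => (u x - v x) ^+ 2).
  exact: (continuous_mulf cd cd).
suff : (u x - v x) ^+ 2 <= 0.
  move=> h; have : (u x - v x) ^+ 2 == 0 by rewrite eq_le h sqr_ge0.
  by rewrite sqrf_eq0 subr_eq0 => /eqP.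
have e0 : (u 0 - v 0) ^+ 2 = 0 by rewrite uv subrr expr0n.
have [x0|/ltW x0] := leP 0 x.
  rewrite -[leLHS]opprK oppr_le0 -[leLHS]oppr0 -e0.
  apply: (derive_ge0_le x0 _ (fun t t0 _ =>
    is_derive_oppf (is_derive_sqrf (is_derive_subf (du1 t t0) (dv1 t t0))))).
  - exact: continuous_subspaceT (continuous_oppf cf).
  - by move=> t _ _; have := mono (u t) (v t); lra.
rewrite -e0; apply: (derive_ge0_le x0 _ (fun t _ t0 =>
  is_derive_sqrf (is_derive_subf (du2 t t0) (dv2 t t0)))).
- exact: continuous_subspaceT cf.
- by move=> t _ _; have := mono (u t) (v t); lra.
Qed.

Lemma decay_opp l u : decay l u -> decay l (fun x => - u x).
Proof.
move=> [d1 d2]; split=> x x0; rewrite slope_odd.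
  exact: is_derive_oppf (d1 x x0).
exact: is_derive_oppf (d2 x x0).
Qed.

Lemma decay_soliton a u : 0 < a -> a <= amp_max -> continuous u ->
  decay (lam a) u -> `|u 0| = a -> u = soliton a \/ u = - soliton a.
Proof.
move=> a0 am cu du ua; have l0 := lam_ge0 hp hq2 hqp (ltW a0) am.
have ds : decay (lam a) (soliton a).
  by split=> x x0; [exact: soliton_derive|exact: soliton_derive_neg].
have cs : continuous (soliton a) by exact: soliton_continuous.
have [u0|u0] := leP 0 (u 0).
  left; apply: (decay_unique l0 cu cs du ds).
  by rewrite soliton0// -ua ger0_norm.
right; have := decay_unique l0 (continuous_oppf cu) cs (decay_opp du) ds.
rewrite soliton0// -ua ltr0_norm// => /(_ erefl) <-.
by apply/funext => x; rewrite /= fctE opprK.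
Qed.

Lemma primitive_derive_right u w : continuous w ->
  (forall x y, 0 <= x -> x <= y -> u y - u x = \int[mu]_(t in `[x, y]) w t) ->
  forall x, 0 < x -> is_derive x 1 u (w x).
Proof.
move=> cw uw x x0; apply: (@is_derive_nearf _ (fun y => u 0 + primitive0 w y)).
  near=> y; have y0 : 0 <= y by apply: ltW; near: y; exact: lt_nbhsr.
  rewrite /primitive0 -(uw 0 y)// (_ : \int[mu]_(t in `[y, 0]) w t = 0) ?subr0 ?subrKC//.
  have [->|ne] := eqVneq y 0; first exact: Rint_point.
  by rewrite set_itv_ge ?Rintegral_set0// bnd_simp -ltNge lt_neqAle eq_sym ne.
have := is_derive_addf (is_derive_cstf (u 0) x) (primitive0_derive x cw).
by rewrite add0r.
Unshelve. all: by end_near. Qed.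

Lemma primitive_derive_left u w : continuous w ->
  (forall x y, y <= 0 -> x <= y -> u y - u x = \int[mu]_(t in `[x, y]) w t) ->
  forall x, x < 0 -> is_derive x 1 u (w x).
Proof.
move=> cw uw x x0; apply: (@is_derive_nearf _ (fun y => u 0 + primitive0 w y)).
  near=> y; have y0 : y <= 0 by apply: ltW; near: y; exact: lt_nbhsl.
  rewrite /primitive0 -(uw y 0)// (_ : \int[mu]_(t in `[0, y]) w t = 0); first by ring.
  have [->|ne] := eqVneq y 0; first exact: Rint_point.
  by rewrite set_itv_ge ?Rintegral_set0// bnd_simp -ltNge lt_neqAle ne.
have := is_derive_addf (is_derive_cstf (u 0) x) (primitive0_derive x cw).
by rewrite add0r.
Unshelve. all: by end_near. Qed.

Lemma zero_of_sq_integral g : sqint g -> \int[mu]_x (g x ^+ 2) = 0 ->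
  {ae mu, forall x, g x = 0}.
Proof.
move=> [mg ig] g0.
have : (\int[mu]_x `|(g x ^+ 2)%:E| = 0)%E.
  rewrite -[RHS]/((0:R)%:E) -g0 -itg_EFin//; apply: eq_integral => x _.
  by rewrite gee0_abs// lee_fin sqr_ge0.
have mg2 : measurable_fun setT (fun x => (g x ^+ 2)%:E).
  by apply/measurable_EFinP; exact: measurable_funX.
move/(ae_eq_integral_abs mu measurableT mg2) => [N [mN N0 hN]].
exists N; split => // x /= gx; apply: hN => /= h; apply: gx.
by have [/eqP] := h I; rewrite sqrf_eq0 => /eqP.
Qed.

(** The square vanishes almost everywhere, so v is a primitive of -sgn S(v); this is continuous on
    each open half-line, which makes v differentiable there. *)
Lemma excess0_decay l v : 0 <= l -> H1 v -> powp_itg v -> excess l v = 0 -> decay l v.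
Proof.
move=> l0 hv ip e0; have cv := H1_continuous hv; have sv := H1_sqint hv.
have ss := sqint_sgn (slope_sqint hp l0 cv sv ip).
have ae := zero_of_sq_integral (sqintD (wderiv_sqint hv) ss) e0.
have cS : continuous (fun x => slope p l (v x)).
  by apply: continuous_compf => //; exact: slope_continuous.
have int x y : x <= y ->
    v y - v x = \int[mu]_(t in `[x, y]) (- (sgn t * slope p l (v t))).
  move=> xy; have [_ /(_ x y (lexx _) xy (lexx _)) ->] := wderiv_primitive hv x y.
  apply: eq_Rint_ae => //.
  - by apply: measurable_funTS; have [] := wderiv_sqint hv.
  - by apply: measurable_funTS; apply: measurable_funN; have [] := ss.
  - by apply: ae_imp ae => t /eqP; rewrite addr_eq0 => /eqP -> _.
split.
  apply: primitive_derive_right; first exact: continuous_oppf.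
  move=> x y x0 xy; rewrite int//; apply: eq_Rintegral => t; rewrite inE/= in_itv/=.
  by move=> /andP[xt _]; rewrite sgn_pos ?mul1r// (le_trans x0).
apply: primitive_derive_left => //.
move=> x y y0 xy; rewrite int//; apply: eq_Rint_oo.
- have := itg_itvS (lexx x) (lexx y) (sqint_itv x y (sqintZ (-1) ss)).
  by congr (_.-integrable _ (EFin \o _)); apply/funext => t; rewrite mulN1r.
- exact: continuous_itg.
- move=> t; rewrite in_itv/= => /andP[_ ty].
  by rewrite sgn_neg ?mulN1r ?opprK//; exact: lt_le_trans ty y0.
Qed.

Hypothesis hq4 : q < 4.

Lemma in_range_peak a : 0 < a -> a <= amp_peak -> in_range p q a.
Proof.
move=> a0 ap; have pm := le_lt_trans ap (amp_peak_lt hp hq2 hqp).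
by split; [exact: a0|exact: ltW|left].
Qed.

Let M_incr a b : 0 < a -> a < b -> b <= amp_peak -> Mass a < Mass b.
Proof.
move=> a0 ab bp; apply: Mass_incr => //; apply: in_range_peak => //.
exact: lt_trans ab.
Qed.

Let M_tangent a l : 0 < a -> a <= amp_peak -> 0 <= l ->
  action p q l a <= crit p q a + (l - lam a) * Mass a / 2.
Proof. by move=> a0 ap; apply: soliton_tangent; exact: in_range_peak. Qed.

Lemma optimal_Mass a : in_range p q a -> optimal p q Mass a (Mass a).
Proof.
move=> ar; have [a0 am _] := ar; split; [exact: a0|exact: am| |by []|].
  by move=> l l0; exact: soliton_tangent.
move=> pa; apply: ltW; apply: Mass_incr; [exact: hp|exact: hqp|exact: hq4| |exact: pa|exact: ar].
exact: amp_peak_gt0.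
Qed.

Lemma in_range_max : p < 6 -> in_range p q amp_max.
Proof. by move=> p6; split; [exact: amp_max_gt0|exact: lexx|right]. Qed.

(** Since [lam amp_max = 0], increasing m above the mass of the soliton only weakens the tangent
    inequality when l >= 0. *)
Lemma optimal_max m : p < 6 -> Mass amp_max <= m -> optimal p q Mass amp_max m.
Proof.
move=> p6 Mm; have ar := in_range_max p6; have [a0 _ _] := ar.
have pm := amp_peak_lt hp hq2 hqp.
split; [exact: a0|exact: lexx| | |].
- move=> l l0; have := soliton_tangent ar l0; rewrite lam_max// subr0.
  move=> /le_trans; apply; rewrite lerD2l.
  by apply: ler_wpM2r; [rewrite invr_ge0|apply: ler_wpM2l].
- by rewrite leNgt pm.
- move=> _; apply: le_trans Mm; apply: ltW.
  apply: Mass_incr; [exact: hp|exact: hqp|exact: hq4| |exact: pm|exact: ar].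
  exact: amp_peak_gt0.
Qed.

Section Minimality.
Variables (a m : R).
Hypothesis am : optimal p q Mass a m.

Lemma optimal_lower v : H1mass m v -> ((level p q a m)%:E <= energy p q v)%E /\
  (energy p q v = (level p q a m)%:E -> v = soliton a \/ v = - soliton a).
Proof.
move=> vm; have [hv _] := vm; have vm' := H1mass_int vm.
have [a0 aM _ _ _] := am; have l0 := lam_ge0 hp hq2 hqp (ltW a0) aM.
have [ip|nip] := pselect (powp_itg v); last by rewrite (energy_oo hv nip) leey; split.
rewrite (energyE hv ip) lee_fin.
(* At amplitude a the frequency [lam a] is exact and equality means zero excess; at any other
   amplitude [optimal_min] gives a strict inequality. *)
have [va|va] := eqVneq `|v 0| a.
  have E := renergy_excess l0 hv ip.
  rewrite vm' -(@action_norm R p q hp (lam a) (v 0)) va -/(crit p q a) -/(level p q a m) in E.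
  have D := excess_ge0 (lam a) v.
  rewrite E; split; first by rewrite lerDl divr_ge0.
  move=> [D0]; apply: decay_soliton => //; first exact: H1_continuous.
  apply: excess0_decay => //.
  move: D0 D; move: (excess _ _) (level _ _ _ _) => e L; lra.
have [l l1 hl] := optimal_min hp hq2 hqp M_incr (Mass_ge0 p q) M_tangent am (normr_ge0 (v 0)) va.
have E := renergy_excess l1 hv ip; rewrite vm' -(@action_norm R p q hp l (v 0)) in E.
have D := excess_ge0 l v.
have : level p q a m < renergy v.
  rewrite E; apply: (lt_le_trans hl); rewrite lerDl divr_ge0//.
move=> h; split; first exact: ltW.
by move=> [h']; move: h; rewrite h' ltxx.
Qed.

Lemma ground_energy_ge : ((level p q a m)%:E <= ground_energy p q m)%E.
Proof.
apply: le_ereal_inf_tmp => _ [v vm <-].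
by have [] := optimal_lower vm.
Qed.

End Minimality.

Lemma ground_energy_Mass a : in_range p q a ->
  ground_energy p q (Mass a) = (level p q a (Mass a))%:E.
Proof.
move=> ar; apply/eqP; rewrite eq_le (ground_energy_ge (optimal_Mass ar)) andbT.
rewrite -(soliton_energy ar); apply: ereal_inf_lbound; exists (soliton a) => //.
exact: soliton_mass.
Qed.

Lemma soliton_ground_state a : in_range p q a -> ground_state p q (Mass a) (soliton a).
Proof.
move=> ar; split; first exact: soliton_mass.
by rewrite soliton_energy// ground_energy_Mass.
Qed.

Lemma ground_state_soliton a u : in_range p q a -> ground_state p q (Mass a) u ->
  u = soliton a \/ u = - soliton a.
Proof.
move=> ar [um uE]; have [_] := optimal_lower (optimal_Mass ar) um.
by apply; rewrite uE ground_energy_Mass.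
Qed.

Lemma ground_states_unique a : in_range p q a -> ground_state_unique p q (Mass a).
Proof.
move=> ar u v /(ground_state_soliton ar)[->|->] /(ground_state_soliton ar)[->|->];
  rewrite ?opprK; by [left|right].
Qed.

End Energy.

(** * Masses above the threshold: trial functions carrying the excess mass *)

Section Trial.
Context {R : realType} (p q : R).
Notation mu := (@lebesgue_measure R).
Implicit Types (a b c d x y l m : R) (u v g : R -> R).
Hypotheses (hp : 2 < p) (hq2 : 2 < q) (hqp : q < p / 2 + 1) (hq4 : q < 4).
Notation gam := ((p - 2) / 2).
Notation lam := (lam p q).
Notation amp_max := (amp_max p q).
Notation soliton := (soliton p q).
Notation Mass := (Mass p q).
Notation P1 := (pmass gam 1).

Let gam0 : 0 < gam. Proof. by have := hp; lra. Qed.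
Let p0 : 0 < p. Proof. by have := hp; lra. Qed.
Let adm1 : admissible gam 1. Proof. by split; [exact: ler01|exact: lexx|left; exact: ltr01]. Qed.

(** This is exp(-c|x|), since [hyp 1 y] is exp(gam y); as a profile it comes with its integrability
    and mass. *)
Definition wide c x := eprof gam 1 (c * x).

Lemma wide_continuous c : continuous (wide c).
Proof.
apply: (continuous_compf (f := eprof gam 1)); first exact: eprof_continuous.
by apply: continuous_mulf; [exact: continuous_cstf|exact: continuous_idf].
Qed.

Lemma wide_gt0 c x : 0 < wide c x. Proof. exact: eprof_gt0. Qed.

Lemma wide_le1 c x : wide c x <= 1. Proof. exact: prof_le1. Qed.

Lemma wide_derive c x : 0 < c -> 0 < x -> is_derive x 1 (wide c) (- (c * wide c x)).
Proof.
move=> c0 x0; have cx : 0 < c * x by exact: mulr_gt0.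
apply: (@is_derive_nearf _ (fun t => prof gam 1 (c * t))).
  near=> t; rewrite /wide /eprof gtr0_norm// mulr_gt0//.
  by near: t; exact: lt_nbhsr.
have d := prof_ode gam0 (@ler01 R) (lexx _) (ltW cx).
have := @is_derive_compf _ (prof gam 1) (fun t => c * t) x _ _ d
  (is_derive_scalef c (is_derive_idf x)).
move/trigger_derive; apply; rewrite /wide /eprof (gtr0_norm cx).
by rewrite expr1n subrr mul0r addr0 sqrtr1; ring.
Unshelve. all: by end_near. Qed.

Lemma wide_derive_neg c x : 0 < c -> x < 0 -> is_derive x 1 (wide c) (c * wide c x).
Proof.
move=> c0 x0; have x0' : 0 < - x by rewrite oppr_gt0.
have ev t : wide c (- t) = wide c t by rewrite /wide mulrN eprof_even.
have := @is_derive_compf _ (wide c) (fun t => - t) x _ _ (wide_derive c0 x0')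
  (is_derive_oppf (is_derive_idf x)).
have -> : (fun t => wide c (- t)) = wide c by apply/funext => t; exact: ev.
by move/trigger_derive; apply; rewrite ev mulrNN mulr1.
Qed.

Lemma wide_sqint c : 0 < c -> sqint (wide c) /\ \int[mu]_x (wide c x ^+ 2) = P1 / c.
Proof.
move=> c0; have [i1 e1] := Rint_scale c0 (eprof_sq_continuous gam0 (@ler01 R))
  (fun x => sqr_ge0 _) (eprof_sq_itg gam0 adm1).
split; last exact: e1.
split; last exact: i1.
by apply: continuous_measurable => //; exact: wide_continuous.
Qed.

(** S_0 is a multiple of t^(p/2), with S_0'^2 = (p/2) t^(p-2); the mean value theorem and
    monotonicity of the power conclude. *)
Lemma slope0_increment x y : 0 < x -> 0 <= y ->
  (slope p 0 (x + y) - slope p 0 x) ^+ 2 <= p / 2 * ((x + y) `^ (p - 2) * y ^+ 2).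
Proof.
move=> x0; rewrite le_eqVlt => /orP[/eqP<-|y0].
  by rewrite addr0 subrr expr0n/= mulr0 mulr0.
have xy : x < x + y by rewrite ltrDl.
(* [slope_pos_derive] gives a derivative point by point; choice makes it a function for the mean
   value theorem. *)
have [df dfE] : exists df : R -> R, forall t : R, 0 < t ->
    is_derive t 1 (slope p 0) (df t) /\ df t ^+ 2 = p / 2 * t `^ (p - 2).
  have H (t : R) : exists d : R, 0 < t -> is_derive t 1 (slope p 0) d /\ d ^+ 2 = p / 2 * t `^ (p - 2).
    have [t0|t0] := ltP 0 t; last by exists 0.
    have [d dd dE] := slope_pos_derive hp (lexx 0) t0.
    exists d => _; split => //; move: dE; rewrite mul0r add0r gtr0_norm// => dE.
    have : (slope p 0 t * d) ^+ 2 = (t `^ (p - 2) * t) ^+ 2 by rewrite dE.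
    rewrite exprMn slope_sq// exprMn mul0r add0r (gtr0_norm t0).
    rewrite -[t in t `^ p](gtr0_norm t0) norm_powR_sq ?gt_eqF// (gtr0_norm t0).
    have T0 : 0 < t `^ (p - 2) by exact: powR_gt0.
    move: (t `^ (p - 2)) T0 => T T0 E.
    apply: (@mulfI _ (2 / p * (T * t ^+ 2))).
      by rewrite gt_eqF// mulr_gt0 ?divr_gt0// mulr_gt0// exprn_gt0.
    rewrite E; field; by rewrite gt_eqF.
  by have [f Hf] := choice H; exists f.
have dx t : t \in `]x, x + y[ -> is_derive t 1 (slope p 0) (df t).
  by rewrite in_itv/= => /andP[xt _]; have [] := dfE t (lt_trans x0 xt).
have [t] := MVT xy dx (continuous_subspaceT (@slope_continuous _ p hp 0)).
rewrite in_itv/= => /andP[xt ty] ->; have t0 := lt_trans x0 xt.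
rewrite addrAC subrr add0r exprMn; have [_ ->] := dfE t t0.
rewrite -[leLHS]mulrA; apply: ler_wpM2l; first by rewrite divr_ge0// ltW.
rewrite ler_wpM2r ?sqr_ge0//.
by apply: ge0_ler_powR; rewrite ?nnegrE ?(ltW t0) ?(ltW ty)//; have := hp; lra.
Qed.

(** * A zero-frequency profile U plus a small decaying bump z *)

Section Perturbation.
Variables (U z : R -> R) (A M Z c d : R).
Hypotheses (A0 : 0 < A) (U0 : forall x, 0 < U x) (UA : forall x, U x <= A)
  (cU : continuous U) (sU : sqint U) (UM : \int[mu]_x (U x ^+ 2) = M) (dU : decay p 0 U).
Hypotheses (z0 : forall x, 0 <= z x) (zd : forall x, z x <= d)
  (cz : continuous z) (sz : sqint z) (zZ : \int[mu]_x (z x ^+ 2) = Z)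
  (dz : forall x, 0 < x -> is_derive x 1 z (- (c * z x)))
  (dzn : forall x, x < 0 -> is_derive x 1 z (c * z x)).
Let v x := U x + z x.

Let cv : continuous v. Proof. exact: continuous_addf. Qed.
Let sv : sqint v. Proof. exact: sqintD. Qed.

Let k x := - slope p 0 (U x) - c * z x.
Let ck : continuous k.
Proof.
apply: continuous_subf.
  by apply: continuous_oppf; apply: continuous_compf => //; exact: slope_continuous.
by apply: continuous_mulf; [exact: continuous_cstf|].
Qed.

Let powp_bounded u C : continuous u -> sqint u -> (forall x, 0 <= u x) ->
  (forall x, u x <= C) -> powp_itg p u.
Proof.
by move=> cu su u0 uC; apply: (@powp_itg_bounded _ p _ u C) => // x; rewrite ger0_norm.
Qed.

Let sk : sqint (fun x => sgn x * k x).
Proof.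
apply: sqint_sgn.
have iU : powp_itg p U by apply: (@powp_bounded U A) => // x; exact: ltW.
have := sqintD (sqintZ (-1) (slope_sqint hp (lexx 0) cU sU iU)) (sqintZ (- c) sz).
by congr sqint; apply/funext => x; rewrite /k; ring.
Qed.

Let vk a b : primitive_on a b v (fun x => sgn x * k x).
Proof.
have [dU1 dU2] := dU.
apply: (@primitive_even R v k cv ck).
  by move=> x x0; exact: is_derive_addf (dU1 x x0) (dz x0).
move=> x x0; have := is_derive_addf (dU2 x x0) (dzn x0).
by move/trigger_derive; apply; rewrite /k; ring.
Qed.

Lemma trial_H1 : H1 v. Proof. exact: (H1_of_primitive cv sv sk vk). Qed.

Lemma trial_mass : \int[mu]_x (v x ^+ 2) = M + 2 * \int[mu]_x (U x * z x) + Z.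
Proof.
have iUz := sqint_mul sU sz; have [_ iU] := sU; have [_ iz] := sz.
have i2 := itgZ 2 measurableT iUz.
have iD := itgD measurableT iU i2.
have -> : 2 * \int[mu]_x (U x * z x) = \int[mu]_x (2 * (U x * z x)).
  by rewrite RintegralZl.
rewrite -UM -zZ -(RintegralD measurableT iU i2) -(RintegralD measurableT iD iz).
by apply: eq_Rintegral => x _; rewrite /v; ring.
Qed.

Lemma trial_powp : powp_itg p v.
Proof.
apply: (@powp_bounded v (A + d)) => // x; first by rewrite addr_ge0// ltW.
by rewrite lerD.
Qed.

(** The line is split at the level eta of U. Where U <= eta, the base of the power is at most eta +
    d; where U > eta, z^2 <= d^2 <= (d / eta)^2 U^2. So the bound is small for bounded Z if eta is
    small, then d small relative to eta, and c small. The remaining constants come from (X - c z)^2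
    <= 2 X^2 + 2 c^2 z^2. *)
Lemma trial_excess eta : 0 < eta -> 0 <= d ->
  excess p 0 v <= p * ((eta + d) `^ (p - 2) * Z + (A + d) `^ (p - 2) * (d ^+ 2 / eta ^+ 2) * M)
    + 2 * c ^+ 2 * Z.
Proof.
move=> eta0 d0.
have ae := wderiv_ae trial_H1 sk vk.
have ss := sqint_sgn (slope_sqint hp (lexx 0) cv sv trial_powp).
have sd := sqintD (wderiv_sqint trial_H1) ss.
have -> : excess p 0 v = \int[mu]_x ((sgn x * k x + sgn x * slope p 0 (v x)) ^+ 2).
  apply: eq_Rint_ae => //.
  - by apply: measurable_funX; have [] := sd.
  - by apply: measurable_funX; have [] := sqintD sk ss.
  - by apply: ae_imp ae => x -> _.
have [_ iU] := sU; have [_ iz] := sz.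
have P0 : 0 <= p - 2 by have := hp; lra.
set C1 := (eta + d) `^ (p - 2); set C2 := (A + d) `^ (p - 2) * (d ^+ 2 / eta ^+ 2).
have -> : p * (C1 * Z + C2 * M) + 2 * c ^+ 2 * Z =
    \int[mu]_x ((p * C1 + 2 * c ^+ 2) * z x ^+ 2 + p * C2 * U x ^+ 2).
  rewrite RintegralD//; [|exact: itgZ..].
  by rewrite !RintegralZl// UM zZ; ring.
apply: le_Rintegral => //.
- by have [_] := sqintD sk ss.
- by apply: itgD => //; apply: itgZ.
move=> x _.
have -> : (sgn x * k x + sgn x * slope p 0 (v x)) ^+ 2 =
    ((slope p 0 (U x + z x) - slope p 0 (U x)) - c * z x) ^+ 2.
  by rewrite -mulrDr exprMn sgn2 mul1r /k /v; ring.
have h1 := slope0_increment (U0 x) (z0 x).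
have h2 : (U x + z x) `^ (p - 2) * z x ^+ 2 <= C1 * z x ^+ 2 + C2 * U x ^+ 2.
  have v0 : 0 <= U x + z x by rewrite addr_ge0// ltW.
  have [Ue|Ue] := leP (U x) eta.
    apply: (@le_trans _ _ (C1 * z x ^+ 2)); last first.
      rewrite lerDl /C2 mulr_ge0 ?sqr_ge0// mulr_ge0 ?powR_ge0//.
      by rewrite divr_ge0 ?sqr_ge0.
    rewrite ler_wpM2r ?sqr_ge0//; apply: ge0_ler_powR; rewrite ?nnegrE// ?addr_ge0 ?(ltW eta0)//.
    exact: lerD.
  apply: (@le_trans _ _ (C2 * U x ^+ 2)); last first.
    by rewrite lerDr mulr_ge0 ?powR_ge0 ?sqr_ge0.
  rewrite /C2 -mulrA; apply: ler_pM; rewrite ?powR_ge0 ?sqr_ge0//.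
    by apply: ge0_ler_powR; rewrite ?nnegrE// ?addr_ge0 ?(ltW A0)//; exact: lerD.
  apply: (@le_trans _ _ (d ^+ 2)); first by apply: sqr_le_sqr.
  rewrite mulrAC ler_pdivlMr ?exprn_gt0// ler_wpM2l ?sqr_ge0//.
  by apply: sqr_le_sqr; exact: ltW.
have h3 := sqr_ge0 ((slope p 0 (U x + z x) - slope p 0 (U x)) + c * z x).
move: h1 h2 h3; set X := slope p 0 _ - slope p 0 _; set Y := (U x + z x) `^ _ * _.
move=> h1 h2 h3.
have : p / 2 * Y <= p / 2 * (C1 * z x ^+ 2 + C2 * U x ^+ 2).
  by apply: ler_wpM2l => //; rewrite divr_ge0// ltW.
lra.
Qed.

Lemma trial_energy : energy p q v = (action p q 0 (U 0 + z 0) + excess p 0 v / 2)%:E.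
Proof.
rewrite (energyE _ hp trial_H1 trial_powp); congr EFin.
by rewrite (renergy_excess hp hq2 (lexx 0) trial_H1 trial_powp) mul0r mul0r subr0.
Qed.

End Perturbation.

(** Chooses the height d of the bump so that overlap and bump together supply exactly the missing
    mass N; intermediate values up to the height sqrt(N / P) at which the bump alone would
    suffice. *)
Lemma small_mass_defect N b P : 0 <= b -> 0 < P -> 0 < N ->
  exists d, [/\ 0 <= d, 2 * (d * b) + d ^+ 2 * P = N & d ^+ 2 * P <= N].
Proof.
move=> b0 P0 N0; pose f d := 2 * (d * b) + d ^+ 2 * P.
have cf : continuous f.
  apply: (@is_derive_continuous _ _ (fun d => 2 * (1 * b) + 2 * d * 1 * P)) => d.
  apply: is_derive_addf.
    have := is_derive_scalef 2 (is_derive_mulf (is_derive_idf d) (is_derive_cstf b d)).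
    by move/trigger_derive; apply; ring.
  have := is_derive_mulf (is_derive_sqrf (is_derive_idf d)) (is_derive_cstf P d).
  by move/trigger_derive; apply; ring.
pose D := Num.sqrt (N / P).
have D2 : D ^+ 2 * P = N by rewrite sqr_sqrtr ?divr_ge0 ?(ltW P0) ?(ltW N0)// divfK// gt_eqF.
have D0 : 0 <= D by exact: sqrtr_ge0.
have [|d] := @IVT R f 0 D N D0 (continuous_subspaceT cf).
  rewrite ge_min le_max {1}/f expr0n/= !(mul0r, mulr0) addr0 (ltW N0)/=.
  by rewrite /f D2 lerDr !mulr_ge0 ?orbT.
rewrite in_itv/= => /andP[d0 dD] fd; exists d; split => //.
by rewrite -[leRHS]fd lerDr mulr_ge0// mulr_ge0.
Qed.

(** The lower bound is the optimality of [amp_max], whose level is independent of the mass because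
    its frequency is 0. For the upper bound the trial function costs the change of the action from A
    to A + d plus half its excess, each at most e / 2. *)
Lemma ground_energy_beyond m : p < 6 -> Mass amp_max < m ->
  ground_energy p q m = (crit p q amp_max)%:E.
Proof.
move=> p6 Mm; have ar := in_range_max q hp p6; have [A0 Ale _] := ar.
have l0 := lam_max hp hqp.
have lower := ground_energy_ge hp hq2 hqp hq4 (optimal_max hp hq2 hqp hq4 p6 (ltW Mm)).
set A := amp_max in A0 Ale ar l0 Mm lower *.
set M := Mass A in Mm *.
have N0 : 0 < m - M by rewrite subr_gt0.
have lE n : level p q A n = crit p q A by rewrite /level l0 !mul0r subr0.
apply/eqP; rewrite eq_le; apply/andP; split; last by rewrite -(lE m).
have quarters2 (e : R) : 0 < e -> e / 4 + e / 4 < e by lra.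
have quarters3 (e : R) : 0 < e -> e / 4 + e / 4 + e / 4 <= e by lra.
pose U := soliton A.
have dU : decay p 0 U.
  rewrite -l0; split=> x x0; [exact: soliton_derive|exact: soliton_derive_neg].
have UM : \int[mu]_x (U x ^+ 2) = M by have [] := soliton_sq_itg hp hqp ar.
have U0 x : 0 < U x by exact: soliton_gt0.
have UA x : U x <= A by exact: soliton_le.
have UE : U 0 = A by exact: soliton0.
have cU : continuous U by exact: soliton_continuous.
have sU : sqint U by exact: soliton_sqint.
have M0 : 0 <= M by exact: Mass_ge0.
have P10 : 0 < P1 by exact: pmass_gt0.
clearbody U M; move: (P1) P10 (@wide_sqint) => P P0 wide2.
set N := m - M in N0.
apply/lee_addgt0Pr => e e0.
have ca : {for A, continuous (action p q 0)} by exact: action_continuous.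
have /cvgrPdist_lt /(_ (e / 2)) := ca.
move=> /(_ ltac:(by rewrite divr_gt0)) [r1 /= r10 hr1].
have p20 : 0 < p - 2 by rewrite subr_gt0.
have cpw := @continuous_norm_powR R _ p20.
have c2 : {for 0, continuous (fun t : R => p * N * `|t| `^ (p - 2))}.
  by apply: continuousM; [exact: cst_continuous|exact: cpw].
have e3 : 0 < e / 4 by rewrite divr_gt0.
have /cvgrPdist_lt /(_ _ e3) [r2 /= r20 hr2] := c2.
(* A quarter of r2 leaves room for eta + d < r2 once d < eta. The radius r3 below depends on eta, as
   d / eta must be small. *)
pose eta := r2 / 4; have eta0 : 0 < eta by rewrite divr_gt0.
have eta2 : eta + eta < r2 by exact: quarters2.
have c3 : {for 0, continuous (fun t : R => p * ((A + 1) `^ (p - 2) * M) * (t ^+ 2 / eta ^+ 2))}.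
  apply: continuousM; first exact: cst_continuous.
  apply: continuousM; last exact: cst_continuous.
  exact: exprn_continuous.
have /cvgrPdist_lt /(_ _ e3) [r3 /= r30 hr3] := c3.
pose D := Num.min (Num.min r1 eta) (Num.min r3 1).
have D0 : 0 < D by rewrite !lt_min r10 eta0 r30 ltr01.
have Dr1 : D <= r1 by rewrite !ge_min lexx.
have Deta : D <= eta by rewrite !ge_min lexx !orbT.
have Dr3 : D <= r3 by rewrite !ge_min lexx !orbT.
have D1 : D <= 1 by rewrite !ge_min lexx !orbT.
(* The second entry makes 2 c^2 Z at most e / 4; the third forces d < D, since d^2 P <= c N. *)
pose c := Num.min (Num.min 1 (e / (8 * N))) (D ^+ 2 * P / (2 * N)).
have c0 : 0 < c by rewrite !lt_min ltr01 !divr_gt0 ?mulr_gt0.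
have c1 : c <= 1 by rewrite !ge_min lexx.
have cN : c * N <= e / 8.
  rewrite -ler_pdivlMr// (_ : e / 8 / N = e / (8 * N)); first by rewrite !ge_min lexx !orbT.
  by field; rewrite gt_eqF.
have cD : c * N <= D ^+ 2 * P / 2.
  rewrite -ler_pdivlMr// (_ : D ^+ 2 * P / 2 / N = D ^+ 2 * P / (2 * N)).
    by rewrite !ge_min lexx !orbT.
  by field; rewrite gt_eqF.
have [sw w2] := wide2 c c0.
pose b := \int[mu]_x (U x * wide c x).
have b0 : 0 <= b by apply: Rintegral_ge0 => x _; rewrite mulr_ge0// ltW// wide_gt0.
have [d [d0 dN dZ]] := small_mass_defect b0 (divr_gt0 P0 c0) N0.
have dD : d < D.
  rewrite -(@ltr_pXn2r _ 2)// ?nnegrE//; last exact: ltW.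
  have : d ^+ 2 * P <= N * c by rewrite -ler_pdivrMr// -mulrA.
  rewrite -(@ltr_pM2r _ P)// => h; apply: (le_lt_trans h).
  rewrite mulrC; apply: (le_lt_trans cD).
  by rewrite ltr_pdivrMr// ltr_pMr ?ltr1n// mulr_gt0// exprn_gt0.
pose z x := d * wide c x.
have z0 x : 0 <= z x by rewrite mulr_ge0// ltW// wide_gt0.
have zd x : z x <= d by rewrite ler_piMr// wide_le1.
have cz : continuous z.
  by apply: continuous_mulf; [exact: continuous_cstf|exact: wide_continuous].
have sz : sqint z by exact: sqintZ.
have zZ : \int[mu]_x (z x ^+ 2) = d ^+ 2 * (P / c).
  have [_ iw] := sw.
  rewrite -w2 -RintegralZl//; by apply: eq_Rintegral => x _; rewrite exprMn.
have dz x : 0 < x -> is_derive x 1 z (- (c * z x)).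
  move=> x0; have := is_derive_scalef d (wide_derive c0 x0).
  by move/trigger_derive; apply; rewrite /z; ring.
have dzn x : x < 0 -> is_derive x 1 z (c * z x).
  move=> x0; have := is_derive_scalef d (wide_derive_neg c0 x0).
  by move/trigger_derive; apply; rewrite /z; ring.
have bE : \int[mu]_x (U x * z x) = d * b.
  rewrite /b -RintegralZl//; last exact: sqint_mul.
  by apply: eq_Rintegral => x _; rewrite /z mulrCA.
have zz : z 0 = d by rewrite /z /wide mulr0 /eprof normr0 prof0 mulr1.
have hv := trial_H1 U0 UA cU sU dU cz sz dz dzn.
have mv := trial_mass sU UM sz zZ.
have ev := trial_energy U0 UA cU sU dU z0 zd cz sz dz dzn.
have xv := trial_excess A0 U0 UA cU sU UM dU z0 zd cz sz zZ dz dzn eta0 d0.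
have vm : H1mass m (fun x => U x + z x).
  split; first exact: hv.
  apply/(mass_sq _ (H1_sqint hv)); rewrite mv bE -addrA dN /N addrC subrK//.
move: (fun x => U x + z x) vm ev xv => v vm ev xv {mv hv}.
apply: (@le_trans _ _ (energy p q v)); first by apply: ereal_inf_lbound; exists v.
rewrite ev UE zz -EFinD lee_fin.
have h1 : action p q 0 (A + d) <= crit p q A + e / 2.
  have : `|action p q 0 A - action p q 0 (A + d)| < e / 2.
    apply: hr1; rewrite /ball/= opprD addrA subrr add0r normrN ger0_norm//.
    exact: lt_le_trans Dr1.
  rewrite /crit l0 distrC => /(le_lt_trans (ler_norm _))/ltW.
  by rewrite lerBlDl.
have h2 : p * N * (eta + d) `^ (p - 2) <= e / 4.
  have ed : 0 <= eta + d by rewrite addr_ge0// ltW.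
  have : `|p * N * `|(0 : R)| `^ (p - 2) - p * N * `|eta + d| `^ (p - 2)| < e / 4.
    apply: hr2; rewrite /ball/= sub0r normrN ger0_norm//.
    by apply: lt_trans eta2; rewrite ltrD2l; exact: lt_le_trans Deta.
  rewrite normr0 powR0 ?gt_eqF// mulr0 sub0r normrN (ger0_norm ed).
  by move=> /(le_lt_trans (ler_norm _)) /ltW.
have h3 : p * ((A + 1) `^ (p - 2) * M) * (d ^+ 2 / eta ^+ 2) <= e / 4.
  have : `|p * ((A + 1) `^ (p - 2) * M) * (0 ^+ 2 / eta ^+ 2) -
    p * ((A + 1) `^ (p - 2) * M) * (d ^+ 2 / eta ^+ 2)| < e / 4.
    by apply: hr3; rewrite /ball/= sub0r normrN ger0_norm//; exact: lt_le_trans Dr3.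
  rewrite expr0n/= mul0r mulr0 sub0r normrN.
  by move=> /(le_lt_trans (ler_norm _)) /ltW.
have h4 : 2 * c ^+ 2 * (d ^+ 2 * (P / c)) <= e / 4.
  apply: (@le_trans _ _ (2 * c ^+ 2 * N)).
    by apply: ler_wpM2l => //; rewrite mulr_ge0// sqr_ge0.
  have -> : e / 4 = 2 * (1 * (e / 8)) by field.
  have -> : 2 * c ^+ 2 * N = 2 * (c * (c * N)) by ring.
  by rewrite ler_pM2l//; apply: ler_pM => //; [exact: ltW|rewrite mulr_ge0// ltW].
have h5 : p * ((eta + d) `^ (p - 2) * (d ^+ 2 * (P / c))) <= e / 4.
  apply: le_trans h2; rewrite -[leRHS]mulrA [N * _]mulrC.
  apply: ler_wpM2l; first exact: ltW.
  by apply: ler_wpM2l => //; exact: powR_ge0.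
have h6 : p * ((A + d) `^ (p - 2) * (d ^+ 2 / eta ^+ 2) * M) <= e / 4.
  apply: le_trans h3; rewrite -[leRHS]mulrA [X in _ <= p * X]mulrAC.
  apply: ler_wpM2l; first exact: ltW.
  apply: ler_wpM2r => //; apply: ler_wpM2r; first by rewrite divr_ge0 ?sqr_ge0.
  apply: ge0_ler_powR; rewrite ?nnegrE; [exact: ltW|by rewrite addr_ge0// ltW..|].
  by rewrite lerD2l (le_trans (ltW dD)).
rewrite mulrDr in xv; rewrite [e]splitr addrA; apply: lerD h1 _.
rewrite ler_pM2r ?invr_gt0//.
exact: le_trans (le_trans xv (lerD (lerD h5 h6) h4)) (quarters3 e e0).
Qed.

End Trial.

(** * The second-order equation on a half-line *)

Section HalfLine.
Context {R : realType}.
Notation mu := (@lebesgue_measure R).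
Implicit Types (f g k u G : R -> R) (a b x y N e I : R).

Lemma ae_exists (P : R -> Prop) a b : a < b -> {ae mu, forall x, P x} ->
  exists2 x, a < x < b & P x.
Proof.
move=> ab [N [mN N0 hN]]; apply: contrapT => H.
have sub : `]a, b[%classic `<=` N.
  move=> x /=; rewrite in_itv/= => xab; apply: hN => /= Px; apply: H; by exists x.
have : (mu `]a, b[%classic <= 0)%E by rewrite -N0; apply: le_measure; rewrite ?inE.
by rewrite lebesgue_measure_itv/= lte_fin ab -EFinB lee_fin leNgt subr_gt0 ab.
Qed.

Lemma ae_neq0 : {ae mu, forall x, x != 0}.
Proof.
exists [set (0:R)]; split; [exact: measurable_set1|exact: lebesgue_measure_set1|].
by move=> x /= /negP; rewrite negbK => /eqP.
Qed.

Lemma incr_within f (df : R -> R) s t : s <= t ->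
  (forall x, s <= x -> is_derive x 1 f (df x)) -> (forall x, s <= x -> 0 <= df x) ->
  f s <= f t.
Proof.
move=> st d df0; apply: (derive_ge0_le st _ (fun x sx _ => d x (ltW sx))).
- by apply: within_derive => x sx _; exact: d.
- by move=> x /ltW sx _; exact: df0.
Qed.

(** The difference quotient at 0 is k itself, so continuity is enough. It handles |t|^p at 0,
    written as t times |t|^(p-2) t. *)
Lemma is_derive_mul_id k : {for 0, continuous k} -> is_derive (0:R) 1 (fun t => t * k t) (k 0).
Proof.
move=> ck.
have E : (fun h : R => h^-1 *: ((fun t => t * k t) (h *: (1:R) + 0) - 0 * k 0)) @ 0^' --> k 0.
  have c : k x @[x --> 0^'] --> k 0 by apply: cvg_trans ck; apply: cvg_app; exact: cvg_within.
  apply: cvg_trans c; apply: near_eq_cvg; near=> h.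
  have h0 : h != 0 by near: h; exact: nbhs_dnbhs_neq.
  rewrite mul0r subr0 addr0 /GRing.scale/= mulr1 mulrA mulVf// mul1r//.
apply: DeriveDef.
  by rewrite /derivable; apply: cvgP; exact: E.
by rewrite /derive; apply: cvg_lim => //; exact: E.
Unshelve. all: by end_near. Qed.

Lemma norm_powR_derive_all (p : R) x : 2 < p ->
  is_derive x 1 (fun t => `|t| `^ p) (p * (`|x| `^ (p - 2) * x)).
Proof.
move=> hp; have p20 : 0 < p - 2 by rewrite subr_gt0.
have pos y : 0 < y -> is_derive y 1 (fun t => `|t| `^ p) (p * (`|y| `^ (p - 2) * y)).
  move=> y0; have := norm_powR_derive p y0; rewrite (gtr0_norm y0).
  rewrite (_ : y `^ (p - 1) = y `^ (p - 2) * y)//.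
  rewrite -[X in _ * X]powRr1 ?(ltW y0)// -powRD; last by rewrite (gt_eqF y0) implybT.
  by congr (_ `^ _); ring.
have [x0|x0|x0] := ltgtP x 0; [|exact: pos|].
  have x0' : 0 < - x by rewrite oppr_gt0.
  have := @is_derive_compf _ _ (fun t => - t) x _ _ (pos _ x0') (is_derive_oppf (is_derive_idf x)).
  have -> : (fun t : R => `|- t| `^ p) = (fun t => `|t| `^ p) by apply/funext => t; rewrite normrN.
  by move/trigger_derive; apply; rewrite normrN; ring.
have ck : continuous (fun t : R => `|t| `^ (p - 2) * t).
  by apply: continuous_mulf; [exact: continuous_norm_powR|exact: continuous_idf].
have := is_derive_mul_id (ck 0).
have -> : (fun t : R => t * (`|t| `^ (p - 2) * t)) = (fun t => `|t| `^ p).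
  have pn0 : p != 0 by rewrite gt_eqF//; lra.
  by apply/funext => t; rewrite (norm_powR_sq t pn0); ring.
by rewrite x0; move/trigger_derive; apply; rewrite !mulr0.
Qed.

(* The first integral G^2 - slope(u)^2 vanishes at infinity and u * G is
   nondecreasing, which selects the decaying branch. *)
Lemma decaying_branch (p l : R) u G : 2 < p -> 0 <= l ->
  (forall x, 0 < x -> is_derive x 1 u (G x)) ->
  (forall x, 0 < x -> is_derive x 1 G (l * u x + `|u x| `^ (p - 2) * u x)) ->
  (forall N e, 0 < e -> exists2 x, N <= x & u x ^+ 2 + G x ^+ 2 < e) ->
  forall x, 0 < x -> G x = - slope p l (u x).
Proof.
move=> hp l0 du dG small x x0; have p0 : 0 < p by lra.
pose E t := G t ^+ 2 - (l * u t ^+ 2 + 2 / p * `|u t| `^ p).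
have dE (t : R) : 0 < t -> is_derive t 1 E 0.
  move=> t0; have := is_derive_subf (is_derive_sqrf (dG t t0))
    (is_derive_addf (is_derive_scalef l (is_derive_sqrf (du t t0)))
      (is_derive_scalef (2 / p) (@is_derive_compf _ (fun z => `|z| `^ p) u t _ _
        (norm_powR_derive_all (u t) hp) (du t t0)))).
  by move/trigger_derive; apply; field; rewrite gt_eqF.
have Ec t : x <= t -> E t = E x.
  move=> xt; apply/eqP; rewrite eq_le; apply/andP; split.
    have := @incr_within (fun z => - E z) (fun _ => - 0) x t xt.
    rewrite lerN2; apply => [z xz|z _]; last by rewrite oppr0.
    by apply: is_derive_oppf; apply: dE; exact: lt_le_trans xz.
  apply: (@incr_within _ (fun _ => 0)) => // z xz.
  by apply: dE; exact: lt_le_trans xz.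
have E0 : E x = 0.
  apply/eqP; rewrite -normr_eq0 -normr_le0 normr_id.
  apply: (@le0_of_le_eps _ _ (1 + l + 2 / p)) => e e0.
  (* The cap at 1 gives |u t| <= 1, hence |u t|^p <= (u t)^2, so all terms of the first integral are
     controlled by e. *)
  have [|t xt te] := small x (Num.min e 1); first by rewrite lt_min e0 ltr01.
  rewrite -(Ec t xt).
  have te' : u t ^+ 2 + G t ^+ 2 < e by apply: (lt_le_trans te); rewrite ge_min lexx.
  have t1 : u t ^+ 2 + G t ^+ 2 < 1 by apply: (lt_le_trans te); rewrite ge_min lexx orbT.
  have G2 := sqr_ge0 (G t); have u2 := sqr_ge0 (u t).
  have pu : 0 <= `|u t| `^ p by exact: powR_ge0.
  have pu2 : `|u t| `^ p <= u t ^+ 2.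
    have u1 : `|u t| <= 1.
      by rewrite -(@ler_pXn2r _ 2)// ?nnegrE// expr1n real_normK ?num_real//; lra.
    have [ut|ut] := eqVneq (u t) 0; first by rewrite ut normr0 powR0 ?gt_eqF// expr0n.
    rewrite -(@real_normK _ (u t)) ?num_real// -powR_mulrn//.
    apply: ger_powR; first by rewrite normr_gt0 ut u1.
    exact: ltW.
  have c0 : 0 < 2 / p by rewrite divr_gt0.
  have h1 : l * u t ^+ 2 <= l * e by apply: ler_wpM2l => //; lra.
  have h2 : 2 / p * `|u t| `^ p <= 2 / p * e by apply: ler_wpM2l; lra.
  have h3 : 0 <= l * u t ^+ 2 by exact: mulr_ge0.
  have h4 : 0 <= 2 / p * `|u t| `^ p by apply: mulr_ge0 => //; exact: ltW.
  by rewrite /E ler_norml; apply/andP; split; lra.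
have K0 : u x * G x <= 0.
  apply: (@le0_of_le_eps _ _ 1) => e e0; rewrite mulr1.
  have [t xt te] := small x e e0.
  apply: (@le_trans _ _ (u t * G t)); last first.
    have := sqr_ge0 (u t - G t); have := sqr_ge0 (u t); have := sqr_ge0 (G t); nra.
  apply: (@incr_within (fun z => u z * G z)
    (fun z => u z * (l * u z + `|u z| `^ (p - 2) * u z) + G z * G z)) => // z xz.
    by apply: is_derive_mulf; [apply: du|apply: dG]; exact: lt_le_trans xz.
  have -> : u z * (l * u z + `|u z| `^ (p - 2) * u z) + G z * G z =
    (l + `|u z| `^ (p - 2)) * u z ^+ 2 + G z ^+ 2 by ring.
  apply: addr_ge0; last exact: sqr_ge0.
  by apply: mulr_ge0; [apply: addr_ge0 => //; exact: powR_ge0|exact: sqr_ge0].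
have : G x ^+ 2 = slope p l (u x) ^+ 2.
  by rewrite slope_sq//; apply/eqP; rewrite -subr_eq0; apply/eqP; exact: E0.
(* On the growing branch u S(u) would be both nonpositive, by [K0], and nonnegative; so the slope
   vanishes and the two branches agree. *)
move/eqP; rewrite eqf_sqr => /orP[/eqP GE|/eqP//].
have h : u x * slope p l (u x) = 0.
  apply/eqP; rewrite eq_le -{1}GE K0/=.
  by rewrite /slope mulrA mulr_ge0 ?sqrtr_ge0// -expr2 sqr_ge0.
rewrite GE; have [u0|u0] := eqVneq (u x) 0; first by rewrite u0 /slope mul0r oppr0.
have s0 : slope p l (u x) = 0.
  by move/eqP: h; rewrite mulf_eq0 (negbTE u0) => /eqP.
by rewrite s0 oppr0.
Qed.

End HalfLine.

(** * Every bound state is a soliton up to sign *)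

Section BoundStates.
Context {R : realType} (p q : R).
Notation mu := (@lebesgue_measure R).
Implicit Types (a b x y l m : R) (u v g : R -> R).
Hypotheses (hp : 2 < p) (hq2 : 2 < q) (hqp : q < p / 2 + 1).
Notation lam := (lam p q).
Notation amp_max := (amp_max p q).
Notation soliton := (soliton p q).
Notation Mass := (Mass p q).

Section WeakSolution.
Variables (u : R -> R) (l : R).
Hypotheses (hu : H1 u) (l0 : 0 <= l) (we : weak_equation p l u).
Let g := wderiv u.
Let rho x := l * u x + `|u x| `^ (p - 2) * u x.
Let cu : continuous u. Proof. exact: H1_continuous. Qed.
Let c2 : continuous (fun x => `|u x| `^ (p - 2) * u x).
Proof.
apply: continuous_mulf => //.
apply: (continuous_compf (f := fun z : R => `|z| `^ (p - 2))) => //.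
by apply: continuous_norm_powR; rewrite subr_gt0.
Qed.
Let c1 : continuous (fun x => l * u x).
Proof. by apply: continuous_mulf; [exact: continuous_cstf|]. Qed.
Let crho : continuous rho. Proof. exact: continuous_addf. Qed.
Let sg : sqint g. Proof. exact: wderiv_sqint. Qed.

Let test phi : C1c phi -> ~ supp phi 0 ->
  \int[mu]_x (g x * derive1 phi x) = - \int[mu]_x (rho x * phi x).
Proof.
move=> cp phi0; have [L L0 HL] := C1c_bounded cp; have cphi := C1c_continuous cp.
have supp0 f : \int[mu]_x (f x * phi x) = \int[mu]_(x in `[- L, L]) (f x * phi x).
  apply: Rint_supp => x /= xL; have [|-> _] := HL x; rewrite ?mulr0//.
  by rewrite leNgt; apply/negP => h; apply: xL; rewrite in_itv/= -ler_norml ltW.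
have := we cp phi0; rewrite !supp0 -/g.
have -> : \int[mu]_(x in `[- L, L]) (rho x * phi x) =
  l * \int[mu]_(x in `[- L, L]) (u x * phi x) +
  \int[mu]_(x in `[- L, L]) (`|u x| `^ (p - 2) * u x * phi x).
  rewrite -RintegralZl//; last by apply: continuous_itg; exact: continuous_mulf.
  rewrite -RintegralD//; last by apply: continuous_itg; exact: continuous_mulf.
    by apply: eq_Rintegral => x _; rewrite /rho; ring.
  apply: itgZ => //; by apply: continuous_itg; exact: continuous_mulf.
by move=> <-; ring.
Qed.

(** Integrates the weak equation between two Lebesgue points of the derivative; they must lie on the
    same side of 0, because test functions avoid the origin. *)
Let increment x y : x < y -> 0 < x \/ y < 0 -> lebesgue_pt g x -> lebesgue_pt g y ->
  g y - g x = primitive0 rho y - primitive0 rho x.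
Proof.
move=> xy xy0 gx gy.
have [_ ->] := primitive_C1 x y (fun t => primitive0_derive t crho) crho; [|lra..].
apply: weak_primitive_at => //.
- by move=> a b; exact: sqint_itv.
- by move=> a b; exact: continuous_itg.
(* Distance from [x, y] to 0: a smaller smoothing width keeps the support of the test function on
   one side. *)
have [d d0 hd] : exists2 d : R, 0 < d & forall h, 0 < h -> h < d -> 0 < x - h \/ y + h < 0.
  case: xy0 => h; [exists x|exists (- y)] => //; first by move=> t t0 tx; left; lra.
    by rewrite oppr_gt0.
  by move=> t t0 tx; right; lra.
exists d => // h h0 hh.
have := test (step2_C1c h0 (ltW xy)).
have -> : derive1 (step2 h x y) = tent2 h x y.
  by apply/funext => t; apply: is_derive_derive1; exact: step2_derive.
apply => /(step2_supp h0 (ltW xy)) /=; rewrite in_itv/= => /andP[h1 h2].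
by case: (hd h h0 hh); lra.
Qed.

Let ae_leb : {ae mu, forall x, lebesgue_pt g x}.
Proof. by apply: lebesgue_pt_ae; [have [] := sg|move=> a b; exact: sqint_itv]. Qed.

Let ae_leb_neq0 : {ae mu, forall x, lebesgue_pt g x /\ x != 0}.
Proof. exact: (@filterI _ (almost_everywhere mu) _ _ _ ae_leb (ae_neq0 (R := R))). Qed.

(** One Lebesgue point x0 fixes the constant, and [increment] transports the formula to almost every
    point of the half-line. *)
Let right_form : exists c, {ae mu, forall x, 0 <= x -> g x = c + primitive0 rho x}.
Proof.
have [x0 /andP[x00 _] gx0] := ae_exists ltr01 ae_leb.
exists (g x0 - primitive0 rho x0); apply: ae_imp ae_leb_neq0 => x [gx xn0] x0'.
have xp : 0 < x by rewrite lt_neqAle eq_sym xn0.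
have [xl|xl|->] := ltgtP x x0; last by rewrite subrK.
  have := increment xl (or_introl xp) gx gx0; lra.
have := increment xl (or_introl x00) gx0 gx; lra.
Qed.

Let left_form : exists c, {ae mu, forall x, x <= 0 -> g x = c + primitive0 rho x}.
Proof.
have m10 : (-1 : R) < 0 by rewrite oppr_lt0 ltr01.
have [x0 /andP[_ x00] gx0] := ae_exists m10 ae_leb.
exists (g x0 - primitive0 rho x0); apply: ae_imp (ae_leb_neq0) => x [gx xn0] x0'; have xp : x < 0 by rewrite lt_neqAle xn0.
have [xl|xl|->] := ltgtP x x0; last by rewrite subrK.
  have := increment xl (or_intror x00) gx gx0; lra.
have := increment xl (or_intror xp) gx0 gx; lra.
Qed.

Let cP c : continuous (fun x => c + primitive0 rho x).
Proof.
apply: continuous_addf; first exact: continuous_cstf.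
by apply: is_derive_continuous => x; exact: primitive0_derive.
Qed.

Let dP c x : is_derive x 1 (fun x => c + primitive0 rho x) (rho x).
Proof.
have := is_derive_addf (is_derive_cstf c x) (primitive0_derive x crho).
by rewrite add0r.
Qed.

(** A bound independent of the interval, from which the far points of smallness asked by
    [decaying_branch] are drawn. *)
Let energy_density_itv (G : R -> R) a b : continuous G ->
  {ae mu, forall x, a <= x <= b -> g x = G x} ->
  \int[mu]_(x in `[a, b]) (u x ^+ 2 + G x ^+ 2) <= \int[mu]_x (u x ^+ 2 + g x ^+ 2).
Proof.
move=> cG gG; have [mu' iu] := H1_sqint hu; have [mg ig] := sg.
have -> : \int[mu]_(x in `[a, b]) (u x ^+ 2 + G x ^+ 2) =
    \int[mu]_(x in `[a, b]) (u x ^+ 2 + g x ^+ 2).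
  apply: eq_Rint_ae => //.
  - apply: measurable_funTS; apply: measurable_funD; first exact: measurable_funX.
    by apply: measurable_funX; exact: continuous_measurable.
  - by apply: measurable_funTS; apply: measurable_funD; exact: measurable_funX.
  - by apply: ae_imp gG => x H /=; rewrite in_itv/= => /H ->.
apply: Rint_itv_leT; first exact: itgD.
by move=> x; rewrite addr_ge0 ?sqr_ge0.
Qed.

Let increment_itv (G : R -> R) a b : a <= b -> continuous G ->
  {ae mu, forall x, a <= x <= b -> g x = G x} -> u b - u a = \int[mu]_(x in `[a, b]) G x.
Proof.
move=> ab cG gG; have [_ ->//] := wderiv_primitive hu a b.
apply: eq_Rint_ae => //.
- by apply: measurable_funTS; have [] := sg.
- exact: continuous_measurable.
Qed.

(** On each open half-line the weak derivative has a C^1 version G with G' = rho, so u is a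
    classical solution and [decaying_branch] applies. *)
Lemma weak_solution_decay : decay p l u.
Proof.
have sq_cont (G : R -> R) : continuous G -> continuous (fun x => u x ^+ 2 + G x ^+ 2).
  by move=> cG; apply: continuous_addf; [exact: (continuous_mulf cu cu)|exact: (continuous_mulf cG cG)].
split.
- have [c hc] := right_form; pose G x := c + primitive0 rho x.
  have gG a b : 0 <= a -> {ae mu, forall x, a <= x <= b -> g x = G x}.
    by move=> a0; apply: ae_imp hc => x H /andP[ax _]; apply: H; exact: le_trans ax.
  have du x : 0 < x -> is_derive x 1 u (G x).
    apply: primitive_derive_right; first exact: cP.
    by move=> s t s0 st; apply: increment_itv => //; [exact: cP|exact: gG].
  have E := @decaying_branch _ p l u G hp l0 du (fun x _ => dP c x).
  move=> x x0; rewrite -E//; first exact: du.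
  move=> N e e0.
  have [] := @small_value_right _ (fun x => u x ^+ 2 + G x ^+ 2) (Num.max N 0) e
    (\int[mu]_x (u x ^+ 2 + g x ^+ 2)) e0.
  - by move=> a b; apply: continuous_itg; apply: sq_cont; exact: cP.
  - move=> b _; apply: energy_density_itv; first exact: cP.
    by apply: gG; rewrite le_max lexx orbT.
  - by move=> t; rewrite ge_max => /andP[Nt _] ht; exists t.
- have [c hc] := left_form; pose G x := c + primitive0 rho x.
  have gG a b : b <= 0 -> {ae mu, forall x, a <= x <= b -> g x = G x}.
    by move=> b0; apply: ae_imp hc => x H /andP[_ xb]; apply: H; exact: le_trans b0.
  have du x : x < 0 -> is_derive x 1 u (G x).
    apply: primitive_derive_left; first exact: cP.
    by move=> s t t0 st; apply: increment_itv => //; [exact: cP|exact: gG].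
  (* The left half-line is reflected: u(-x), with derivative -G(-x), solves the same equation on the
     right. *)
  have refl (f : R -> R) d x : is_derive (- x) 1 f d -> is_derive x 1 (fun t => f (- t)) (- d).
    move=> fd; have := @is_derive_compf _ f (fun t => - t) x _ _ fd (is_derive_oppf (is_derive_idf x)).
    by rewrite mulrN1.
  have E := @decaying_branch _ p l (fun x => u (- x)) (fun x => - G (- x)) hp l0.
  move=> x x0; have x0' : 0 < - x by rewrite oppr_gt0.
  have /(_ (- x) x0')/oppr_inj : forall x, 0 < x -> - G (- x) = - slope p l (u (- x)); last first.
    by rewrite opprK => <-; exact: du.
  apply: E.
  + by move=> t t0; apply: refl; apply: du; rewrite oppr_lt0.
  + move=> t t0; have := is_derive_oppf (refl G _ _ (dP c (- t))).
    by rewrite opprK.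
  + move=> N e e0.
    have [] := @small_value_left _ (fun x => u x ^+ 2 + G x ^+ 2) (Num.min (- N) 0) e
      (\int[mu]_x (u x ^+ 2 + g x ^+ 2)) e0.
    - by move=> a b; apply: continuous_itg; apply: sq_cont; exact: cP.
    - move=> b _; apply: energy_density_itv; first exact: cP.
      by apply: gG; rewrite ge_min lexx orbT.
    - move=> t; rewrite le_min => /andP[Nt _] ht; exists (- t); first by rewrite lerNr.
      by rewrite opprK sqrrN.
Qed.

End WeakSolution.

Lemma decay_jump u l : continuous u -> decay p l u -> jump_condition q u ->
  2 * slope p l (u 0) = `|u 0| `^ (q - 2) * u 0.
Proof.
move=> cu [d1 d2] [dl [dr [hl hr <-]]].
have cS : continuous (fun x => slope p l (u x)).
  by apply: continuous_compf => //; exact: slope_continuous.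
have l1 := left_slope cu cS d2.
have r1 := right_slope cu (continuous_oppf cS) d1.
have -> : dl = slope p l (u 0) by apply: (cvg_unique _ hl l1); exact: norm_hausdorff.
have -> : dr = - slope p l (u 0) by apply: (cvg_unique _ hr r1); exact: norm_hausdorff.
ring.
Qed.

(** The jump condition fixes the slope at the origin, and squaring it gives l = lam |u 0|; then l >=
    0 bounds the amplitude by [amp_max]. *)
Lemma bound_state_soliton u l : H1 u -> 0 <= l -> weak_equation p l u ->
  jump_condition q u -> u <> (fun=> 0) ->
  exists a, [/\ 0 < a, a <= amp_max & u = soliton a \/ u = - soliton a].
Proof.
move=> hu l0 we ju une; have cu := H1_continuous hu.
have du := weak_solution_decay hu l0 we.
have J := decay_jump cu du ju.
(* A zero at the origin would make u vanish identically, by uniqueness of the decaying flow. *)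
have [u0|u0] := eqVneq (u 0) 0.
  exfalso; apply: une; apply: (decay_unique hp l0 cu (@continuous_cstf _ 0) du) => //.
  by split=> x _; rewrite /slope mul0r ?oppr0; exact: is_derive_cstf.
have a0 : 0 < `|u 0| by rewrite normr_gt0.
have S : Num.sqrt (radicand p l (u 0)) = `|u 0| `^ (q - 2) / 2.
  apply: (@mulfI _ (2 * u 0)); first by rewrite mulf_neq0.
  by rewrite -mulrA -[_ * Num.sqrt _]/(slope p l (u 0)) J; field.
have lE : l = lam `|u 0|.
  have := congr1 (fun z => z ^+ 2) S; rewrite sqr_sqrtr ?radicand_ge0//.
  rewrite expr_div_n -powR_mulrn ?powR_ge0// -powRrM (_ : (q - 2) * 2%:R = 2 * q - 4); last by ring.
  rewrite /radicand => H; rewrite /lam normr_id.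
  rewrite (_ : _ / 4 = `|u 0| `^ (2 * q - 4) / 2 ^+ 2); last by congr (_ / _); ring.
  by rewrite -H; ring.
have am : `|u 0| <= amp_max by apply: lam_ge0_le => //; rewrite -lE.
exists `|u 0|; split => //.
by apply: (decay_soliton hp hq2 hqp a0 am cu) => //; rewrite -lE.
Qed.

Hypothesis hq4 : q < 4.

Lemma bound_state_iff m : p < 6 -> 0 < m -> (bound_state_exists p q m <-> m <= Mass amp_max).
Proof.
move=> p6 m0; have arM := in_range_max q hp p6; split.
  move=> [u [l [l0 um we ju]]]; have [hu _] := um; have um' := H1mass_int um.
  have une : u <> (fun=> 0).
    move=> uE; move: um' m0; rewrite uE.
    have -> : \int[mu]_x ((fun=> 0 : R) x ^+ 2) = 0.
      have -> : (fun x : R => (0 : R) ^+ 2) = (fun x => 0) by apply/funext => x; rewrite expr0n.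
      by rewrite Rintegral_cst// mul0r.
    by move=> <-; rewrite ltxx.
  have [a [a0 aM ua]] := bound_state_soliton hu l0 we ju une.
  have ar : in_range p q a by split; [exact: a0|exact: aM|right].
  have -> : m = Mass a.
    rewrite -um'; have [_ <-] := soliton_sq_itg hp hqp ar.
    by case: ua => ->//; apply: eq_Rintegral => x _; rewrite fctE sqrrN.
  move: aM; rewrite le_eqVlt => /orP[/eqP->|aM]; first exact: lexx.
  apply: ltW; apply: Mass_incr; [exact: hp|exact: hqp|exact: hq4|exact: a0|exact: aM|exact: arM].
rewrite le_eqVlt => mM.
have [a ar <-] : exists2 a, in_range p q a & Mass a = m.
  case/orP: mM => [/eqP->|mM]; first by exists amp_max.
  have [a [a0 aM aE]] := Mass_surj hp hqp hq4 m0 (fun _ => mM).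
  by exists a => //; split; [exact: a0|exact: ltW|left].
have [a0 aM _] := ar.
exists (soliton a), (lam a); split.
- by apply: lam_ge0 => //; exact: ltW.
- exact: soliton_mass.
- exact: soliton_weak_equation.
- exact: soliton_jump.
Qed.

End BoundStates.

(** * The ground energy as a function of the mass *)

Section GroundEnergyCurve.
Context {R : realType} (p q : R).
Notation mu := (@lebesgue_measure R).
Implicit Types (a b x y l m n : R) (u v g : R -> R).
Hypotheses (hp : 2 < p) (hq2 : 2 < q) (hqp : q < p / 2 + 1) (hq4 : q < 4).
Notation lam := (lam p q).
Notation amp_max := (amp_max p q).
Notation amp_peak := (amp_peak p q).
Notation soliton := (soliton p q).
Notation Mass := (Mass p q).
Notation E := (ground_energy p q).

Let Minc a b : 0 < a -> a < b -> in_range p q b -> Mass a < Mass b.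
Proof. exact: Mass_incr. Qed.

Let Mpeak a b : 0 < a -> a < b -> b <= amp_peak -> Mass a < Mass b.
Proof.
move=> a0 ab bp; apply: Minc; [exact: a0|exact: ab|].
apply: in_range_peak => //; exact: lt_trans ab.
Qed.

Let Mtan a l : 0 < a -> a <= amp_peak -> 0 <= l ->
  action p q l a <= crit p q a + (l - lam a) * Mass a / 2.
Proof. by move=> a0 ap; apply: soliton_tangent => //; exact: in_range_peak. Qed.

Let M0 a : 0 <= Mass a. Proof. exact: Mass_ge0. Qed.

Let peak0 : 0 < amp_peak. Proof. exact: amp_peak_gt0. Qed.
Let peak_max : amp_peak < amp_max. Proof. exact: amp_peak_lt. Qed.
Let in_peak : in_range p q amp_peak. Proof. exact: in_range_peak. Qed.

Lemma in_range_lt a : 0 < a -> a < amp_max -> in_range p q a.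
Proof. by move=> a0 am; split; [exact: a0|exact: ltW|left]. Qed.

Lemma peak_lt_max : p < 6 -> Mass amp_peak < Mass amp_max.
Proof. by move=> p6; apply: Minc => //; exact: in_range_max. Qed.

Lemma Mass_peak_gt0 : 0 < Mass amp_peak.
Proof.
have h : amp_peak / 2 < amp_peak by move: peak0; lra.
by apply: le_lt_trans (M0 (amp_peak / 2)) (Mpeak _ h (lexx _)); rewrite divr_gt0.
Qed.

Definition representative a m := optimal p q Mass a m /\ E m = (level p q a m)%:E.

Lemma representative_lt m : 0 < m -> (p < 6 -> m < Mass amp_max) ->
  exists a, [/\ 0 < a, a < amp_max, Mass a = m & representative a m].
Proof.
move=> m0 hm; have [a [a0 am <-]] := Mass_surj hp hqp hq4 m0 hm.
have ar := in_range_lt a0 am.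
exists a; split; [exact: a0|exact: am|by []|split].
- exact: optimal_Mass.
- exact: ground_energy_Mass.
Qed.

Let level_max m : level p q amp_max m = crit p q amp_max.
Proof. by rewrite /level lam_max// !mul0r subr0. Qed.

Lemma ground_energy_max m : p < 6 -> Mass amp_max <= m -> E m = (crit p q amp_max)%:E.
Proof.
move=> p6; rewrite le_eqVlt => /orP[/eqP<-|mM]; last exact: ground_energy_beyond.
by rewrite (ground_energy_Mass hp hq2 hqp hq4 (in_range_max q hp p6)) level_max.
Qed.

Lemma representative_ge m : p < 6 -> Mass amp_max <= m -> representative amp_max m.
Proof.
move=> p6 mM; split; first exact: optimal_max.
by rewrite level_max; exact: ground_energy_max.
Qed.

Lemma representative_exists m : 0 < m -> exists a, representative a m.
Proof.
move=> m0; have [p6|p6] := ltP p 6; last first.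
  by have [|a [_ _ _ ra]] := representative_lt m0; [rewrite ltNge p6|exists a].
have [mM|mM] := ltP m (Mass amp_max).
  by have [a [_ _ _ ra]] := representative_lt m0 (fun _ => mM); exists a.
by exists amp_max; exact: representative_ge.
Qed.

Lemma ground_energy_lt0 m : 0 < m -> (E m < 0)%E.
Proof.
move=> m0; have [a [am ->]] := representative_exists m0.
rewrite lte_fin; apply: (level_lt0 hp hq2 hqp Mpeak M0 Mtan) am; exact: ltW.
Qed.

Lemma H1_zero : H1 (fun=> 0 : R).
Proof.
have c0 : continuous (fun _ : R => 0 : R) by exact: continuous_cstf.
have s0 : sqint (fun _ : R => 0 : R).
  split; first exact: measurable_cst.
  rewrite (_ : _ \o _ = cst 0%E); first exact: integrable0.
  by apply/funext => x /=; rewrite expr0n.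
apply: (H1_of_primitive c0 s0 s0) => a b; split; first exact: continuous_itg.
by move=> s t _ st _; rewrite subrr Rint_cst// mul0r.
Qed.

(** A function vanishing almost everywhere has zeros arbitrarily close to each point, and v is
    continuous. *)
Lemma zero_of_mass0 v : H1mass 0 v -> v = (fun=> 0).
Proof.
move=> vm; have [hv _] := vm; have v0 := H1mass_int vm.
have cv := H1_continuous hv; have ae := zero_of_sq_integral (H1_sqint hv) v0.
apply/funext => x; apply/eqP; rewrite -normr_eq0 -normr_le0; apply: (@le0_of_le_eps _ _ 1) => e e0.
rewrite mulr1; have /cvgrPdist_lt /(_ _ e0) [d /= d0 hd] := cv x.
have xd : x < x + d by rewrite ltrDl.
have [t /andP[xt td] vt] := ae_exists xd ae.
rewrite normr_id; apply: ltW; have := hd t; rewrite /= vt subr0; apply.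
by rewrite distrC gtr0_norm ?subr_gt0//; lra.
Qed.

Lemma ground_energy0 : E 0 = 0.
Proof.
have h0 := H1_zero; have s0 := H1_sqint h0.
have i0 : \int[mu]_x ((fun=> 0 : R) x ^+ 2) = 0.
  have -> : (fun x : R => (0 : R) ^+ 2) = (fun x => 0) by apply/funext => x; rewrite expr0n.
  by rewrite Rintegral_cst// mul0r.
have ip : powp_itg p (fun=> 0 : R).
  rewrite /powp_itg (_ : _ \o _ = cst 0%E); first exact: integrable0.
  by apply/funext => x /=; rewrite normr0 powR0// gt_eqF//; have := hp; lra.
have m0 : H1mass 0 (fun=> 0 : R) by split => //; apply/(mass_sq _ s0).
have e0 : energy p q (fun=> 0 : R) = 0.
  rewrite (energyE q hp h0 ip) /renergy normr0.
  have -> : \int[mu]_x (wderiv (fun=> 0 : R) x ^+ 2) = 0.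
    have pr a b : primitive_on a b (fun=> 0 : R) (fun=> 0).
      exact: (@primitive_C1 _ (fun=> 0) (fun=> 0) a b (is_derive_cstf 0) (@continuous_cstf _ 0)).
    rewrite -[RHS]i0; apply: eq_Rint_ae => //.
      by apply: measurable_funX; have [] := wderiv_sqint h0.
    by apply: ae_imp (wderiv_ae h0 s0 pr) => x -> _.
  have p0 : p != 0 by rewrite gt_eqF//; have := hp; lra.
  have q0 : q != 0 by rewrite gt_eqF//; have := hq2; lra.
  by rewrite !powR0// Rintegral_cst// mul0r !mulr0 addr0 subrr.
apply/eqP; rewrite eq_le; apply/andP; split.
  by rewrite -e0; apply: ereal_inf_lbound; exists (fun=> 0).
by apply: le_ereal_inf_tmp => _ [v /zero_of_mass0 -> <-]; rewrite e0.
Qed.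

Lemma ground_energy_decr m n : 0 <= m -> m < n -> (p < 6 -> n < Mass amp_max) ->
  (E n < E m)%E.
Proof.
move=> m0 mn hn; have n0 : 0 < n by exact: le_lt_trans mn.
move: m0; rewrite le_eqVlt => /orP[/eqP<-|m0].
  by rewrite ground_energy0; exact: ground_energy_lt0.
have [b [b0 bm _ [ob ->]]] := representative_lt n0 hn.
have [a [a0 am _ [oa ->]]] := representative_lt m0 (fun p6 => lt_trans mn (hn p6)).
by rewrite lte_fin; exact: (level_decr hp hq2 hqp Mpeak Mtan oa ob mn bm).
Qed.

Lemma ground_state_beyond m u : p < 6 -> 0 < m -> ground_state p q m u -> m <= Mass amp_max.
Proof.
move=> p6 m0 [um uE]; rewrite leNgt; apply/negP => mM.
have [om Em] := representative_ge p6 (ltW mM).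
have [_ H] := optimal_lower hp hq2 hqp hq4 om um.
have ar := in_range_max q hp p6.
have : m = Mass amp_max; last by move=> h; move: mM; rewrite h ltxx.
rewrite -(H1mass_int um); have [_ <-] := soliton_sq_itg hp hqp ar.
have [->//|->] := H (etrans uE Em).
by apply: eq_Rintegral => x _; rewrite fctE sqrrN.
Qed.

Lemma Mass_onto m : 0 < m -> (p < 6 -> m <= Mass amp_max) ->
  exists2 a, in_range p q a & Mass a = m.
Proof.
move=> m0 hm; have [[p6 mM]|h] := pselect (p < 6 /\ m = Mass amp_max).
  by exists amp_max => //; exact: in_range_max.
have hm' : p < 6 -> m < Mass amp_max.
  move=> p6; rewrite lt_neqAle hm// andbT; apply/eqP => mM; exact: h.
by have [a [a0 am aE]] := Mass_surj hp hqp hq4 m0 hm'; exists a => //; exact: in_range_lt.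
Qed.

Lemma ground_state_exists m : 0 < m -> (p < 6 -> m <= Mass amp_max) ->
  exists u, ground_state p q m u.
Proof.
move=> m0 hm; have [a ar <-] := Mass_onto m0 hm.
by exists (soliton a); exact: soliton_ground_state.
Qed.

Lemma ground_state_uniq m : 0 < m -> (p < 6 -> m <= Mass amp_max) ->
  ground_state_unique p q m.
Proof.
by move=> m0 hm; have [a ar <-] := Mass_onto m0 hm; exact: ground_states_unique.
Qed.

(** Calibration at frequency 0 gives E >= F_0(a), and F_0 decreases on (a, amp_max) because [lam] is
    positive there. *)
Lemma ground_energy_ge_min m : 6 <= p -> 0 < m -> ((action p q 0 amp_max)%:E <= E m)%E.
Proof.
move=> p6 m0; have [|a [a0 am aE [_ Em]]] := representative_lt m0; first by rewrite ltNge p6.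
have ar := in_range_lt a0 am.
rewrite Em -aE -(soliton_energy hp hq2 hqp ar).
rewrite (energyE _ hp (soliton_H1 hp hq2 hqp ar) (soliton_powp_itg hp hqp ar)).
rewrite (soliton_renergy hp hq2 hqp ar (lexx 0)) !mul0r subr0 lee_fin.
apply: (@le_trans _ _ (action p q 0 a)); last by rewrite lerDl divr_ge0// excess_ge0.
apply: ltW; apply: action_decr => //; first exact: ltW.
by move=> x ax xm; apply: lam_gt0 => //; exact: lt_trans ax.
Qed.

(** The infimum is over an empty set. The value makes the energy nonincreasing on the whole line, as
    the monotone limit at infinity requires. *)
Lemma ground_energy_neg m : m < 0 -> E m = +oo%E.
Proof.
move=> m0; apply/eqP; rewrite -leye_eq; apply: le_ereal_inf_tmp => z [v vm _]; exfalso.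
have h : 0 <= \int[mu]_x (v x ^+ 2) by apply: Rintegral_ge0 => x _; exact: sqr_ge0.
by move: h; rewrite (H1mass_int vm) leNgt m0.
Qed.

Lemma ground_energy_limit : 6 <= p ->
  exists2 l : \bar R, E m @[m --> +oo] --> l & (-oo < l)%E.
Proof.
move=> p6; exists (ereal_inf (range E)).
  apply: nonincreasing_cvge => x y; rewrite le_eqVlt => /orP[/eqP->//|xy].
  have [x0|x0] := leP 0 x; first by apply: ltW; apply: ground_energy_decr => //; rewrite ltNge p6.
  by rewrite (ground_energy_neg x0) leey.
apply: (@lt_le_trans _ _ (Num.min 0 (action p q 0 amp_max))%:E); first exact: ltNyr.
apply: le_ereal_inf_tmp => _ [m _ <-].
have [m0|m0|<-] := ltgtP 0 m.
- by apply: (le_trans _ (ground_energy_ge_min p6 m0)); rewrite lee_fin ge_min lexx orbT.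
- by rewrite (ground_energy_neg m0) leey.
- by rewrite ground_energy0 lee_fin ge_min lexx.
Qed.

Lemma ground_energy_fin m : 0 <= m -> E m \is a fin_num.
Proof.
rewrite le_eqVlt => /orP[/eqP<-|m0]; first by rewrite ground_energy0.
by have [a [_ ->]] := representative_exists m0.
Qed.

(** The support inequality at the convex combination z is averaged at x and y; its linear part
    cancels. *)
Lemma convex_of_support (I : interval R) (f : R -> R) :
  (forall z, z \in I -> exists k, forall x, x \in I -> f z + k * (x - z) <= f x) ->
  convex_on I f.
Proof.
move=> H t x y /set_mem /= xI /set_mem /= yI; rewrite !convRE /unstable.onem.
have t0 : 0 <= t%:num by [].
have t1 : t%:num <= 1 by [].
have -> : f (conv t x y) = f (t%:num * (x : R) + (1 - t%:num) * (y : R)) by [].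
move: (t%:num) t0 t1 => s s0 s1; pose z : R := s * x + (1 - s) * y.
have zI : z \in I.
  have h1 : 0 <= s * `|x - y| by exact: mulr_ge0.
  have h2 : 0 <= (1 - s) * `|x - y| by apply: mulr_ge0 => //; rewrite subr_ge0.
  have [xy|yx] := leP x y.
    apply: (@interval_is_interval _ I x y) => //; rewrite distrC ger0_norm ?subr_ge0// in h1 h2.
    by rewrite /z; apply/andP; split; lra.
  apply: (@interval_is_interval _ I y x) => //; rewrite gtr0_norm ?subr_gt0// in h1 h2.
  by rewrite /z; apply/andP; split; lra.
have [k hk] := H z zI; have hx := hk x xI; have hy := hk y yI.
have h1 : s * (f z + k * (x - z)) <= s * f x by exact: ler_wpM2l.
have h2 : (1 - s) * (f z + k * (y - z)) <= (1 - s) * f y by apply: ler_wpM2l => //; rewrite subr_ge0.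
have : s * (f z + k * (x - z)) + (1 - s) * (f z + k * (y - z)) = f z by rewrite /z; ring.
rewrite -/z; lra.
Qed.

Lemma ground_energy_concave : concave_on `[0, Mass amp_peak] (fun m => fine (E m)).
Proof.
have rep m : 0 < m -> m <= Mass amp_peak -> exists2 a, a <= amp_peak & representative a m.
  move=> m0 mM.
  have [p6|a [a0 am aE ra]] := representative_lt m0.
    exact: le_lt_trans mM (peak_lt_max p6).
  exists a => //; rewrite leNgt; apply/negP => pa.
  by have := Minc peak0 pa (in_range_lt a0 am); rewrite aE ltNge mM.
(* Mass 0 has no representative; there the horizontal line supports the opposite of E, which
   vanishes at 0 and is nonnegative. *)
apply: convex_of_support => z; rewrite in_itv/= => /andP[]; rewrite le_eqVlt => /orP[/eqP<- _|z0 zM].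
  exists 0 => x; rewrite in_itv/= => /andP[]; rewrite le_eqVlt => /orP[/eqP<- _|x0 _].
    by rewrite mul0r addr0.
  rewrite ground_energy0 /= mul0r addr0 oppr0 oppr_ge0.
  have := ground_energy_lt0 x0; have [a [_ ->]] := representative_exists x0.
  by rewrite lte_fin => /ltW.
have [a ap [oa Ea]] := rep z z0 zM.
(* At the endpoint x = 0 the support inequality amounts to [crit a >= 0]; elsewhere it is
   [level_concave]. *)
exists (lam a / 2) => x; rewrite in_itv/= => /andP[]; rewrite le_eqVlt => /orP[/eqP<- _|x0 xM].
  rewrite ground_energy0 Ea /= oppr0 sub0r mulrN /level.
  have [a0 _ _ _ _] := oa; have := crit_ge0 hp hq2 hqp (ltW a0) ap.
  move: (crit _ _ _) (lam a) => c la; lra.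
have [b bp [ob Eb]] := rep x x0 xM.
rewrite Ea Eb /=; have := level_concave hp hq2 hqp Mpeak Mtan ap bp oa ob.
move: (level _ _ _ _) (level _ _ _ _) (lam a) => c d la; lra.
Qed.

Lemma ground_energy_convex : convex_on `[Mass amp_peak, +oo[ (fun m => fine (E m)).
Proof.
have Mp0 := Mass_peak_gt0.
have rep m : Mass amp_peak <= m -> exists2 a, amp_peak <= a & representative a m.
  move=> mM; have m0 := lt_le_trans Mp0 mM.
  have [[p6 Mm]|h] := pselect (p < 6 /\ Mass amp_max <= m).
    by exists amp_max; [exact: ltW|exact: representative_ge].
  have [p6|a [a0 am aE ra]] := representative_lt m0.
    by rewrite ltNge; apply/negP => h'; exact: h.
  exists a => //; rewrite leNgt; apply/negP => pa.
  by have := Minc a0 pa in_peak; rewrite aE ltNge mM.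
apply: convex_of_support => z; rewrite in_itv/= andbT => zM.
have [a ap [oa Ea]] := rep z zM.
exists (- (lam a / 2)) => x; rewrite in_itv/= andbT => xM.
have [b bp [ob Eb]] := rep x xM.
rewrite Ea Eb /=; have := level_convex hp hq2 hqp ap bp oa ob.
move: (level _ _ _ _) (level _ _ _ _) (lam a) => c d la; lra.
Qed.

End GroundEnergyCurve.

Unset Implicit Arguments.
Set Strict Implicit.

Theorem theorem1p5 (R : realType) (p q : R) (hp : 2 < p)
    (hq : 2 < q < Num.min 4 (p / 2 + 1)) :
  [/\ p < 6 ->
        (forall mu : R, 0 < mu -> (ground_energy p q mu < 0)%E) /\
        (exists m : R,
          [/\ is_threshold_mass p q m,
              strictly_decreasing_on `[0, m[ (ground_energy p q),
              (forall mu : R, m <= mu ->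
                 ground_energy p q mu = ground_energy p q m),
              (forall mu : R, 0 < mu ->
                 ((exists u : R -> R, ground_state p q mu u) <-> mu <= m))
            & (forall mu : R, 0 < mu <= m -> ground_state_unique p q mu)]),
      6 <= p ->
        [/\ (forall mu : R, 0 < mu -> (ground_energy p q mu < 0)%E),
            strictly_decreasing_on `[0, +oo[ (ground_energy p q),
            (exists2 l : \bar R,
               ground_energy p q mu @[mu --> +oo] --> l & (-oo < l)%E)
          & (forall mu : R, 0 < mu ->
               (exists u : R -> R, ground_state p q mu u) /\
               ground_state_unique p q mu)]
    & exists mubar : R,
        [/\ 0 < mubar,
            (forall mu : R, 0 <= mu -> ground_energy p q mu \is a fin_num),
            concave_on `[0, mubar] (fun mu => fine (ground_energy p q mu))
          & convex_on `[mubar, +oo[ (fun mu => fine (ground_energy p q mu))]].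
Proof.
have [hq2 hq4 hqp] : [/\ 2 < q, q < 4 & q < p / 2 + 1].
  by move: hq => /andP[h]; rewrite lt_min => /andP[].
split.
- move=> p6; split; first by move=> m m0; exact: ground_energy_lt0.
  have ar := in_range_max q hp p6.
  exists (Mass p q (amp_max p q)); split.
  + split; last by move=> m m0; exact: bound_state_iff.
    exact: lt_trans (Mass_peak_gt0 hp hq2 hqp hq4) (peak_lt_max hp hq2 hqp hq4 p6).
  + move=> x y; rewrite !in_itv/= => /andP[x0 _] /andP[_ yM] xy.
    exact: ground_energy_decr.
  + by move=> m mM; rewrite !ground_energy_max.
  + move=> m m0; split; first by move=> [u]; exact: ground_state_beyond.
    by move=> mM; exact: ground_state_exists.
  + by move=> m /andP[m0 mM]; exact: ground_state_uniq.
- move=> p6; have np6 : p < 6 -> False by rewrite ltNge p6.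
  split.
  + by move=> m m0; exact: ground_energy_lt0.
  + move=> x y; rewrite !in_itv/= => /andP[x0 _] _ xy.
    by apply: ground_energy_decr => // /np6.
  + exact: ground_energy_limit.
  + by move=> m m0; split; [apply: ground_state_exists|apply: ground_state_uniq] => // /np6.
- exists (Mass p q (amp_peak p q)); split.
  + exact: Mass_peak_gt0.
  + by move=> m; exact: ground_energy_fin.
  + exact: ground_energy_concave.
  + exact: ground_energy_convex.
Qed.
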